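(* Let $\beta>0$ and $\nu\in\mathbb{R}$ be fixed. There is an algorithm that, given a line graph $L(\Gamma)$ and a tolerance $\delta>0$, outputs a spin configuration $\sigma:V(L(\Gamma))\to\{0,1\}$ drawn from a distribution whose total variation distance from the Gibbs distribution $\mathcal{D}_{L(\Gamma),\beta,\nu}$ is at most $\delta$. The running time of the algorithm is bounded by a polynomial in $\log\delta^{-1}$ and the size of the instance.
   Context: For a finite simple undirected graph $G$ and $\beta,\nu\in\mathbb{R}$, define for $\sigma:V(G)\to\{0,1\}$ the weight $w(\sigma)=\prod_{\{i,j\}\in E(G)}\exp\big(\beta|\sigma(i)-\sigma(j)|\big)\prod_{k\in V(G)}\exp(\nu\sigma(k))$ and $Z_{\beta,\nu}(G)=\sum_{\sigma}w(\sigma)$. The Gibbs distribution $\mathcal{D}_{G,\beta,\nu}$ assigns probability $w(\sigma)/Z_{\beta,\nu}(G)$ to $\sigma$. The line graph $L(\Gamma)$ of a graph $\Gamma$ has vertex set $E(\Gamma)$, with distinct $e,f\in E(\Gamma)$ adjacent iff they share an endpoint. *)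

(* Defs.v *)
From HB Require Import structures.
From mathcomp Require Import all_boot all_order all_algebra.
From mathcomp Require Import all_classical all_reals all_analysis.

Set Implicit Arguments.
Unset Strict Implicit.
Unset Printing Implicit Defensive.

Import Order.TTheory GRing.Theory Num.Theory.
Local Open Scope ring_scope.

Record sgraph := SGraph {
  vertex :> finType;
  adj : rel vertex;
  adj_sym : symmetric adj;
  adj_irrefl : irreflexive adj }.

Definition edges (G : sgraph) : {set {set G}} :=
  [set e : {set G} | [exists x, exists y, adj x y && (e == [set x; y])]].

Section LineGraph.
Variable G : sgraph.

Definition line_vertex := {e : {set G} | e \in edges G}.

Definition line_adj : rel line_vertex :=
  fun e f => (e != f) && (val e :&: val f != finset.set0).

Lemma line_adj_sym : symmetric line_adj.
Proof. by move=> e f; rewrite /line_adj eq_sym finset.setIC. Qed.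

Lemma line_adj_irrefl : irreflexive line_adj.
Proof. by move=> e; rewrite /line_adj eqxx. Qed.

Definition line_graph : sgraph := SGraph line_adj_sym line_adj_irrefl.

End LineGraph.

Section Ising.
Variables (R : realType) (beta nu : R) (G : sgraph).
Implicit Types sigma : {ffun G -> bool}.

(* The condition on [enum_rank] selects one orientation of each edge. *)
Definition weight sigma : R :=
  (\prod_(ij : G * G | adj ij.1 ij.2 && (enum_rank ij.1 < enum_rank ij.2)%N)
     expR (beta * `|(sigma ij.1)%:R - (sigma ij.2)%:R|)) *
  \prod_(k : G) expR (nu * (sigma k)%:R).

Definition partition_function : R := \sum_sigma weight sigma.

Definition gibbs sigma : R := weight sigma / partition_function.

End Ising.

Definition tv_distance (R : realType) (T : finType) (P Q : T -> R) : R :=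
  2^-1 * \sum_x `|P x - Q x|.

(* Probabilistic random access machine. The registers hold natural numbers and
   are initially 0; the input is a read-only list of words; real-number data
   are available only through oracles returning approximations. Arithmetic is
   restricted to addition, truncated subtraction and halving, so word lengths
   grow by at most one bit per step and unit cost is polynomially related to
   bit cost. *)
Inductive cmd : Type :=
  | CSkip
  | CConst of nat & nat
  | CAdd of nat & nat & nat
  | CSub of nat & nat & nat
  | CHalf of nat & nat
  | CFetch of nat & nat
  | CStore of nat & nat
  | CRead of nat & nat
  | CQuery of nat & nat & nat
  | CFlip of nat
  | CSeq of cmd & cmd
  | CIf of nat & cmd & cmd
  | CWhile of nat & cmd.

Record config := Config {
  todo : seq cmd;
  regs : nat -> nat;
  cost : nat }.

Definition upd (m : nat -> nat) (d v : nat) : nat -> nat :=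
  fun i => if i == d then v else m i.

Section Semantics.
Variables (input : seq nat) (oracles : seq (nat -> nat)).

(* An oracle call with precision k is charged k plus the length of the answer;
   everything else has unit cost. Each step is supplied with a random bit,
   which only [CFlip] uses. *)
Definition step (cf : config) (bit : bool) : config :=
  let: Config s m t := cf in
  match s with
  | [::] => cf
  | c :: s' =>
    let put d v := Config s' (upd m d v) t.+1 in
    match c with
    | CSkip => Config s' m t.+1
    | CConst d k => put d k
    | CAdd d a b => put d (m a + m b)%N
    | CSub d a b => put d (m a - m b)%N
    | CHalf d a => put d (m a)./2
    | CFetch d a => put d (m (m a))
    | CStore a b => put (m a) (m b)
    | CRead d a => put d (nth 0%N input (m a))
    | CQuery d o a =>
        let v := nth (fun=> 0%N) oracles o (m a) in
        Config s' (upd m d v) (t + (m a + trunc_log 2 v).+1)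
    | CFlip d => put d (nat_of_bool bit)
    | CSeq c1 c2 => Config [:: c1, c2 & s'] m t.+1
    | CIf a c1 c2 => Config ((if m a == 0%N then c2 else c1) :: s') m t.+1
    | CWhile a c1 =>
        Config (if m a == 0%N then s' else [:: c1, c & s']) m t.+1
    end
  end.

Definition run (A : cmd) (bits : seq bool) : config :=
  foldl step (Config [:: A] (fun=> 0%N) 0%N) bits.

(* Worst case over the random bits. As every step costs at least 1, a
   computation of cost at most T uses at most T random bits. *)
Definition runs_in_time (A : cmd) (T : nat) : Prop :=
  forall bits : T.-tuple bool,
    nilp (todo (run A bits)) /\ (cost (run A bits) <= T)%N.

End Semantics.

(* Adjacency matrix of G with respect to the listing s of its vertices,
   preceded by the number of vertices. *)
Definition graph_code (G : sgraph) (s : seq G) : seq nat :=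
  size s :: [seq nat_of_bool (adj x y) | x <- s, y <- s].

(* The spin of the i-th vertex of s is read off register i. *)
Definition output_config (G : sgraph) (s : seq G) (cf : config) :
    {ffun G -> bool} :=
  [ffun v => regs cf (index v s) != 0%N].

(* Law of the output when the T random bits are uniform. *)
Definition output_law (R : realType) (G : sgraph) (s : seq G)
    (oracles : seq (nat -> nat)) (A : cmd) (T : nat)
    (sigma : {ffun G -> bool}) : R :=
  #|[pred bits : T.-tuple bool |
      output_config s (run (graph_code s) oracles A bits) == sigma]|%:R
  / 2 ^+ T.

(* phi k / 2 ^ k approximates the nonnegative real x to within 2 ^ -k. *)
Definition dyadic_name (R : realType) (phi : nat -> nat) (x : R) : Prop :=
  forall k : nat, `|x - (phi k)%:R / 2 ^+ k| <= 2 ^- k.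

(* Main.v *)
Require Import Defs.
From HB Require Import structures.
From mathcomp Require Import all_boot all_order all_algebra.
From mathcomp Require Import ring lra zify.

(** Metropolis single-spin dynamics on a line graph has a polynomial spectral
    gap for every [beta > 0], so a machine that simulates it with coins of
    exponentially small error samples from the Gibbs distribution.

    The gap is a Poincare inequality. With [x] and [y] the numbers of half-edges
    of either spin at a vertex of [Gamma], the weight of a configuration is the
    product over the vertices of [exp (beta x y)], times a field. For two
    replicas [s] and [s + D], the product of the weights is
    [prod_v exp (2 beta x_v y_v)], with the counts restricted to [D], up to a
    factor that flips inside [D] do not change. Moreover [exp (t x y)] is a sum
    over the partial matchings of half-edges of opposite spin at the vertex, a
    matching with [j] pairs having weight [j!] times the divided difference of
    [u |-> exp (t u)] at the nodes [i (d - i)], [i <= j], where [d = x + y]; these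
    weights are positive and almost log-concave in [j].

    A matching at every vertex cuts [D] into trails. Flipping a whole trail
    keeps the matched pairs opposite, and flipping it edge by edge breaks at most
    two pairs at a time, which are removed from the matching. These paths lead
    from [s] to [s + D] and bound the variance by the Dirichlet form, except near
    matchings that have a vertex where an additional pair would multiply the
    weight by a large factor but one spin has hardly any free half-edge. There
    one flips instead the trail of a free half-edge of the other spin and adds a
    pair: the gain makes the contribution of these matchings a small fraction of
    the variance. *)

Set Implicit Arguments.
Unset Strict Implicit.
Unset Printing Implicit Defensive.

Import Order.TTheory GRing.Theory Num.Theory.
Local Open Scope ring_scope.

(** * Half-edges, partial matchings and trails *)

(** The obstacle is that removing one pair can be ruinous: [w d j.+1 / w d j] is only bounded by
    [t * expR ((d - j.*2.+1)%:R * t)], exponential in the number of free half-edges. The curvature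
    bound [w d j.+1 ^+ 2 <= kap * w d j * w d j.+2] helps in this direction: the ratio
    [w d j / w d j.+1] drops by at most the factor [kap] when [j] decreases by one, so where a
    removal is expensive, a further pair is profitable by about the same factor. Removing one pair
    and adding another keeps the weight; this needs free half-edges of both spins, and bad vertices
    are those where one spin has run out. A path changes the matching by boundedly many toggles, and
    each toggle is a bijection of the families of matchings. Summing over all possible toggles thus
    replaces the injective encoding usual for canonical paths. [theta] is of the order of the
    inverse fourth power of the number of half-edges, so that the bad part is at most one of the two
    copies of the variance that the replicas produce. In the program a single number [M] is both the
    number of steps and the precision, and powers of [expR (- beta)] are realised by repeated tosses
    of one coin. *)

Section Flip.
Variable E : finType.
Implicit Types (s : {ffun E -> bool}) (X Y : {set E}).

Definition flip s X : {ffun E -> bool} := [ffun e => s e (+) (e \in X)].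

Lemma flipK X : involutive (flip^~ X).
Proof. by move=> s; apply/ffunP => e; rewrite !ffunE -addbA addbb addbF. Qed.

Lemma flip0 s : flip s set0 = s.
Proof. by apply/ffunP => e; rewrite ffunE inE addbF. Qed.

Lemma flipU s X Y : [disjoint X & Y] -> flip s (X :|: Y) = flip (flip s X) Y.
Proof.
move=> /pred0P dXY; apply/ffunP => e; rewrite !ffunE inE.
by have := dXY e; rewrite /=; case: (e \in X); case: (e \in Y); rewrite ?addbF // addbT.
Qed.

Lemma flip_inj X : injective (flip^~ X).
Proof. exact: inv_inj (flipK X). Qed.

Lemma flip_sum (R : nmodType) X (F : {ffun E -> bool} -> R) :
  \sum_s F (flip s X) = \sum_s F s.
Proof. by rewrite [RHS](reindex_inj (@flip_inj X)). Qed.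

Lemma flip_sum_set (R : nmodType) s (F : {ffun E -> bool} -> R) :
  \sum_X F (flip s X) = \sum_s F s.
Proof.
rewrite [RHS](reindex (flip s)) //=.
exists (fun s' => [set e | s e (+) s' e]) => [X _|s' _].
  by apply/setP => e; rewrite !inE !ffunE addbA addbb.
by apply/ffunP => e; rewrite !ffunE inE addbA addbb.
Qed.

End Flip.

Section HalfEdges.
Variables (E V : finType) (vt : E * bool -> V) (D : {set E}).
Local Notation H := (E * bool)%type.
Implicit Types (s x : {ffun E -> bool}) (M : {ffun H -> H}) (h a b g : H) (v : V).
Implicit Types J : {ffun V -> {ffun H -> H}}.

(* The half-edge [(e, b)] is the end of [e] at the vertex [vt (e, b)]. A partial
   matching is an involution of the half-edges; its fixed points are free. *)
Definition half_at v h := (vt h == v) && (h.1 \in D).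

Definition deg v := #|[set h | half_at v h]|.

Definition local_matching v M :=
  [forall h, (M (M h) == h) && ((M h != h) ==> half_at v h)].

Definition opposite s M := [forall h, (M h != h) ==> (s h.1 != s (M h).1)].

Definition moved M := [set h | M h != h].

Definition matching J := [forall v, local_matching v (J v)].

Definition compatible s J := [forall v, opposite s (J v)].

Definition partner J h := J (vt h) h.

Definition cross h : H := (h.1, ~~ h.2).

(** Traverses an edge and passes to the partner of its far end. At a free end [partner] is the
    identity, so the walk turns back along the same edge; for a matching [next] is therefore a
    permutation. *)
Definition next J h := partner J (cross h).

(* Separates [a] and [b] if they form a pair and pairs them if both are free:
   an involution, hence a reindexing of sums over matchings. *)
Definition local_toggle a b M : {ffun H -> H} :=
  if [&& a != b, M a == b & M b == a]
  then [ffun h => if (h == a) || (h == b) then h else M h]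
  else if (M a == a) && (M b == b)
  then [ffun h => if h == a then b else if h == b then a else M h]
  else M.

Definition toggle a b J : {ffun V -> {ffun H -> H}} :=
  [ffun v => if v == vt a then local_toggle a b (J v) else J v].

Lemma local_toggleK a b : involutive (local_toggle a b).
Proof.
move=> M; rewrite {2}/local_toggle.
case: ifPn => [/and3P[ab /eqP Ma /eqP Mb]|nab].
  rewrite /local_toggle !ffunE !eqxx /= orbT /= (negbTE ab) /= eqxx.
  apply/ffunP => h; rewrite !ffunE.
  by case: eqVneq => [->//|_]; case: eqVneq => [->|].
case: ifPn => [/andP[/eqP Ma /eqP Mb]|nf]; last first.
  by rewrite /local_toggle (negbTE nab) (negbTE nf).
have [eab|ab] := eqVneq a b.
  rewrite /local_toggle eab eqxx !ffunE !eqxx /=.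
  apply/ffunP => h; rewrite !ffunE.
  by case: eqVneq => [->//|].
have ba : (b == a) = false by rewrite eq_sym (negbTE ab).
rewrite /local_toggle ab !ffunE !eqxx ba /= !eqxx /=.
apply/ffunP => h; rewrite !ffunE; case: eqVneq => [->//|ha] /=.
by case: eqVneq => [->//|].
Qed.

Lemma toggleK a b : involutive (toggle a b).
Proof.
move=> J; apply/ffunP => v; rewrite !ffunE.
by case: ifPn => [/eqP-> | /negbTE->]; rewrite ?eqxx ?local_toggleK.
Qed.

(** Degenerate toggles are no-ops, so that labels of a fixed shape also encode fewer changes. *)
Lemma toggle_id a J : toggle a a J = J.
Proof.
apply/ffunP => v; rewrite ffunE; case: ifP => // _.
rewrite /local_toggle eqxx /=; case: ifP => // /andP[/eqP Ma _].
by apply/ffunP => h; rewrite ffunE; case: eqVneq => [->|].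
Qed.

Lemma crossK : involutive cross.
Proof. by case=> e b; rewrite /cross /= negbK. Qed.

Section Matching.
Variable J : {ffun V -> {ffun H -> H}}.
Hypothesis mJ : matching J.

Lemma matchingP v h : J v (J v h) = h /\ (J v h != h -> half_at v h).
Proof.
move/forallP/(_ v)/forallP/(_ h): mJ => /andP[/eqP -> /implyP].
by split.
Qed.

Lemma partner_at h : partner J h != h -> half_at (vt h) h.
Proof. by case: (matchingP (vt h) h). Qed.

Lemma partner_D h : partner J h != h -> h.1 \in D.
Proof. by move=> /partner_at/andP[]. Qed.

Lemma vt_partner h : vt (partner J h) = vt h.
Proof.
have [//|Mh] := eqVneq (partner J h) h; first by move=> ->.
have [JJ _] := matchingP (vt h) h.
have [_ /(_ _)/andP[|/eqP //]] := matchingP (vt h) (partner J h).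
by rewrite /partner JJ eq_sym.
Qed.

Lemma partnerK : involutive (partner J).
Proof.
by move=> h; rewrite {1}/partner vt_partner; case: (matchingP (vt h) h).
Qed.

Lemma partner_D2 h : partner J h != h -> (partner J h).1 \in D.
Proof.
by move=> nh; apply: partner_D; rewrite partnerK eq_sym.
Qed.

Lemma partnerE v h : vt h = v -> J v h = partner J h.
Proof. by move=> <-. Qed.

Lemma moved_vt v h : J v h != h -> vt h = v.
Proof. by case: (matchingP v h) => _ /[apply] /andP[/eqP]. Qed.

Lemma compatibleP s :
  reflect (forall h, partner J h != h -> s h.1 != s (partner J h).1)
          (compatible s J).
Proof.
apply: (iffP forallP) => [cJ h nh|cJ v].
  by move/forallP/(_ h)/implyP: (cJ (vt h)); apply.
apply/forallP => h; apply/implyP => nh.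
by have vh := moved_vt nh; rewrite (partnerE vh) in nh *; apply: cJ.
Qed.

Lemma next_inj : injective (next J).
Proof. by move=> a b /(inv_inj partnerK)/(inv_inj crossK). Qed.

Lemma cross_nextE h : partner J (next J h) = cross h.
Proof. exact: partnerK. Qed.

End Matching.

Lemma toggle_sumE (R : nmodType) a b (F : {ffun V -> {ffun H -> H}} -> R) :
  \sum_J F (toggle a b J) = \sum_J F J.
Proof. by rewrite [RHS](reindex_inj (inv_inj (toggleK a b))). Qed.

Lemma partner_toggle_rem J a h : matching J -> partner J a != a ->
  partner (toggle a (partner J a) J) h =
  if (h == a) || (h == partner J a) then h else partner J h.
Proof.
move=> mJ na; rewrite /partner ffunE.
have [vh|nv] := eqVneq (vt h) (vt a).
  rewrite vh /local_toggle eq_sym -/(partner J a) na eqxx /=.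
  by rewrite -{1}(vt_partner mJ a) -/(partner J _) partnerK // eqxx ffunE.
case: eqVneq => [ha|_] /=; first by rewrite ha eqxx in nv.
by case: eqVneq => // hb; rewrite hb vt_partner ?eqxx in nv.
Qed.

Lemma partner_toggle_add J a b h : matching J -> vt a = vt b -> a != b ->
  partner J a = a -> partner J b = b ->
  partner (toggle a b J) h =
  if h == a then b else if h == b then a else partner J h.
Proof.
move=> mJ vab nab pa pb; rewrite /partner ffunE.
have [vh|nv] := eqVneq (vt h) (vt a).
  have Ja : J (vt a) a = a by [].
  have Jb : J (vt a) b = b by rewrite vab.
  by rewrite vh /local_toggle nab Ja Jb (negbTE nab) /= !eqxx ffunE.
case: eqVneq => [ha|_] /=; first by rewrite ha eqxx in nv.
by case: eqVneq => // hb; rewrite hb vab eqxx in nv.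
Qed.

Lemma toggle_remP J a : matching J -> partner J a != a ->
  let J' := toggle a (partner J a) J in
  [/\ matching J', forall v, v != vt a -> J' v = J v &
      moved (J' (vt a)) = moved (J (vt a)) :\: [set a; partner J a] /\
      #|moved (J (vt a))| = (#|moved (J' (vt a))| + 2)%N].
Proof.
move=> mJ na J'.
have vb := vt_partner mJ a.
have J'E : J' (vt a) =
    [ffun h => if (h == a) || (h == partner J a) then h else J (vt a) h].
  rewrite ffunE eqxx /local_toggle eq_sym -/(partner J a) na eqxx /=.
  by rewrite -{1}(vt_partner mJ a) -/(partner J _) partnerK // eqxx.
have mvE : moved (J' (vt a)) = moved (J (vt a)) :\: [set a; partner J a].
  apply/setP => h; rewrite !inE J'E ffunE.
  by case: ifP => // _; rewrite ?eqxx.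
have oth v : v != vt a -> J' v = J v by move=> /negbTE nv; rewrite ffunE nv.
split=> //; last first.
  split=> //; rewrite mvE cardsDS.
    have c2 : #|[set a; partner J a]| = 2 by rewrite cards2 eq_sym na.
    rewrite c2 subnK // -c2.
    apply/subset_leq_card/subsetP => h; rewrite !inE => /orP[]/eqP-> //.
    by rewrite -vb -/(partner J _) partnerK // eq_sym.
  apply/subsetP => h; rewrite !inE => /orP[]/eqP-> //.
  by rewrite -vb -/(partner J _) partnerK // eq_sym.
apply/forallP => v; have [->|nv] := eqVneq v (vt a); last first.
  by rewrite oth //; move/forallP: mJ.
apply/forallP => h; have [JJ Jn] := matchingP mJ (vt a) h.
rewrite J'E !ffunE; have [hab|nh] := boolP ((h == a) || (h == partner J a)).
  by rewrite hab !eqxx.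
have -> : ((J (vt a) h == a) || (J (vt a) h == partner J a)) = false.
  apply: contraNF nh => /orP[]/eqP E1.
    by apply/orP; right; rewrite -JJ E1 eqxx.
  apply/orP; left; rewrite -JJ E1; apply/eqP.
  by rewrite -vb -/(partner J _) partnerK.
by rewrite JJ eqxx; apply/implyP.
Qed.

Lemma toggle_addP J a b : matching J -> vt a = vt b -> a != b ->
  partner J a = a -> partner J b = b -> a.1 \in D -> b.1 \in D ->
  let J' := toggle a b J in
  [/\ matching J', forall v, v != vt a -> J' v = J v &
      #|moved (J' (vt a))| = (#|moved (J (vt a))| + 2)%N].
Proof.
move=> mJ vab nab pa pb aD bD J'.
have Ja : J (vt a) a = a by [].
have Jb : J (vt a) b = b by rewrite vab.
have J'E : J' (vt a) =
    [ffun h => if h == a then b else if h == b then a else J (vt a) h].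
  by rewrite ffunE eqxx /local_toggle nab Ja Jb (negbTE nab) /= !eqxx.
have mvE : moved (J' (vt a)) = [set a; b] :|: moved (J (vt a)).
  apply/setP => h; rewrite !inE J'E ffunE.
  have [->|ha] := eqVneq h a; first by rewrite eq_sym nab.
  by have [->|hb] := eqVneq h b; rewrite ?nab.
have oth v : v != vt a -> J' v = J v by move=> /negbTE nv; rewrite ffunE nv.
split=> //; last first.
  rewrite mvE cardsU (_ : _ :&: _ = set0) ?cards0 ?subn0 ?cards2 ?nab 1?addnC //.
  apply/setP => h; rewrite !inE.
  by case: eqVneq => [->|_] /=; [rewrite Ja eqxx | case: eqVneq => [->|//]; rewrite Jb eqxx].
apply/forallP => v; have [->|nv] := eqVneq v (vt a); last first.
  by rewrite oth //; move/forallP: mJ.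
apply/forallP => h; have [JJ Jn] := matchingP mJ (vt a) h.
rewrite J'E !ffunE.
have [->|ha] := eqVneq h a.
  by rewrite eqxx [b == a]eq_sym (negbTE nab) eqxx /= /half_at eqxx aD.
have [->|hb] := eqVneq h b.
  by rewrite eqxx eqxx /= /half_at vab eqxx bD implybT.
have -> : (J (vt a) h == a) = false.
  by apply: contraNF ha => /eqP E1; rewrite -JJ E1 Ja.
have -> : (J (vt a) h == b) = false.
  by apply: contraNF hb => /eqP E1; rewrite -JJ E1 Jb.
by rewrite JJ eqxx; apply/implyP.
Qed.

End HalfEdges.

(** * Trails: orbits of the walk through a matching *)

Section Trails.
Variables (E V : finType) (vt : E * bool -> V) (D : {set E}).
Local Notation H := (E * bool)%type.
Local Notation matching := (matching vt D).
Local Notation partner := (partner vt).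
Local Notation next := (next vt).
Variable J : {ffun V -> {ffun H -> H}}.
Hypothesis mJ : matching J.
Implicit Types (s : {ffun E -> bool}) (h : H).

(** As a set, so an edge that the walk meets once from either end is still flipped only once. *)
Definition trail h k : {set E} := [set (iter i (next J) h).1 | i : 'I_k].

Lemma trailP h k e :
  reflect (exists2 i, (i < k)%N & e = (iter i (next J) h).1) (e \in trail h k).
Proof.
apply: (iffP imsetP) => [[i _ ->]|[i ik ->]]; first by exists i.
by exists (Ordinal ik).
Qed.

Lemma trailS h k : trail h k.+1 = (iter k (next J) h).1 |: trail h k.
Proof.
apply/setP => e; rewrite in_setU1; apply/trailP/orP => [[i]|[/eqP->|/trailP[i ik ->]]].
- rewrite ltnS leq_eqVlt => /orP[/eqP-> ->|ik ->]; first by left.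
  by right; apply/trailP; exists i.
- by exists k.
- by exists i => //; apply: ltnW.
Qed.

Lemma trail0 h : trail h 0 = set0.
Proof. by apply/setP => e; rewrite inE; apply/trailP => -[]. Qed.

Lemma trail_sub h k : h.1 \in D -> trail h k \subset D.
Proof.
move=> hD; apply/subsetP => e /trailP[i _ ->].
elim: i => //= i IH; rewrite {1}/next.
have [-> //|nx] := eqVneq (partner J (cross (iter i (next J) h))) (cross (iter i (next J) h)).
exact: partner_D2 nx.
Qed.

Lemma half_in_trail h k a : a.1 \in trail h k ->
  exists2 i, (i < k)%N & (a = iter i (next J) h) \/ (a = cross (iter i (next J) h)).
Proof.
case/trailP => i ik ai; exists i => //.
case: a ai => a0 a1 /=; case: (iter i _ h) => e b /= ->.
by case: a1; case: b; rewrite /cross /=; [left|right|right|left].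
Qed.

(* Flipping a prefix of a trail can only break the pair at its head and the
   pair at its tail. *)
Lemma trail_closed_except h k a : a.1 \in trail h k ->
  [\/ (partner J a).1 \in trail h k, a = h |
      [/\ (0 < k)%N, a = cross (iter k.-1 (next J) h) &
          partner J a = iter k (next J) h]].
Proof.
case/half_in_trail => i ik [->|->].
  case: i ik => [|i] ik; first by apply: Or32.
  apply: Or31; apply/trailP; exists i; first exact: ltnW.
  by rewrite iterS (cross_nextE mJ).
have [ik1|] := ltnP i.+1 k; first by apply: Or31; apply/trailP; exists i.+1.
rewrite leq_eqVlt ltnNge ik orbF => /eqP kE.
by apply: Or33; rewrite kE.
Qed.

Definition closed_set (U : {set E}) :=
  forall h, h.1 \in U -> (partner J h).1 \in U.

(** The length is at least the order of every orbit, so the whole orbit is covered. Being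
    independent of [J], it gives all paths the same number of steps. *)
Definition full_trail h := trail h #|{: H}|.

Lemma full_trailE h i : (iter i (next J) h).1 \in full_trail h.
Proof.
have co : fconnect (next J) h (iter i (next J) h) by exact: fconnect_iter.
apply/trailP; exists (findex (next J) h (iter i (next J) h)).
  by apply: leq_trans (findex_max co) _; apply: max_card.
by rewrite iter_findex.
Qed.

Lemma full_trail_closed h : closed_set (full_trail h).
Proof.
move=> a /half_in_trail[i ik [->|->]]; last exact: (full_trailE h i.+1).
case: i ik => [|i] ik; last by rewrite iterS (cross_nextE mJ); apply: full_trailE.
have := iter_order (next_inj mJ) h; rewrite -orderSpred iterS /= => hE.
by rewrite -{1}hE (cross_nextE mJ); apply: full_trailE.
Qed.

Lemma closed_trail U h k : closed_set U -> h.1 \in U -> trail h k \subset U.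
Proof.
move=> cU hU; apply/subsetP => e /trailP[i _ ->].
by elim: i => //= i IH; apply: cU.
Qed.

Lemma closedC U : closed_set U -> closed_set (~: U).
Proof.
move=> cU h; rewrite !inE; apply: contra => pU.
by rewrite -(partnerK mJ h); apply: cU.
Qed.

Lemma closedU U1 U2 : closed_set U1 -> closed_set U2 -> closed_set (U1 :|: U2).
Proof.
by move=> c1 c2 h; rewrite !inE => /orP[/c1->|/c2->]; rewrite ?orbT.
Qed.

Lemma compatible_flip s U : closed_set U ->
  compatible (flip s U) J = compatible s J.
Proof.
move=> cU.
suff imp s' : compatible s' J -> compatible (flip s' U) J.
  by apply/idP/idP => /imp; rewrite ?flipK.
move=> /(compatibleP mJ) cJ; apply/(compatibleP mJ) => h /cJ; rewrite !ffunE.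
have -> : ((partner J h).1 \in U) = (h.1 \in U).
  by apply/idP/idP => [/cU|/cU//]; rewrite (partnerK mJ).
by case: (h.1 \in U); rewrite ?addbF // !addbT; case: (s' _); case: (s' _).
Qed.

(* A trail has at most two free ends: [partner] acts on the orbit of a free
   half-edge as a reflection. *)
Lemma free_in_trail h k :
  (#|[set a | (partner J a == a) && (a.1 \in trail h k)]| <= 2)%N.
Proof.
set F := [set a | _].
have orb a : a \in F -> exists i, a = iter i (next J) h.
  rewrite inE => /andP[/eqP fa /half_in_trail[i _ [->|aE]]]; first by exists i.
  by exists i.+1; rewrite iterS /next -aE fa.
have [->|[a aF]] := set_0Vmem F; first by rewrite cards0.
have refl i c : partner J c = c -> iter i (next J) (partner J (iter i (next J) c)) = c.
  move=> fc; elim: i => //= i IH.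
  by rewrite -iterS iterSr (cross_nextE mJ) {2}/next crossK.
set N := order (next J) a.
suff sub : F \subset [set a; iter N./2 (next J) a].
  by apply: leq_trans (subset_leq_card sub) _; rewrite cards2; case: (_ == _).
apply/subsetP => b bF; rewrite !inE.
have inj := next_inj mJ.
have ab : fconnect (next J) a b.
  have [i ai] := orb a aF; have [j bj] := orb b bF.
  apply: (@connect_trans _ _ h); last by rewrite bj fconnect_iter.
  by rewrite fconnect_sym // ai fconnect_iter.
have kN := findex_max ab; have bE := iter_findex ab.
move: kN bE; set k' := findex _ _ _ => kN bE.
have fa : partner J a = a by move: aF; rewrite inE => /andP[/eqP].
have fb : partner J b = b by move: bF; rewrite inE => /andP[/eqP].
(* As [b] is free, [refl] says that [k'] more steps lead from [b] back to [a]. So the order [N]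
   divides [2 k'], and [k' < N] leaves [2 k' = 0] or [2 k' = N]. *)
have per : iter (k' + k') (next J) a = a.
  by have := refl k' a fa; rewrite bE fb iterD bE.
have min0 i : (i < N)%N -> iter i (next J) a = a -> i = 0%N.
  by move=> iN ia; rewrite -(findex_iter iN) ia findex0.
have [lt|ge] := ltnP (k' + k') N.
  have /eqP := min0 _ lt per; rewrite addn_eq0 => /andP[/eqP k0 _].
  by rewrite -bE k0 eqxx.
have : (k' + k' - N)%N = 0%N.
  apply: min0; first by move: kN ge; rewrite -/N; lia.
  by rewrite -{2}per -{2}(subnK ge) iterD iter_order.
move=> /eqP; rewrite subn_eq0 => le.
have -> : N = k'.*2 by apply/eqP; rewrite eqn_leq -addnn le ge.
by rewrite doubleK bE eqxx orbT.
Qed.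

End Trails.

(** * Energy along trails *)

Lemma half_addn2 q d j : (q + 2 <= d)%N -> q./2 = j.+1 -> (j.+2.*2 <= d)%N.
Proof. by move=> qd qj; have := odd_double_half q; rewrite qj; lia. Qed.

Section Weights.
Variables (R : realFieldType) (E V : finType) (vt : E * bool -> V) (D : {set E}).
Local Notation H := (E * bool)%type.
Local Notation matching := (matching vt D).
Local Notation partner := (partner vt).
Local Notation next := (next vt).
Local Notation deg := (deg vt D).
Local Notation half_at := (half_at vt D).
Local Notation toggle := (toggle vt).
Local Notation trail := (trail vt).
Variables (w : nat -> nat -> R) (kap theta : R).
Hypothesis w_gt0 : forall d j, (j.*2 <= d)%N -> 0 < w d j.
Hypothesis w_curv : forall d j, (j.+2.*2 <= d)%N ->
  w d j.+1 ^+ 2 <= kap * w d j * w d j.+2.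
Hypothesis w_few : forall d j, (d <= #|{: H}|)%N -> (j.+1.*2 <= d)%N ->
  (d <= j.*2 + 22)%N -> theta * w d j.+1 <= w d j.
Hypothesis theta_gt0 : 0 < theta.
Hypothesis theta_le1 : theta <= 1.
Hypothesis kap_ge1 : 1 <= kap.
Implicit Types (s x : {ffun E -> bool}) (h a b g : H) (v u : V).
Implicit Types J : {ffun V -> {ffun H -> H}}.

Let kap_gt0 : 0 < kap. Proof. exact: lt_le_trans ltr01 kap_ge1. Qed.

Definition pairs J v := (#|moved (J v)|)./2.
Definition local_weight J v := w (deg v) (pairs J v).
Definition match_weight J := \prod_v local_weight J v.

Definition free J v := [set h | half_at v h && (partner J h == h)].
Definition free_spin s J v c := [set h in free J v | s h.1 == c].

(* At a big vertex one more pair multiplies the weight by more than [theta^-1];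
   if it is bad, hardly any free half-edge has the spin such a pair needs. *)
Definition big_vertex J v :=
  (#|moved (J v)| + 2 <= deg v)%N &&
  (w (deg v) (pairs J v) < theta * w (deg v) (pairs J v).+1).

Definition bad_vertex r s J v :=
  big_vertex J v && [exists c, (#|free_spin s J v c| <= r)%N].

Definition bad r s J := [exists v, bad_vertex r s J v].

(** Removing a pair at [v] multiplies the weight by at least [eta]; vacuously true when there is no
    pair. *)
Definition loss_ok eta J v :=
  (#|moved (J v)| < 2)%N || (eta * w (deg v) (pairs J v) <= w (deg v) (pairs J v).-1).

Lemma moved_deg J v : matching J -> (#|moved (J v)| <= deg v)%N.
Proof.
move=> mJ; apply/subset_leq_card/subsetP => h; rewrite !inE => nh.
by case: (matchingP mJ v h) => _; apply.
Qed.

Lemma pairs_deg J v : matching J -> ((pairs J v).*2 <= deg v)%N.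
Proof.
move=> mJ; apply: leq_trans (moved_deg v mJ).
by rewrite /pairs; have := odd_double_half #|moved (J v)|; lia.
Qed.

Lemma local_weight_gt0 J v : matching J -> 0 < local_weight J v.
Proof. by move=> mJ; apply/w_gt0/pairs_deg. Qed.

Lemma match_weight_gt0 J : matching J -> 0 < match_weight J.
Proof. by move=> mJ; apply: prodr_gt0 => v _; apply: local_weight_gt0. Qed.

Lemma card_free J v : matching J -> #|free J v| = (deg v - #|moved (J v)|)%N.
Proof.
move=> mJ; rewrite -cardsDS; last first.
  apply/subsetP => h; rewrite !inE => nh.
  by case: (matchingP mJ v h) => _; apply.
apply: eq_card => h; rewrite !inE negbK andbC.
case: (boolP (half_at v h)); rewrite ?andbF // !andbT => /andP[/eqP <- _].
by [].
Qed.

Lemma card_free_spin s J v c :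
  #|free J v| = (#|free_spin s J v c| + #|free_spin s J v (~~ c)|)%N.
Proof.
rewrite -cardsUI (_ : _ :&: _ = set0) ?cards0 ?addn0; last first.
  apply/setP => h; rewrite !inE; case: (half_at v h && _) => //=.
  by case: (s h.1); case: c.
apply: eq_card => h; rewrite !inE; case: (half_at v h && _) => //=.
by case: (s h.1); case: c.
Qed.

Lemma match_weight_change J J' u c : matching J -> matching J' ->
  (forall v, v != u -> J' v = J v) ->
  c * local_weight J u <= local_weight J' u ->
  c * match_weight J <= match_weight J'.
Proof.
move=> mJ mJ' eqJ le; rewrite /match_weight [X in _ * X](bigD1 u) //= [X in _ <= X](bigD1 u) //= mulrA.
rewrite [X in _ * X <= _](eq_bigr (local_weight J')); last first.
  by move=> v nv; rewrite /local_weight /pairs eqJ.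
apply: ler_wpM2r => //; apply: prodr_ge0 => v _.
exact/ltW/local_weight_gt0.
Qed.

Lemma loss_okW eta eta' J v : matching J -> eta' <= eta ->
  loss_ok eta J v -> loss_ok eta' J v.
Proof.
move=> mJ le /orP[lt|ok]; apply/orP; [by left|right].
apply: le_trans ok; apply: ler_wpM2r => //.
exact/ltW/(local_weight_gt0 v mJ).
Qed.

Lemma loss_ok_eq eta J J' v : J' v = J v -> loss_ok eta J v -> loss_ok eta J' v.
Proof. by rewrite /loss_ok /pairs => ->. Qed.

(** If [theta * w d j.+2 <= w d j.+1], the curvature bound yields [theta * w d j.+1 <= kap * w d j].
    If no further pair fits, at most one half-edge is free and [w_few] applies. *)
Lemma not_big_loss_ok J v : matching J -> ~~ big_vertex J v ->
  loss_ok (theta / kap) J v.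
Proof.
move=> mJ; rewrite /big_vertex negb_and -leNgt /loss_ok.
case: ltnP => //= m2; have md := moved_deg v mJ.
have d_le : (deg v <= #|{: H}|)%N by apply: max_card.
have [j jE] : exists j, pairs J v = j.+1.
  by rewrite /pairs; case: #|moved (J v)| m2 => [|[|q]] //= _; exists q./2.
have pd := pairs_deg v mJ; rewrite jE /= in pd *.
have wj0 : 0 < w (deg v) j by apply: w_gt0; lia.
have wj1 : 0 < w (deg v) j.+1 by apply: w_gt0.
case: ltnP => /= [dlt _|m2d ok].
  have le : theta * w (deg v) j.+1 <= w (deg v) j.
    apply: w_few => //; move: jE dlt; rewrite /pairs.
    by move: #|moved (J v)| (deg v) => q d jE; have := odd_double_half q; rewrite jE; case: odd; lia.
  apply: le_trans le; apply: ler_wpM2r; first exact: ltW.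
  by rewrite ler_pdivrMr // ler_peMr // ltW.
have d2 : (j.+2.*2 <= deg v)%N.
  move: jE m2d; rewrite /pairs; move: #|moved (J v)| (deg v) => q d jE.
  by have := odd_double_half q; rewrite jE; case: odd; lia.
have wj2 := w_gt0 d2.
have c := w_curv d2.
rewrite mulrAC ler_pdivrMr //.
rewrite -(ler_pM2r wj2) -mulrA [X in _ <= X](_ : _ = kap * w (deg v) j * w (deg v) j.+2); last by ring.
apply: le_trans c; rewrite expr2 mulrCA ler_wpM2l // ltW //.
Qed.

(** Among the free half-edges only the ends of the trail change their spin. This is why the
    thresholds 3 and 5 of [bad] differ by two. *)
Lemma flip_free_spin s J h0 k v c : matching J ->
  (#|free_spin s J v c| <= #|free_spin (flip s (trail J h0 k)) J v c| + 2)%N.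
Proof.
move=> mJ; set F := [set a | (partner J a == a) && (a.1 \in trail J h0 k)].
have F2 : (#|F| <= 2)%N := free_in_trail mJ h0 k.
apply: leq_trans (leq_add (leqnn _) F2).
apply: leq_trans (leq_card_setU _ _).
apply/subset_leq_card/subsetP => h; rewrite !inE ffunE.
move=> /andP[/andP[-> ->] /eqP ->] /=.
by case: (h.1 \in _); rewrite ?orbT // addbF eqxx.
Qed.

Lemma not_bad_ok r s J h0 k v : matching J -> ~~ bad_vertex r.+2 s J v ->
  loss_ok (theta / kap) J v \/
  forall c, (r < #|free_spin (flip s (trail J h0 k)) J v c|)%N.
Proof.
move=> mJ; rewrite /bad_vertex negb_and => /orP[nb|nb].
  by left; apply: not_big_loss_ok.
right=> c; move/existsPn/(_ c): nb; rewrite -ltnNge => lt.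
by have := flip_free_spin s h0 k v c mJ; lia.
Qed.

(** If the loss is affordable, the pair of [a] is just removed. Otherwise free half-edges [g] and
    [g'] of opposite spins are paired at the same vertex, which restores the number of pairs and
    hence the weight. Only pairs inherited from [J] can fail to be opposite for [x]. The last clause
    keeps the hypothesis alive for a second removal, at the price of a factor [kap] or of one free
    half-edge of each spin. *)
Lemma remove_pair x J a eta r : matching J -> 0 < eta -> eta <= 1 ->
  loss_ok eta J (vt a) \/ (forall c, (r < #|free_spin x J (vt a) c|)%N) ->
  exists g g' b, let J' := toggle g g' (toggle a b J) in
  [/\ matching J', eta * match_weight J <= match_weight J', partner J' a = a,
      forall h, partner J' h != h ->
        [/\ partner J' h = partner J h, h != a & h != partner J a] \/
        x h.1 != x (partner J' h).1 &
      forall v, loss_ok eta J v \/ (forall c, (r < #|free_spin x J v c|)%N) ->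
        loss_ok (eta / kap) J' v \/ (forall c, (r.-1 < #|free_spin x J' v c|)%N) \/ r = 0%N].
Proof.
move=> mJ eta0 eta1 ok.
have ek : eta / kap <= eta by rewrite ler_pdivrMr // ler_peMr // ltW.
have [fa|na] := eqVneq (partner J a) a.
  exists a, a, a; rewrite !toggle_id; split=> //.
  - by rewrite ler_piMl // ltW // match_weight_gt0.
  - move=> h nh; left; rewrite fa.
    by have ha : h != a by apply: contraNneq nh => ->; rewrite fa eqxx.
  - move=> v [okv|okv]; [left; exact: loss_okW okv|right].
    by case: r {ok} okv => [|r] okv; [right|left => c; apply: ltnW].
set b := partner J a; set J1 := toggle a b J.
have [mJ1 J1v [mv1 cm1]] := toggle_remP mJ na.
have pJ1 h : partner J1 h = if (h == a) || (h == b) then h else partner J h.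
  exact: (partner_toggle_rem h mJ na).
have fsub v c : free_spin x J v c \subset free_spin x J1 v c.
  apply/subsetP => h; rewrite !inE pJ1 => /andP[/andP[-> ph] ->].
  by rewrite andbT /=; case: ifP.
have mvJ : (2 <= #|moved (J (vt a))|)%N by rewrite cm1 addn2.
case: ok => [okl|okf].
  exists a, a, b; rewrite toggle_id -/J1; split=> //.
  - apply: (match_weight_change mJ mJ1 J1v); rewrite /local_weight.
    case/orP: okl => [|okl]; first by rewrite ltnNge mvJ.
    rewrite (_ : pairs J1 (vt a) = (pairs J (vt a)).-1) //.
    by rewrite /pairs cm1 addn2.
  - by rewrite pJ1 eqxx.
  - move=> h; rewrite pJ1; case: ifP; first by rewrite eqxx.
    by move=> /negbT; rewrite negb_or => /andP[ha hb]; left.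
  move=> v [okv|okv]; last first.
    right; case: r okv => [|r] okv; [by right|left => c].
    by apply: leq_trans (subset_leq_card (fsub v c)); apply: ltnW.
  left; have [->|nv] := eqVneq v (vt a); last first.
    by apply: (@loss_ok_eq _ J); [exact: J1v|exact: loss_okW okv].
  case/orP: okl => [|okl]; first by rewrite ltnNge mvJ.
  rewrite /loss_ok; case: ltnP => //= m1.
  have [j jE] : exists j, pairs J1 (vt a) = j.+1.
    by rewrite /pairs; case: #|moved (J1 (vt a))| m1 => [|[|q]] //= _; exists q./2.
  have j2E : pairs J (vt a) = j.+2.
    by rewrite -jE /pairs cm1 addn2.
  have d2 := pairs_deg (vt a) mJ.
  rewrite j2E /= in okl d2; rewrite jE /=.
  have wj1 : 0 < w (deg (vt a)) j.+1 by apply: w_gt0; apply: leq_trans d2; rewrite leq_double.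
  have wj2 := w_gt0 d2.
  have wj : 0 < w (deg (vt a)) j.
    by apply: w_gt0; apply: leq_trans d2; rewrite leq_double; apply: ltnW.
  have cv := w_curv d2.
  rewrite mulrAC ler_pdivrMr //.
  rewrite -(ler_pM2r wj1) -mulrA -expr2.
  apply: le_trans (ler_wpM2l (ltW eta0) cv) _.
  rewrite (_ : eta * _ = w (deg (vt a)) j * kap * (eta * w (deg (vt a)) j.+2)); last by ring.
  by apply: ler_wpM2l => //; rewrite mulr_ge0 // ltW.
have [g gF] : exists g, g \in free_spin x J (vt a) true.
  by apply/set0Pn; rewrite -card_gt0; apply: leq_ltn_trans (okf true).
have [g' gF'] : exists g, g \in free_spin x J (vt a) false.
  by apply/set0Pn; rewrite -card_gt0; apply: leq_ltn_trans (okf false).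
move: gF; rewrite !inE => /andP[/andP[/andP[/eqP vg gD] /eqP pg] /eqP xg].
move: gF'; rewrite !inE => /andP[/andP[/andP[/eqP vg' gD'] /eqP pg'] /eqP xg'].
have gg' : g != g' by apply/eqP => e; rewrite e xg' in xg.
have fr1 h : partner J h = h -> partner J1 h = h by rewrite pJ1 => ->; case: ifP.
have vgg : vt g = vt g' by rewrite vg vg'.
have [mJ2 J2v cm2] := toggle_addP mJ1 vgg gg' (fr1 _ pg) (fr1 _ pg') gD gD'.
exists g, g', b; set J2 := toggle g g' J1.
rewrite -/J2 in mJ2 J2v cm2.
have pJ2 h : partner J2 h = if h == g then g' else if h == g' then g else partner J1 h.
  by apply: (partner_toggle_add h mJ1 vgg gg'); apply: fr1.
have nga h : partner J h = h -> a != h.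
  by move=> ph; apply: contraNneq na => ->; rewrite ph.
have ngb h : partner J h = h -> b != h.
  move=> ph; apply: contraNneq na => bh.
  by rewrite -/b bh -ph -bh (partnerK mJ) eqxx.
have cmE v : #|moved (J2 v)| = #|moved (J v)|.
  have [->|nv] := eqVneq v (vt a); first by rewrite -vg cm2 vg cm1.
  by rewrite J2v ?vg // J1v.
have lwE v : loss_ok eta J2 v = loss_ok eta J v by rewrite /loss_ok /pairs cmE.
split=> //.
- apply: le_trans (_ : match_weight J <= _); last first.
    by apply: ler_prod => v _; rewrite ltW ?local_weight_gt0 //= /local_weight /pairs cmE.
  by rewrite ler_piMl // ltW // match_weight_gt0.
- by rewrite pJ2 (negbTE (nga _ pg)) (negbTE (nga _ pg')) pJ1 eqxx.
- move=> h; rewrite pJ2; have [->|hg] := eqVneq h g; first by right; rewrite xg xg'.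
  have [->|hg'] := eqVneq h g'; first by right; rewrite xg xg'.
  rewrite pJ1; case: ifP; first by rewrite eqxx.
  by move=> /negbT; rewrite negb_or => /andP[ha hb] _; left.
move=> v [okv|okv]; first by left; apply: (loss_okW mJ2 ek); rewrite lwE.
right; case: r {okf} okv => [|r] okv; [by right|left => c /=].
have sub : free_spin x J v c :\ (if c then g else g') \subset free_spin x J2 v c.
  apply/subsetP => h; rewrite !inE pJ2 => /and3P[hn /andP[-> ph] /eqP xc].
  rewrite /= xc eqxx andbT.
  have hg : (h == g) = false.
    by apply/eqP => hg; move: hn; rewrite -xc hg xg eqxx.
  have hg' : (h == g') = false.
    by apply/eqP => hg'; move: hn; rewrite -xc hg' xg' eqxx.
  by rewrite hg hg' pJ1; case: ifP.
have h1 := okv c; rewrite (cardsD1 (if c then g else g')) in h1.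
apply: leq_trans (subset_leq_card sub); move: h1.
by case: (_ \in _) => /=; rewrite ?add1n ?add0n ?ltnS // => /ltnW.
Qed.

(* One step along a trail changes the matching by at most four toggles. *)
Definition label := ((H * H) * (H * H) * ((H * H) * (H * H)))%type.

Definition relabel (l : label) J :=
  toggle l.1.1.1 l.1.1.2 (toggle l.1.2.1 l.1.2.2
    (toggle l.2.1.1 l.2.1.2 (toggle l.2.2.1 l.2.2.2 J))).

(** A fixed label permutes the families of matchings, so summing over all labels costs only the
    factor [#|{: label}|], and no inverse of the path construction has to be exhibited. *)
Lemma relabel_sum (l : label) (F : {ffun V -> {ffun H -> H}} -> R) :
  \sum_J F (relabel l J) = \sum_J F J.
Proof.
rewrite /relabel; rewrite -[RHS](toggle_sumE vt l.1.1.1 l.1.1.2).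
rewrite -[RHS](toggle_sumE vt l.1.2.1 l.1.2.2).
rewrite -[RHS](toggle_sumE vt l.2.1.1 l.2.1.2).
by rewrite -[RHS](toggle_sumE vt l.2.2.1 l.2.2.2).
Qed.

Lemma broken_pair s J h0 k h : matching J -> compatible s J ->
  partner J h != h ->
  flip s (trail J h0 k) h.1 = flip s (trail J h0 k) (partner J h).1 ->
  [\/ h = h0, h = partner J h0 |
   (0 < k)%N /\ (h = cross (iter k.-1 (next J) h0) \/
                 h = partner J (cross (iter k.-1 (next J) h0)))].
Proof.
move=> mJ /(compatibleP mJ) cJ nh; have := cJ h nh; rewrite !ffunE.
have [hT|hT] := boolP (h.1 \in trail J h0 k).
  have [pT|->|[k0 -> _] _ _] := trail_closed_except mJ hT.
  - by rewrite pT !addbT => + /negb_inj => /eqP.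
  - by move=> _ _; apply: Or31.
  - by apply: Or33; split=> //; left.
have [pT|pT] := boolP ((partner J h).1 \in trail J h0 k).
  have := trail_closed_except mJ pT; rewrite (partnerK mJ) (negbTE hT).
  case=> // [<-|[k0 <- _]] _ _; rewrite ?(partnerK mJ).
    by apply: Or32.
  by apply: Or33; split=> //; right.
by rewrite !addbF => + e; rewrite e eqxx.
Qed.

(** Two removals, at the head [h0] and at the tail [a], clear the pairs that the flipped prefix
    breaks. Where the loss is not affordable, the threshold 3 leaves, after the at most two spins
    changed by the flip, more than one free half-edge of each spin for the first removal and more
    than none for the second. *)
Lemma path_not_bad s J h0 k : matching J -> compatible s J -> ~~ bad 3 s J ->
  exists l : label, let J' := relabel l J in
  [/\ matching J', compatible (flip s (trail J h0 k)) J' &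
      (theta / kap) * (theta / kap / kap) * match_weight J <= match_weight J'].
Proof.
move=> mJ cJ /existsPn nb; set x := flip s _.
have tk0 : 0 < theta / kap by rewrite divr_gt0.
have tk1 : theta / kap <= 1 by rewrite ler_pdivrMr // mul1r (le_trans theta_le1).
have tkk0 : 0 < theta / kap / kap by rewrite divr_gt0.
have tkk1 : theta / kap / kap <= 1 by rewrite ler_pdivrMr // mul1r (le_trans tk1).
have ok v : loss_ok (theta / kap) J v \/ forall c, (1 < #|free_spin x J v c|)%N.
  exact: (@not_bad_ok 1).
have [g1 [g1' [b1 [mJ1 W1 _ c1 ok1]]]] := remove_pair mJ tk0 tk1 (ok (vt h0)).
set J1 := toggle g1 g1' _ in mJ1 W1 c1 ok1.
set a := cross (iter k.-1 (next J) h0).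
have ok1' v : loss_ok (theta / kap / kap) J1 v \/
              forall c, (0 < #|free_spin x J1 v c|)%N.
  by have [|[|//]] := ok1 v (ok v); [left|right].
have [g2 [g2' [b2 [mJ2 W2 _ c2 _]]]] := remove_pair mJ1 tkk0 tkk1 (ok1' (vt a)).
set J2 := toggle g2 g2' _ in mJ2 W2 c2.
exists ((g2, g2'), (a, b2), ((g1, g1'), (h0, b1))); split=> //; last first.
  rewrite mulrAC mulrC; apply: le_trans W2; apply: ler_wpM2l => //; exact: ltW.
rewrite /relabel /= -/J1 -/J2; apply/(compatibleP mJ2) => h nh.
have [[p2 ha hpa]|//] := c2 h nh.
have n1 : partner J1 h != h by rewrite -p2.
have [[p1 h0h hp0]|] := c1 h n1; last by rewrite p2.
have n0 : partner J h != h by rewrite -p1.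
rewrite p2 p1; apply/eqP => xe.
have [e|e|[k0 [e|e]]] := broken_pair mJ cJ n0 xe.
- by rewrite e eqxx in h0h.
- by rewrite e eqxx in hp0.
- by rewrite /a e eqxx in ha.
- case/eqP: hpa; rewrite -(partnerK mJ1 h) p1 e (partnerK mJ).
  by [].
Qed.

(* The vertex of [h0] has the least ratio [w d j / w d j.+1] among the bad ones,
   so that a pair added there pays for a pair removed at any of them. *)
Definition admissible s J h0 :=
  [&& partner J h0 == h0, h0.1 \in D, bad_vertex 5 s J (vt h0),
      [forall v, bad_vertex 5 s J v ==>
        (w (deg (vt h0)) (pairs J (vt h0)) * w (deg v) (pairs J v).+1 <=
         w (deg v) (pairs J v) * w (deg (vt h0)) (pairs J (vt h0)).+1)] &
      (2 < #|free_spin s J (vt h0) (s h0.1)|)%N].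

(** With at most 5 free half-edges of one spin, at least 17 have the other; the descent asks for
    three. The constant 22 in [w_few] provides this margin. *)
Lemma big_free J v : matching J -> big_vertex J v -> (21 < #|free J v|)%N.
Proof.
move=> mJ /andP[md lt]; rewrite card_free //.
have d_le : (deg v <= #|{: H}|)%N by apply: max_card.
have pE : ((pairs J v).*2 <= #|moved (J v)| <= (pairs J v).*2.+1)%N.
  rewrite /pairs; move: #|moved (J v)| => q.
  by have := odd_double_half q; case: odd; lia.
have [le|] := leqP (deg v) ((pairs J v).*2 + 22); last by lia.
have p2 : ((pairs J v).+1.*2 <= deg v)%N by lia.
by have := w_few d_le p2 le; rewrite leNgt lt.
Qed.

Lemma admissible_exists s J : matching J -> bad 5 s J ->
  exists h0, admissible s J h0.
Proof.
move=> mJ /existsP[v0 bv0].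
pose rt v := w (deg v) (pairs J v) / w (deg v) (pairs J v).+1.
have [u bu umin] := @Order.TotalTheory.arg_minP _ _ _ v0 (bad_vertex 5 s J) rt bv0.
have wS v : bad_vertex 5 s J v -> 0 < w (deg v) (pairs J v).+1.
  move=> /andP[/andP[md _] _]; apply: w_gt0; move: md; rewrite /pairs.
  by move: #|moved (J v)| => q; have := odd_double_half q; case: odd; lia.
have [bigu /existsP[c cle]] := andP bu.
have := big_free mJ bigu; rewrite (card_free_spin s J u c) => fr.
have c2 : (2 < #|free_spin s J u (~~ c)|)%N by lia.
have [h0] : exists h0, h0 \in free_spin s J u (~~ c).
  by apply/set0Pn; rewrite -card_gt0; lia.
rewrite !inE => /andP[/andP[/andP[/eqP vh hD] ph] /eqP sh].
exists h0; rewrite /admissible ph hD vh bu sh c2 /= andbT.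
apply/forallP => v; apply/implyP => bv.
have := umin v bv; rewrite /rt ler_pdivrMr ?wS // mulrAC ler_pdivlMr ?wS //.
Qed.

Section Descent.
Variables (s : {ffun E -> bool}) (J : {ffun V -> {ffun H -> H}}) (h0 : H).
Hypothesis mJ : matching J.
Hypothesis cJ : compatible s J.
Hypothesis ad : admissible s J h0.

Let u := vt h0.

Lemma adm_free : partner J h0 = h0. Proof. by case/and5P: ad => /eqP. Qed.
Lemma adm_D : h0.1 \in D. Proof. by case/and5P: ad. Qed.
Lemma adm_big : big_vertex J u. Proof. by case/and5P: ad => _ _ /andP[]. Qed.

(** More than two free half-edges at the vertex share the spin of [h0], and the trail contains at
    most two free ones, so some [g] lies off the trail. Flipping the trail makes [h0] and [g]
    opposite, ready to be paired. The prefix of length [k.+1] contains [h0] even for [k = 0], whence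
    [h0 != g]. *)
Lemma adm_next k : exists g, [/\ vt h0 = vt g, h0 != g, partner J g = g,
   g.1 \in D & (0 < k)%N ->
     flip s (trail J h0 k) h0.1 != flip s (trail J h0 k) g.1].
Proof.
have c3 : (2 < #|free_spin s J (vt h0) (s h0.1)|)%N by case/and5P: ad.
set F := [set a | (partner J a == a) && (a.1 \in trail J h0 k.+1)].
have F2 : (#|F| <= 2)%N := free_in_trail mJ h0 k.+1.
have hT : h0.1 \in trail J h0 k.+1 by apply/trailP; exists 0%N.
have [g gF gT] : exists2 g, g \in free_spin s J (vt h0) (s h0.1) & g \notin F.
  apply/subsetPn; apply: contraTN c3 => /subset_leq_card le.
  by rewrite -leqNgt (leq_trans le).
move: gF gT; rewrite !inE => /andP[/andP[/andP[/eqP vg gD] pg] /eqP sg].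
rewrite pg /= => gT; exists g; split=> //; last 2 first.
- exact/eqP.
- move=> k0; rewrite !ffunE.
  have -> : h0.1 \in trail J h0 k by apply/trailP; exists 0%N.
  have /negbTE -> : g.1 \notin trail J h0 k.
    by apply: contra gT; rewrite trailS inE => ->; rewrite orbT.
  by rewrite sg addbF addbT; case: (s h0.1).
by apply: contraNneq gT => <-.
Qed.

Lemma adm_toggle g : vt h0 = vt g -> h0 != g -> partner J g = g -> g.1 \in D ->
  let J1 := toggle h0 g J in
  [/\ matching J1, (forall v, v != u -> J1 v = J v), pairs J1 u = (pairs J u).+1,
   #|moved (J1 u)| = (#|moved (J u)| + 2)%N &
   match_weight J <= theta * match_weight J1].
Proof.
move=> vg hg pg gD J1.
have [mJ1 J1v cm] := toggle_addP mJ vg hg adm_free pg adm_D gD.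
have pS : pairs J1 u = (pairs J u).+1 by rewrite /pairs cm addn2.
split=> //; rewrite -ler_pdivrMl //.
apply: (match_weight_change mJ mJ1 J1v); rewrite ler_pdivrMl //.
by rewrite /local_weight pS; have /andP[_ /ltW] := adm_big.
Qed.

(** As [h0] is free, the flipped prefix breaks only the pair at the tail [a], while the pair of [h0]
    and [g] is gained. At [u] itself the removal cancels the addition. At a vertex that is not bad
    [remove_pair] applies. At another bad vertex the loss is outweighed, up to [kap], by the gain at
    [u], because [u] minimises the ratio. *)
Lemma path_admissible k :
  exists l : label, let J' := relabel l J in
  [/\ matching J', compatible (flip s (trail J h0 k)) J' &
      (theta / kap) * (theta / kap / kap) * match_weight J <= match_weight J'].
Proof.
have tk0 : 0 < theta / kap by rewrite divr_gt0.
have tk1 : theta / kap <= 1 by rewrite ler_pdivrMr // mul1r (le_trans theta_le1).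
have tkk1 : theta / kap / kap <= 1 by rewrite ler_pdivrMr // mul1r (le_trans tk1).
have W0 := match_weight_gt0 mJ.
have weaken J' : (theta / kap) * match_weight J <= match_weight J' ->
    (theta / kap) * (theta / kap / kap) * match_weight J <= match_weight J'.
  apply: le_trans; apply: ler_wpM2r; first exact: ltW.
  by rewrite ler_piMr // ltW.
have [->|k0] := posnP k.
  exists ((h0, h0), (h0, h0), ((h0, h0), (h0, h0))).
  rewrite /relabel /= !toggle_id trail0 flip0; split=> //.
  by apply: weaken; rewrite ler_piMl // ltW.
have [g [vg hg pg gD /(_ k0) xg]] := adm_next k.
set x := flip s _ in xg *.
have [mJ1 J1v pS cm1 W1] := adm_toggle vg hg pg gD.
set J1 := toggle h0 g J in mJ1 J1v pS cm1 W1.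
have W10 := match_weight_gt0 mJ1.
have W1' : match_weight J <= match_weight J1.
  by apply: le_trans W1 _; rewrite ler_piMl // ltW.
have pJ1 h : partner J1 h = if h == h0 then g else if h == g then h0 else partner J h.
  exact: (partner_toggle_add h mJ vg hg adm_free pg).
set a := cross (iter k.-1 (next J) h0).
have compat J' : matching J' ->
    (forall h, partner J' h != h ->
       [/\ partner J' h = partner J1 h, h != a & h != partner J a] \/
       x h.1 != x (partner J' h).1) -> compatible x J'.
  move=> mJ' c'; apply/(compatibleP mJ') => h nh.
  have [[p' ha hpa]|//] := c' h nh.
  rewrite p' pJ1; have [->|hh0] := eqVneq h h0; first exact: xg.
  have [->|hhg] := eqVneq h g; first by rewrite eq_sym.
  have n0 : partner J h != h by move: nh; rewrite p' pJ1 (negbTE hh0) (negbTE hhg).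
  apply/eqP => xe; have [e|e|[_ [e|e]]] := broken_pair mJ cJ n0 xe.
  - by rewrite e eqxx in hh0.
  - by rewrite e adm_free eqxx in hh0.
  - by rewrite /a e eqxx in ha.
  - by rewrite /a e eqxx in hpa.
have [fa|na] := eqVneq (partner J a) a.
  exists ((h0, h0), (h0, h0), ((h0, h0), (h0, g))).
  rewrite /relabel /= !toggle_id; split=> //; last first.
    by apply: weaken; apply: le_trans W1'; rewrite ler_piMl // ltW.
  apply: compat => // h nh; rewrite fa.
  have [ha|ha] := eqVneq h a; last by left.
  right; rewrite pJ1; move: nh; rewrite pJ1.
  have [-> _|hh0] := eqVneq h h0; first exact: xg.
  have [-> _|hhg] := eqVneq h g; first by rewrite eq_sym.
  by rewrite ha fa eqxx.
have ah0 : a != h0 by apply: contraNneq na => ->; rewrite adm_free.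
have ag : a != g by apply: contraNneq na => ->; rewrite pg.
have pa1 : partner J1 a = partner J a by rewrite pJ1 (negbTE ah0) (negbTE ag).
have na1 : partner J1 a != a by rewrite pa1.
have [mJ2 J2v [_ cm2]] := toggle_remP mJ1 na1.
have compat2 : compatible x (toggle a (partner J1 a) J1).
  apply: compat => // h; rewrite (partner_toggle_rem h mJ1 na1).
  case: ifP; first by rewrite eqxx.
  by move=> /negbT; rewrite negb_or pa1 => /andP[ha hb] _; left.
set J2 := toggle a (partner J1 a) J1 in mJ2 J2v cm2 compat2.
have [va|va] := eqVneq (vt a) u.
  exists ((h0, h0), (h0, h0), ((a, partner J1 a), (h0, g))).
  rewrite /relabel /= !toggle_id -/J1 -/J2; split=> //.
  apply: weaken; apply: le_trans (_ : match_weight J <= _).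
    by rewrite ler_piMl // ltW.
  apply: ler_prod => v _; rewrite ltW ?(local_weight_gt0 v mJ) //=.
  rewrite /local_weight /pairs; have [->|nv] := eqVneq v u.
    by move: cm1; rewrite -va cm2 => /addIn ->.
  by rewrite J2v ?va // J1v.
have J1w : J1 (vt a) = J (vt a) by apply: J1v.
have [bw|nbw] := boolP (bad_vertex 5 s J (vt a)); last first.
  have ok : loss_ok (theta / kap) J1 (vt a) \/
            forall c, (0 < #|free_spin x J1 (vt a) c|)%N.
    have := @not_bad_ok 3 s J h0 k (vt a) mJ nbw.
    case=> [okl|okf]; [left; exact: loss_ok_eq okl|right => c].
    apply: leq_ltn_trans (leq0n 3) (leq_trans (okf c) _).
    apply/subset_leq_card/subsetP => h; rewrite !inE pJ1.
    case/andP => /andP[ha ph] ->.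
    have vh : vt h = vt a by case/andP: ha => /eqP.
    rewrite ha !andbT /=.
    have [hh0|_] := eqVneq h h0; first by rewrite -vh hh0 eqxx in va.
    have [hg'|//] := eqVneq h g; by rewrite -vh hg' -vg eqxx in va.
  have [g2 [g2' [b2 [mJ3 W3 _ c3 _]]]] := remove_pair mJ1 tk0 tk1 ok.
  exists ((h0, h0), (g2, g2'), ((a, b2), (h0, g))).
  rewrite /relabel /= !toggle_id -/J1; split=> //.
    by apply: compat => // h nh; rewrite -pa1; apply: c3.
  apply: weaken; apply: le_trans W3; apply: ler_wpM2l => //; exact: ltW.
exists ((h0, h0), (h0, h0), ((a, partner J1 a), (h0, g))).
rewrite /relabel /= !toggle_id -/J1 -/J2; split=> //.
have /forallP/(_ (vt a))/implyP/(_ bw) : [forall v, bad_vertex 5 s J v ==>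
        (w (deg u) (pairs J u) * w (deg v) (pairs J v).+1 <=
         w (deg v) (pairs J v) * w (deg u) (pairs J u).+1)].
  by case/and5P: ad.
have p2 : pairs J (vt a) = (pairs J2 (vt a)).+1.
  by rewrite /pairs -J1w cm2 addn2.
rewrite p2; set j := pairs J2 (vt a); set d := deg (vt a).
set wu := w (deg u) (pairs J u); set wu1 := w (deg u) (pairs J u).+1 => mn.
have d2 : (j.+2.*2 <= d)%N.
  case/andP: bw => /andP[md _] _; move: md p2; rewrite -/d -/j /pairs.
  exact: half_addn2.
have wj : 0 < w d j by apply: w_gt0; apply: leq_trans d2; rewrite leq_double; apply: ltnW.
have wj1 : 0 < w d j.+1 by apply: w_gt0; apply: leq_trans d2; rewrite leq_double.
have wj2 : 0 < w d j.+2 by apply: w_gt0.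
have wu0 : 0 < wu by exact: (local_weight_gt0 u mJ).
have wu10 : 0 < wu1 by rewrite /wu1 -pS; exact: (local_weight_gt0 u mJ1).
have st1 : (wu1 / wu) * match_weight J <= match_weight J1.
  apply: (match_weight_change mJ mJ1 J1v).
  by rewrite /local_weight pS -/wu -/wu1 divfK // gt_eqF.
have st2 : (w d j / w d j.+1) * match_weight J1 <= match_weight J2.
  apply: (match_weight_change mJ1 mJ2 J2v).
  rewrite /local_weight -/j -/d (_ : pairs J1 (vt a) = j.+1); last by rewrite /pairs J1w.
  by rewrite divfK // gt_eqF.
apply: le_trans (_ : kap^-1 * match_weight J <= _).
  apply: ler_wpM2r; first exact: ltW.
  rewrite -[leRHS]mul1r; apply: ler_pM; [exact: ltW|by rewrite ltW // divr_gt0| by []|].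
  rewrite -[leRHS]mul1r; apply: ler_wpM2r => //; by rewrite invr_ge0 ltW.
apply: le_trans st2; apply: le_trans (ler_wpM2l _ st1); last by rewrite divr_ge0 // ltW.
rewrite mulrA; apply: ler_wpM2r; first exact: ltW.
rewrite mulf_div ler_pdivlMr ?mulr_gt0 // mulrC ler_pdivrMr //.
(* The chain is [wu / wu1 <= w d j.+1 / w d j.+2 <= kap * (w d j / w d j.+1)], by minimality and
   then by curvature. *)
have cv := w_curv d2.
rewrite -(ler_pM2r wj2).
apply: le_trans (_ : w d j.+1 ^+ 2 * wu1 <= _).
  rewrite expr2 -[leLHS]mulrA -[leRHS]mulrA.
  by apply: ler_wpM2l; [exact: ltW|].
apply: le_trans (ler_wpM2r (ltW wu10) cv) _.
by rewrite le_eqVlt; apply/orP; left; apply/eqP; ring.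
Qed.

End Descent.

(** * Replica pairs with a random matching *)

Variables (mu : {ffun E -> bool} -> R) (fac : {ffun E -> bool} -> V -> R).
Hypothesis mu_gt0 : forall s, 0 < mu s.
Hypothesis fac_gt0 : forall s v, 0 < fac s v.
Hypothesis fac_sum : forall s v,
  \sum_(M | local_matching vt D v M && opposite s M) w (deg v) (#|moved M|)./2 = fac s v.

Definition mass s := mu s * mu (flip s D).

Hypothesis mass_flip : forall s (U : {set E}), U \subset D ->
  mass (flip s U) * \prod_v fac s v = mass s * \prod_v fac (flip s U) v.

(** Given [s], the matchings at the vertices are independent, each drawn among those opposite for
    [s] with probability proportional to [w]; [fac] is the normalising constant. By [mass_flip] the
    prefactor does not change under flips inside [D], so there [joint] depends on [s] only through
    compatibility. *)
Definition joint s J : R :=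
  if matching J && compatible s J
  then mass s / (\prod_v fac s v) * match_weight J else 0.

Let prod_fac_gt0 s : 0 < \prod_v fac s v.
Proof. by apply: prodr_gt0. Qed.

Lemma mass_gt0 s : 0 < mass s.
Proof. by rewrite mulr_gt0. Qed.

Lemma joint_ge0 s J : 0 <= joint s J.
Proof.
rewrite /joint; case: ifP => // /andP[mJ _].
by rewrite mulr_ge0 ?divr_ge0 // ltW ?mass_gt0 ?match_weight_gt0.
Qed.

Lemma joint_sum s : \sum_J joint s J = mass s.
Proof.
pose L v M := if local_matching vt D v M && opposite s M
              then w (deg v) (#|moved M|)./2 else 0.
have -> : \sum_J joint s J = mass s / (\prod_v fac s v) *
    \sum_(J : {ffun V -> {ffun H -> H}}) \prod_v L v (J v).
  rewrite mulr_sumr; apply: eq_bigr => J _; rewrite /joint /L.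
  have [mc|nmc] := ifPn; last rewrite -[LHS](mulr0 (mass s / \prod_v fac s v)).
    congr (_ * _); apply: eq_bigr => v _.
    by have /andP[/forallP/(_ v) -> /forallP/(_ v) ->] := mc.
  congr (_ * _); apply/esym/eqP; rewrite prodf_seq_eq0.
  move: nmc; rewrite negb_and => /orP[]/forallPn[v nv]; apply/hasP;
    exists v; rewrite ?mem_index_enum //= (negbTE nv) ?andbF //=.
rewrite -bigA_distr_bigA /=.
have -> : \prod_i \sum_j L i j = \prod_v fac s v.
  by apply: eq_bigr => v _; rewrite -fac_sum [RHS]big_mkcond.
by rewrite divfK // gt_eqF.
Qed.

Lemma ratio_flip s (U : {set E}) : U \subset D ->
  mass (flip s U) / (\prod_v fac (flip s U) v) = mass s / \prod_v fac s v.
Proof.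
move=> UD; apply/eqP; rewrite eqr_div ?lt0r_neq0 //.
by apply/eqP; exact: (mass_flip s UD).
Qed.

(** The point of the construction: flipping a whole trail is a symmetry of the joint law, although
    it may change [mass]. *)
Lemma joint_flip s J (U : {set E}) : U \subset D -> closed_set vt J U ->
  joint (flip s U) J = joint s J.
Proof.
move=> UD cU; rewrite /joint ratio_flip //.
by case: (boolP (matching J)) => //= mJ; rewrite (compatible_flip mJ).
Qed.

Lemma joint_le s J J' (U : {set E}) c : 0 < c -> U \subset D -> matching J' ->
  compatible (flip s U) J' -> c * match_weight J <= match_weight J' ->
  joint s J <= c^-1 * joint (flip s U) J'.
Proof.
move=> c0 UD mJ' cJ' le; rewrite {2}/joint mJ' cJ' /= ratio_flip //.
rewrite /joint; case: ifP => _; last first.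
  by rewrite !mulr_ge0 ?invr_ge0 ?(ltW c0) ?ltW ?mass_gt0 ?match_weight_gt0.
rewrite mulrCA; apply: ler_wpM2l; last by rewrite ler_pdivlMl.
by rewrite divr_ge0 // ltW // mass_gt0.
Qed.

Definition dirichlet (f : {ffun E -> bool} -> R) :=
  \sum_x \sum_e Num.min (mass x) (mass (flip x [set e])) *
    (f x - f (flip x [set e])) ^+ 2.

Lemma dirichlet_ge0 f : 0 <= dirichlet f.
Proof.
apply: sumr_ge0 => x _; apply: sumr_ge0 => e _; rewrite mulr_ge0 ?sqr_ge0 //.
by rewrite le_min !ltW ?mass_gt0.
Qed.

(** Cauchy-Schwarz, by expanding the double sum of [(a i - a j) ^+ 2]. *)
Lemma sqr_sum_le (I : finType) (P : pred I) (a : I -> R) :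
  (\sum_(i | P i) a i) ^+ 2 <= #|P|%:R * \sum_(i | P i) a i ^+ 2.
Proof.
have e0 : 0 <= \sum_(i | P i) \sum_(j | P j) (a i - a j) ^+ 2.
  by do 2 (apply: sumr_ge0 => ? _); apply: sqr_ge0.
suff e1 : \sum_(i | P i) \sum_(j | P j) (a i - a j) ^+ 2 =
    #|P|%:R * (\sum_(i | P i) a i ^+ 2) *+ 2 - (\sum_(i | P i) a i) ^+ 2 *+ 2.
  rewrite e1 in e0; rewrite -subr_ge0.
  by rewrite -(pmulrn_lge0 _ (ltn0Sn 1)) mulrnBl.
transitivity (\sum_(i | P i) \sum_(j | P j) (a i ^+ 2 + a j ^+ 2 - (a i * a j) *+ 2)).
  by apply: eq_bigr => i _; apply: eq_bigr => j _; ring.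
transitivity (\sum_(i | P i) (#|P|%:R * a i ^+ 2 + (\sum_(j | P j) a j ^+ 2)
    - (a i * \sum_(j | P j) a j) *+ 2)).
  apply: eq_bigr => i _; rewrite sumrB big_split /= sumr_const -[_ *+ #|P|]mulr_natl.
  by rewrite sumrMnl -mulr_sumr.
rewrite sumrB big_split /= sumr_const -[_ *+ #|P|]mulr_natl -mulr_sumr sumrMnl -mulr_suml.
by rewrite expr2; ring.
Qed.

(** * Congestion of the paths along trails *)

Section PathEnergy.
Variables (P : {ffun E -> bool} -> {ffun V -> {ffun H -> H}} -> bool) (h0 : H) (c : R).
Hypothesis h0D : h0.1 \in D.
Hypothesis c_gt0 : 0 < c.
Hypothesis pathP : forall s J k, P s J -> matching J -> compatible s J ->
  exists l : label, let J' := relabel l J in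
  [/\ matching J', compatible (flip s (trail J h0 k)) J' &
      c * match_weight J <= match_weight J'].

Let hop J k x := flip x (trail J h0 k).

(** The load that the [k]-th points of all paths put on [x]. Each such path is charged to an altered
    matching compatible with [x]; for each label the alteration is a bijection, so its total charge
    is at most [c^-1 * mass x]. *)
Lemma transport k x :
  \sum_J (if P (hop J k x) J then joint (hop J k x) J else 0)
  <= c^-1 * #|{: label}|%:R * mass x.
Proof.
apply: le_trans (_ : \sum_J \sum_(l : label) c^-1 * joint x (relabel l J) <= _).
  apply: ler_sum => J _.
  have ge0 : 0 <= \sum_(l : label) c^-1 * joint x (relabel l J).
    by apply: sumr_ge0 => l _; rewrite mulr_ge0 ?joint_ge0 // invr_ge0 ltW.
  case: ifP => // PJ; rewrite {1}/joint; case: ifPn => // /andP[mJ cJ].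
  have [l [mJ' cJ' W']] := pathP k PJ mJ cJ.
  have TD := trail_sub mJ k h0D.
  rewrite (bigD1 l) //= -[leLHS]addr0; apply: lerD; last first.
    by apply: sumr_ge0 => l' _; rewrite mulr_ge0 ?joint_ge0 // invr_ge0 ltW.
  have := joint_le c_gt0 TD mJ' cJ' W'.
  by rewrite /hop flipK {1}/joint mJ cJ.
rewrite exchange_big /= (eq_bigr (fun=> c^-1 * mass x)); last first.
  by move=> l _; rewrite -mulr_sumr relabel_sum joint_sum.
by rewrite sumr_const -[_ *+ #|_|]mulr_natr mulrAC.
Qed.

(** When the walk comes back along an edge, the path stands still instead of flipping it again. *)
Lemma hopS J k x : hop J k.+1 (hop J k x) = x \/
  hop J k.+1 (hop J k x) = flip x [set (iter k (next J) h0).1].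
Proof.
rewrite /hop trailS; set e := (iter k _ _).1.
have [eT|eT] := boolP (e \in trail J h0 k).
  by left; rewrite (setUidPr _) ?flipK // sub1set.
right; rewrite setUC flipU ?flipK // disjoint_sym disjoints1 //.
Qed.

(** Substituting [x = hop J k s] turns the sum over starting points into one over current points.
    [transport] at [k] bounds the load by the mass of one end of the step, at [k.+1] by that of the
    other, hence by their minimum. *)
Lemma path_step_energy k f :
  \sum_s \sum_J (if P s J then joint s J * (f (hop J k s) - f (hop J k.+1 s)) ^+ 2 else 0)
  <= c^-1 * #|{: label}|%:R * dirichlet f.
Proof.
set K := c^-1 * _.
rewrite exchange_big /=.
rewrite (eq_bigr (fun J => \sum_x (if P (hop J k x) J then joint (hop J k x) J *
   (f x - f (hop J k.+1 (hop J k x))) ^+ 2 else 0))); last first.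
  move=> J _; rewrite [LHS](reindex_inj (@flip_inj _ (trail J h0 k))) /=.
  by apply: eq_bigr => x _; rewrite -/(hop J k x);
    have -> : hop J k (hop J k x) = x by exact: flipK.
rewrite exchange_big /= /dirichlet mulr_sumr; apply: ler_sum => x _.
pose B J e := (if P (hop J k x) J && (hop J k.+1 (hop J k x) == flip x [set e])
               then joint (hop J k x) J else 0).
apply: le_trans (_ : \sum_J \sum_e B J e * (f x - f (flip x [set e])) ^+ 2 <= _).
  apply: ler_sum => J _.
  have B0 e : 0 <= B J e * (f x - f (flip x [set e])) ^+ 2.
    by rewrite mulr_ge0 ?sqr_ge0 // /B; case: ifP => // _; apply: joint_ge0.
  case: ifP => PJ; last by apply: sumr_ge0.
  have [->|hE] := hopS J k x; first by rewrite subrr expr0n mulr0; apply: sumr_ge0.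
  rewrite (bigD1 (iter k (next J) h0).1) //= {1}/B PJ hE eqxx -[leLHS]addr0 lerD //.
  exact: sumr_ge0.
rewrite exchange_big /= mulr_sumr; apply: ler_sum => e _.
rewrite -mulr_suml [leRHS]mulrA; apply: ler_wpM2r; first exact: sqr_ge0.
have K0 : 0 <= K by rewrite mulr_ge0 // invr_ge0 ltW.
have [_|_] := leP (mass x) (mass (flip x [set e])).
  apply: le_trans (transport k x); apply: ler_sum => J _; rewrite /B.
  by case: ifP => [/andP[-> _]//|_]; case: ifP => // _; apply: joint_ge0.
apply: le_trans (transport k.+1 (flip x [set e])); apply: ler_sum => J _; rewrite /B.
case: ifP => [/andP[PJ /eqP hE]|_]; last by case: ifP => // _; apply: joint_ge0.
have -> : hop J k.+1 (flip x [set e]) = hop J k x by rewrite -hE /hop flipK.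
by rewrite PJ.
Qed.

Lemma path_energy f :
  \sum_s \sum_J (if P s J then joint s J * (f s - f (flip s (full_trail vt J h0))) ^+ 2 else 0)
  <= #|{: H}|%:R ^+ 2 * (c^-1 * #|{: label}|%:R) * dirichlet f.
Proof.
set N := #|{: H}|.
apply: le_trans (_ : \sum_s \sum_J \sum_(k < N) N%:R *
  (if P s J then joint s J * (f (hop J k s) - f (hop J k.+1 s)) ^+ 2 else 0) <= _).
  apply: ler_sum => s _; apply: ler_sum => J _; case: ifP => PJ; last first.
    by apply: sumr_ge0 => k _; rewrite mulr0.
  rewrite -mulr_sumr -mulr_sumr [leRHS]mulrCA; apply: ler_wpM2l; first exact: joint_ge0.
  have -> : f s - f (flip s (full_trail vt J h0)) =
     \sum_(k < N) (f (hop J k s) - f (hop J k.+1 s)).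
    rewrite -(big_mkord xpredT (fun k => f (hop J k s) - f (hop J k.+1 s))).
    rewrite -[RHS]opprK -sumrN (eq_bigr (fun k => f (hop J k.+1 s) - f (hop J k s))); last first.
      by move=> i _; rewrite opprB.
    by rewrite telescope_sumr // opprB /hop trail0 flip0.
  by apply: le_trans (sqr_sum_le _ _) _; rewrite card_ord.
rewrite (eq_bigr (fun s => \sum_(k < N) \sum_J N%:R *
  (if P s J then joint s J * (f (hop J k s) - f (hop J k.+1 s)) ^+ 2 else 0))); last first.
  by move=> s _; rewrite exchange_big.
rewrite exchange_big /=.
apply: le_trans (_ : \sum_(k < N) N%:R * (c^-1 * #|{: label}|%:R * dirichlet f) <= _).
  apply: ler_sum => k _; under eq_bigr => s _ do rewrite -mulr_sumr.
  by rewrite -mulr_sumr; apply: ler_wpM2l => //; apply: path_step_energy.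
rewrite sumr_const card_ord -[_ *+ N]mulr_natl.
by rewrite le_eqVlt; apply/orP; left; apply/eqP; ring.
Qed.

End PathEnergy.

(** For a fixed matching two full trails coincide or are disjoint, and [joint] is invariant under
    flipping each. They are flipped one after the other, and the energy of a new trail started at
    [flip s U] equals that of the trail started at [s]. *)
Lemma trails_energy_seq f J (l : seq E) : matching J -> {subset l <= D} ->
  let U := \bigcup_(e <- l) full_trail vt J (e, false) in
  [/\ closed_set vt J U, U \subset D &
  \sum_s joint s J * (f s - f (flip s U)) ^+ 2 <=
  (size l)%:R * \sum_(e <- l)
    \sum_s joint s J * (f s - f (flip s (full_trail vt J (e, false)))) ^+ 2].
Proof.
move=> mJ; elim: l => [|e l IH] lD.
  rewrite !big_nil mulr0; split; first by move=> h; rewrite inE.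
    exact: sub0set.
  by rewrite big1 // => s _; rewrite flip0 subrr expr0n mulr0.
have eD : e \in D by apply: lD; rewrite mem_head.
have /IH[] : {subset l <= D} by move=> e' e'l; apply: lD; rewrite inE e'l orbT.
rewrite !big_cons; set U := \bigcup_(e' <- l) _; set T := full_trail _ _ _.
set S := \sum_(e' <- l) _ => cU UD le.
have cT : closed_set vt J T by exact: (full_trail_closed mJ).
have TD : T \subset D by exact: (trail_sub mJ).
have A0 : 0 <= \sum_s joint s J * (f s - f (flip s T)) ^+ 2.
  by apply: sumr_ge0 => s _; rewrite mulr_ge0 ?joint_ge0 ?sqr_ge0.
have S0 : 0 <= S.
  apply: sumr_ge0 => e' _; apply: sumr_ge0 => s _.
  by rewrite mulr_ge0 ?joint_ge0 ?sqr_ge0.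
split; [exact: closedU | by rewrite subUset TD | ].
have [eU|eU] := boolP (e \in U).
  have TU : T \subset U by rewrite /T /full_trail; apply: closed_trail cU _.
  rewrite (setUidPr TU); apply: le_trans le _.
  apply: ler_pM => //; first by rewrite ler_nat.
  by rewrite lerDr.
have dTU : [disjoint U & T].
  rewrite disjoint_sym disjoints_subset /T /full_trail.
  by apply: closed_trail (closedC mJ cU) _; rewrite inE.
set A := \sum_s _ in A0 *.
have AE : \sum_s joint s J * (f (flip s U) - f (flip (flip s U) T)) ^+ 2 = A.
  rewrite /A -[RHS](flip_sum U); apply: eq_bigr => s _.
  by rewrite joint_flip.
have [l0|l0] := posnP (size l).
  have U0 : U = set0 by rewrite /U (size0nil l0) big_nil.
  by rewrite /= l0 U0 setU0 mul1r lerDl.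
have n0 : 0 < (size l)%:R :> R by rewrite ltr0n.
rewrite -(ler_pM2l n0) mulr_sumr.
apply: le_trans (_ : \sum_s (size l).+1%:R * ((size l)%:R *
  (joint s J * (f (flip s U) - f (flip (flip s U) T)) ^+ 2) +
  joint s J * (f s - f (flip s U)) ^+ 2) <= _).
  apply: ler_sum => s _; rewrite setUC flipU //.
  set a := f (flip s U) - _; set b := f s - f (flip s U).
  have -> : f s - f (flip (flip s U) T) = a + b by rewrite /a /b; ring.
  (* Weighted Cauchy-Schwarz with [n = size l]: [(n + 1) * (n * a ^+ 2 + b ^+ 2) - n * (a + b) ^+ 2
     = (n * a - b) ^+ 2]. *)
  rewrite -subr_ge0 (_ : _ - _ = joint s J * ((size l)%:R * a - b) ^+ 2).
    by rewrite mulr_ge0 ?joint_ge0 ?sqr_ge0.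
  by rewrite -natr1; ring.
rewrite -mulr_sumr big_split /= -mulr_sumr AE mulrCA.
apply: ler_wpM2l => //; rewrite mulrDr lerD2l.
exact: le.
Qed.

Lemma trails_energy f :
  \sum_s mass s * (f s - f (flip s D)) ^+ 2 <= #|D|%:R * \sum_(e in D)
    \sum_s \sum_J joint s J * (f s - f (flip s (full_trail vt J (e, false)))) ^+ 2.
Proof.
under eq_bigr => s _ do rewrite -joint_sum mulr_suml.
rewrite exchange_big /=.
under [X in _ <= _ * X]eq_bigr => e _ do rewrite exchange_big /=.
rewrite [X in _ <= _ * X]exchange_big /= mulr_sumr; apply: ler_sum => J _.
have [mJ|nJ] := boolP (matching J); last first.
  rewrite !big1 ?mulr0 //; last by move=> s _; rewrite /joint (negbTE nJ) mul0r.
  by move=> e _; rewrite big1 // => s _; rewrite /joint (negbTE nJ) mul0r.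
have eD : {subset enum D <= D} by move=> e; rewrite mem_enum.
have [_] := @trails_energy_seq f J (enum D) mJ eD.
rewrite -cardE !big_enum /= => UD le; apply: le_trans le.
rewrite (_ : \bigcup_(e in D) full_trail vt J (e, false) = D) ?lexx //.
apply/eqP; rewrite eqEsubset UD; apply/subsetP => e eD'.
by apply/bigcupP; exists e => //; exact: (@full_trailE _ _ vt J (e, false) 0).
Qed.

Lemma bad_flip s J h : matching J -> bad 3 (flip s (full_trail vt J h)) J -> bad 5 s J.
Proof.
move=> mJ /existsP[v /andP[bv /existsP[c cle]]]; apply/existsP; exists v.
rewrite /bad_vertex bv; apply/existsP; exists c.
apply: leq_trans (flip_free_spin s h #|{: H}| v c mJ) _.
by rewrite (leq_add2r 2 _ 3).
Qed.

Let eta := (theta / kap) * (theta / kap / kap).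

Let eta_gt0 : 0 < eta.
Proof. by rewrite /eta !(mulr_gt0, divr_gt0) // invr_gt0. Qed.

Let path_cost := #|{: H}|%:R ^+ 2 * (eta^-1 * #|{: label}|%:R).

Let path_cost_ge0 : 0 <= path_cost.
Proof. by rewrite !mulr_ge0 ?sqr_ge0 // invr_ge0 ltW. Qed.

(** Let [T] be the trail of an admissible [h0]. At [x = flip s T] the half-edge [h0] can be paired
    with some [g], whence [joint s J <= theta * joint x (toggle h0 g J)]. Summed over [g] and [J],
    the value of [f] at [x] yields the term in [theta]; the difference [f s - f x] is paid for by
    the path along [T]. *)
Lemma bad_energy f :
  \sum_s \sum_J (if bad 5 s J then joint s J * f s ^+ 2 else 0) <=
  #|{: H}|%:R * (theta * #|{: H}|%:R * (\sum_s mass s * f s ^+ 2) *+ 2 +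
                 path_cost * dirichlet f *+ 2).
Proof.
pose P h0 s J := [&& matching J, compatible s J & admissible s J h0].
apply: le_trans (_ : \sum_h0 \sum_s \sum_J
   (if P h0 s J then joint s J * f s ^+ 2 else 0) <= _).
  rewrite [leRHS]exchange_big /=; apply: ler_sum => s _.
  rewrite [leRHS]exchange_big /=; apply: ler_sum => J _.
  have ge0 h : 0 <= if P h s J then joint s J * f s ^+ 2 else 0.
    by case: ifP => // _; rewrite mulr_ge0 ?joint_ge0 ?sqr_ge0.
  case: ifPn => [bJ|_]; last exact: sumr_ge0.
  have [/andP[mJ cJ]|nJ] := boolP (matching J && compatible s J); last first.
    by rewrite /joint (negbTE nJ) mul0r; apply: sumr_ge0 => h _; have := ge0 h; rewrite /joint (negbTE nJ) mul0r.
  have [h0 ad] := admissible_exists mJ bJ.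
  rewrite (bigD1 h0) //= {1}/P mJ cJ ad /= lerDl; exact: sumr_ge0.
set X := theta * _ * _ *+ 2 + _.
suff bound h0 : \sum_s \sum_J (if P h0 s J then joint s J * f s ^+ 2 else 0) <= X.
  apply: le_trans (ler_sum _ (fun h0 _ => bound h0)) _.
  by rewrite sumr_const mulr_natl.
have [h0D|h0D] := boolP (h0.1 \in D); last first.
  rewrite big1 => [|s _]; last first.
    rewrite big1 // => J _; case: ifP => // /and3P[_ _ /and5P[_]].
    by rewrite (negbTE h0D).
  apply: addr_ge0; apply: mulrn_wge0; last exact: mulr_ge0 path_cost_ge0 (dirichlet_ge0 f).
  apply: mulr_ge0; first by rewrite mulr_ge0 // ltW.
  by apply: sumr_ge0 => s _; rewrite mulr_ge0 ?sqr_ge0 // ltW ?mass_gt0.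
pose T J := full_trail vt J h0.
apply: le_trans (_ : \sum_s \sum_J ((if P h0 s J then joint s J * f (flip s (T J)) ^+ 2 else 0) *+ 2
   + (if P h0 s J then joint s J * (f s - f (flip s (T J))) ^+ 2 else 0) *+ 2) <= _).
  apply: ler_sum => s _; apply: ler_sum => J _; case: ifP => _; last by rewrite !mul0rn addr0.
  rewrite -!mulrnAr -mulrDr; apply: ler_wpM2l; first exact: joint_ge0.
  set a := f (flip s (T J)); set b := f s.
  have -> : a * (a *+ 2) + (b - a) * ((b - a) *+ 2) = b ^+ 2 + (b - a *+ 2) ^+ 2 by ring.
  by rewrite lerDl sqr_ge0.
rewrite (eq_bigr (fun s => (\sum_J (if P h0 s J then joint s J * f (flip s (T J)) ^+ 2 else 0)) *+ 2
   + (\sum_J (if P h0 s J then joint s J * (f s - f (flip s (T J))) ^+ 2 else 0)) *+ 2)); last first.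
  by move=> s _; rewrite big_split /= !sumrMnl.
rewrite big_split /= !sumrMnl; apply: lerD; apply: ler_wMn2r; last first.
  apply: (path_energy (P := P h0) h0D eta_gt0) => s J k /and3P[mJ cJ ad] _ _.
  exact: path_admissible.
rewrite exchange_big /=.
rewrite (eq_bigr (fun J => \sum_x (if P h0 (flip x (T J)) J then
    joint (flip x (T J)) J * f x ^+ 2 else 0))); last first.
  move=> J _; rewrite [LHS](reindex_inj (@flip_inj _ (T J))) /=.
  by apply: eq_bigr => x _; rewrite flipK.
rewrite exchange_big /= mulr_sumr; apply: ler_sum => x _.
apply: le_trans (_ : \sum_J \sum_(g : H) theta * joint x (toggle h0 g J) * f x ^+ 2 <= _).
  apply: ler_sum => J _.
  have ge0 g : 0 <= theta * joint x (toggle h0 g J) * f x ^+ 2.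
    by rewrite mulr_ge0 ?sqr_ge0 // mulr_ge0 ?joint_ge0 // ltW.
  case: ifPn => [/and3P[mJ cJ ad]|_]; last exact: sumr_ge0.
  have [g [vg hg pg gD xg]] := adm_next mJ ad #|{: H}|.
  have [mJ1 J1v pS cm1 W1] := adm_toggle mJ ad vg hg pg gD.
  rewrite (bigD1 g) //=; apply: le_trans (_ : theta * joint x (toggle h0 g J) * f x ^+ 2 <= _); last first.
    by rewrite lerDl; apply: sumr_ge0.
  apply: ler_wpM2r; first exact: sqr_ge0.
  have TD : T J \subset D := trail_sub mJ _ h0D.
  have cl : closed_set vt J (T J) by exact: (full_trail_closed mJ).
  have N0 : (0 < #|{: H}|)%N by apply/card_gt0P; exists h0.
  have := xg N0; rewrite -/(T J) flipK => xg'.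
  have cJ' : compatible x J by rewrite -(compatible_flip mJ _ cl).
  have cJ1 : compatible (flip (flip x (T J)) (T J)) (toggle h0 g J).
    rewrite flipK; apply/(compatibleP mJ1) => h.
    rewrite (partner_toggle_add h mJ vg hg (adm_free ad) pg).
    have [->|hh0] := eqVneq h h0; first by [].
    have [->|hhg] := eqVneq h g; first by move=> _; rewrite eq_sym.
    by move/(compatibleP mJ): cJ'; apply.
  have ti : 0 < theta^-1 by rewrite invr_gt0.
  have := @joint_le (flip x (T J)) J (toggle h0 g J) (T J) theta^-1 ti TD mJ1 cJ1.
  by rewrite flipK invrK; apply; rewrite ler_pdivrMl.
rewrite exchange_big /= (eq_bigr (fun=> theta * (mass x * f x ^+ 2))); last first.
  move=> g _; rewrite -mulr_suml -mulr_sumr toggle_sumE joint_sum mulrA //.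
by rewrite sumr_const -[_ *+ #|_|]mulr_natr mulrAC.
Qed.

(** A trail from a matching that is not bad is paid for by its path. For the others the difference
    is split into the values of [f - m] at both ends, and both ends are controlled by [bad_energy],
    since flipping a full trail leads from [bad 3] to [bad 5]. The coefficient of [theta] stays
    explicit, to be absorbed by the variance. *)
Lemma replica_energy f m :
  \sum_s mass s * (f s - f (flip s D)) ^+ 2 <=
  #|{: H}|%:R ^+ 3 * (theta * #|{: H}|%:R) * 8%:R * (\sum_s mass s * (f s - m) ^+ 2) +
  (#|{: H}|%:R ^+ 2 * (1 + 8%:R * #|{: H}|%:R) * path_cost) * dirichlet f.
Proof.
set N := #|{: H}|.
pose F s := f s - m.
have dF : dirichlet F = dirichlet f.
  apply: eq_bigr => x _; apply: eq_bigr => e _; congr (_ * _ ^+ 2).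
  by rewrite /F; ring.
set BE := \sum_s \sum_J (if bad 5 s J then joint s J * F s ^+ 2 else 0).
have BEle : BE <= N%:R * (theta * N%:R * (\sum_s mass s * (f s - m) ^+ 2) *+ 2 +
                 path_cost * dirichlet f *+ 2).
  by have := bad_energy F; rewrite dF.
have term e : e \in D ->
  \sum_s \sum_J joint s J * (f s - f (flip s (full_trail vt J (e, false)))) ^+ 2 <=
  path_cost * dirichlet f + BE *+ 4.
  move=> eD; pose T J := full_trail vt J (e, false).
  apply: le_trans (_ : \sum_s \sum_J (
     (if ~~ bad 3 s J then joint s J * (f s - f (flip s (T J))) ^+ 2 else 0) +
     ((if bad 3 s J then joint s J * F s ^+ 2 else 0) *+ 2 +
      (if bad 3 s J then joint s J * F (flip s (T J)) ^+ 2 else 0) *+ 2)) <= _).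
    apply: ler_sum => s _; apply: ler_sum => J _.
    case: (bad 3 s J) => /=; last by rewrite !mul0rn !addr0.
    rewrite add0r -!mulrnAr -mulrDr; apply: ler_wpM2l; first exact: joint_ge0.
    rewrite -/(T J) (_ : f s - f (flip s (T J)) = F s - F (flip s (T J))); last by rewrite /F; ring.
    set a := F s; set b := F _.
    have -> : a * (a *+ 2) + b * (b *+ 2) = (a - b) ^+ 2 + (a + b) ^+ 2 by ring.
    by rewrite lerDl sqr_ge0.
  rewrite (eq_bigr (fun s =>
     (\sum_J (if ~~ bad 3 s J then joint s J * (f s - f (flip s (T J))) ^+ 2 else 0)) +
     ((\sum_J (if bad 3 s J then joint s J * F s ^+ 2 else 0)) *+ 2 +
      (\sum_J (if bad 3 s J then joint s J * F (flip s (T J)) ^+ 2 else 0)) *+ 2))); last first.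
    by move=> s _; rewrite big_split /= big_split /= !sumrMnl.
  rewrite big_split /= big_split /= !sumrMnl; apply: lerD.
    apply: (@path_energy (fun s J => ~~ bad 3 s J) (e, false) eta eD eta_gt0).
    by move=> s J k nb mJ cJ; apply: path_not_bad.
  rewrite (mulrnDr BE 2 2); apply: lerD; apply: ler_wMn2r.
    apply: ler_sum => s _; apply: ler_sum => J _.
    have [b3|_] := boolP (bad 3 s J); last first.
      by case: ifP => // _; rewrite mulr_ge0 ?joint_ge0 ?sqr_ge0.
    rewrite ifT //; case/existsP: b3 => v /andP[bv /existsP[c cle]].
    apply/existsP; exists v; rewrite /bad_vertex bv; apply/existsP; exists c.
    exact: leq_trans cle _.
  rewrite exchange_big /BE [leRHS]exchange_big /=; apply: ler_sum => J _.
  have [mJ|nJ] := boolP (matching J); last first.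
    rewrite big1; last by move=> s _; rewrite /joint (negbTE nJ) mul0r; case: ifP.
    by apply: sumr_ge0 => s _; case: ifP => // _; rewrite mulr_ge0 ?joint_ge0 ?sqr_ge0.
  rewrite [leLHS](reindex_inj (@flip_inj _ (T J))) /=; apply: ler_sum => s _.
  rewrite flipK; case: ifP => [b3|_]; last first.
    by case: ifP => // _; rewrite mulr_ge0 ?joint_ge0 ?sqr_ge0.
  rewrite (bad_flip mJ b3) joint_flip //; first exact: (trail_sub mJ).
  exact: (full_trail_closed mJ).
apply: le_trans (trails_energy f) _.
have BE0 : 0 <= BE.
  by do 2 (apply: sumr_ge0 => ? _); case: ifP => // _; rewrite mulr_ge0 ?joint_ge0 ?sqr_ge0.
have DN : #|D|%:R <= N%:R :> R.
  rewrite ler_nat /N card_prod; apply: leq_trans (max_card _) _.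
  by rewrite leq_pmulr // card_bool.
have tot0 : 0 <= path_cost * dirichlet f + BE *+ 4.
  by rewrite addr_ge0 ?mulrn_wge0 // mulr_ge0 ?dirichlet_ge0.
apply: le_trans (_ : N%:R * (N%:R * (path_cost * dirichlet f + BE *+ 4)) <= _).
  apply: ler_pM => //.
    by do 3 (apply: sumr_ge0 => ? _); rewrite mulr_ge0 ?joint_ge0 ?sqr_ge0.
  apply: le_trans (ler_sum _ term) _.
  by rewrite sumr_const -[_ *+ #|_|]mulr_natl; apply: ler_wpM2r.
set M2 := \sum_s _ in BEle *; set X := path_cost * _ in BEle *.
rewrite [leRHS](_ : _ = N%:R * (N%:R * (X + (N%:R * (theta * N%:R * M2 *+ 2 + X *+ 2)) *+ 4))); last first.
  by rewrite /X; ring.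
apply: ler_wpM2l => //; apply: ler_wpM2l => //; rewrite lerD2l; exact: ler_wMn2r.
Qed.

End Weights.

(** * Summation over the disagreement sets of the replicas *)

Section Poincare.
Variables (R : realFieldType) (E V : finType) (vt : E * bool -> V).
Local Notation H := (E * bool)%type.
Variables (w : nat -> nat -> R) (kap theta : R).
Hypothesis w_gt0 : forall d j, (j.*2 <= d)%N -> 0 < w d j.
Hypothesis w_curv : forall d j, (j.+2.*2 <= d)%N ->
  w d j.+1 ^+ 2 <= kap * w d j * w d j.+2.
Hypothesis w_few : forall d j, (d <= #|{: H}|)%N -> (j.+1.*2 <= d)%N ->
  (d <= j.*2 + 22)%N -> theta * w d j.+1 <= w d j.
Hypothesis theta_gt0 : 0 < theta.
Hypothesis theta_le1 : theta <= 1.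
Hypothesis kap_ge1 : 1 <= kap.
Hypothesis theta_small : 8 * #|{: H}|%:R ^+ 4 * theta <= 1.
Variables (mu : {ffun E -> bool} -> R) (fac : {set E} -> {ffun E -> bool} -> V -> R).
Hypothesis mu_gt0 : forall s, 0 < mu s.
Hypothesis mu_sum : \sum_s mu s = 1.
Hypothesis fac_gt0 : forall (D : {set E}) s v, 0 < fac D s v.
Hypothesis fac_sum : forall (D : {set E}) s v,
  \sum_(M | local_matching vt D v M && opposite s M)
    w (deg vt D v) (#|moved M|)./2 = fac D s v.
Hypothesis mass_flip : forall (D : {set E}) (s : {ffun E -> bool}) (U : {set E}), U \subset D ->
  mass D mu (flip s U) * \prod_v fac D s v = mass D mu s * \prod_v fac D (flip s U) v.

(** Of the 12 powers, 8 count the labels, 2 come from the length of the paths and 2 from the number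
    of trails; [kap ^+ 3 / theta ^+ 2] is the inverse of the weight kept along a path. *)
Definition poincare_const : R :=
  #|{: H}|%:R ^+ 12 * (1 + 8 * #|{: H}|%:R) * (kap ^+ 3 / theta ^+ 2).

(** Each ordered pair of configurations is [(s, flip s D)] for exactly one [D], so the left sides
    sum to twice the variance. By [theta_small] the bad parts sum to at most one variance, which is
    subtracted. The Dirichlet forms add up because a sum of minima is at most the minimum of the
    sums. *)
Lemma poincare (f : {ffun E -> bool} -> R) (m := \sum_s mu s * f s) :
  \sum_s mu s * (f s - m) ^+ 2 <= poincare_const *
  \sum_x \sum_e Num.min (mu x) (mu (flip x [set e])) * (f x - f (flip x [set e])) ^+ 2.
Proof.
set N := #|{: H}|; set Var := (X in X <= _); set Dir := (X in _ <= _ * X).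
have kap0 : 0 < kap by apply: lt_le_trans kap_ge1.
have Var0 : 0 <= Var.
  by apply: sumr_ge0 => s _; rewrite mulr_ge0 ?sqr_ge0 // ltW.
have mass0 D s : 0 < mass D mu s by rewrite mulr_gt0.
have twice : \sum_(D : {set E}) \sum_s mass D mu s * (f s - f (flip s D)) ^+ 2 = Var *+ 2.
  rewrite exchange_big /=.
  transitivity (\sum_s mu s * (\sum_s' mu s' * (f s - f s') ^+ 2)).
    apply: eq_bigr => s _; rewrite mulr_sumr -(flip_sum_set s).
    by apply: eq_bigr => D _; rewrite /mass mulrA.
  have inner s : \sum_s' mu s' * (f s - f s') ^+ 2 = (f s - m) ^+ 2 + Var.
    transitivity (\sum_s' (mu s' * (f s - m) ^+ 2 + mu s' * (f s' - m) ^+ 2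
        - (f s - m) *+ 2 * (mu s' * f s' - mu s' * m))).
      by apply: eq_bigr => s' _; ring.
    rewrite sumrB big_split /= -mulr_suml mu_sum mul1r -mulr_sumr sumrB -mulr_suml mu_sum.
    by rewrite mul1r subrr mulr0 subr0.
  under eq_bigr => s _ do rewrite inner mulrDr.
  by rewrite big_split /= -mulr_suml mu_sum mul1r.
have once : \sum_(D : {set E}) \sum_s mass D mu s * (f s - m) ^+ 2 = Var.
  rewrite exchange_big /=; apply: eq_bigr => s _; rewrite -mulr_suml; congr (_ * _).
  by rewrite /mass -mulr_sumr flip_sum_set mu_sum mulr1.
have dirs : \sum_(D : {set E}) dirichlet D mu f <= Dir.
  rewrite /dirichlet exchange_big /=; apply: ler_sum => x _.
  rewrite exchange_big /=; apply: ler_sum => e _; rewrite -mulr_suml.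
  apply: ler_wpM2r; first exact: sqr_ge0.
  have mass_sum y : \sum_(D : {set E}) mass D mu y = mu y.
    by rewrite /mass -mulr_sumr flip_sum_set mu_sum mulr1.
  rewrite le_min; apply/andP; split; rewrite -[leRHS]mass_sum; apply: ler_sum => D _.
    by rewrite ge_min lexx.
  by rewrite ge_min lexx orbT.
have re D := @replica_energy R E V vt D w kap theta w_gt0 w_curv w_few theta_gt0
  theta_le1 kap_ge1 mu (fac D) mu_gt0 (fac_gt0 D) (fac_sum D) (@mass_flip D) f m.
have := @ler_sum _ _ (index_enum _) xpredT _ _ (fun D _ => re D); rewrite twice big_split /= -!mulr_sumr once -/N.
set K := N%:R ^+ 2 * _ * _ => le.
have KE : K = poincare_const.
  rewrite /K /poincare_const -/N !card_prod -/N.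
  have cN : (#|{: E}| * #|{: bool}|)%N = N by rewrite /N card_prod.
  rewrite cN !natrM; field; by rewrite !gt_eqF.
have small : N%:R ^+ 3 * (theta * N%:R) * 8 * Var <= Var.
  rewrite -[leRHS]mul1r; apply: ler_wpM2r => //.
  by apply: le_trans theta_small; rewrite -/N le_eqVlt; apply/orP; left; apply/eqP; ring.
rewrite -KE; have K0 : 0 <= K.
  rewrite /K !mulr_ge0 ?addr_ge0 ?sqr_ge0 // ?mulr_ge0 // ?invr_ge0 ?ltW //.
  by rewrite !(mulr_gt0, divr_gt0, invr_gt0).
have := le_trans le (lerD small (ler_wpM2l K0 dirs)).
by rewrite mulr2n lerD2l.
Qed.

End Poincare.

(** * Counting opposite matchings at a vertex *)

Lemma exchange_big3 (R : nmodType) (I J K : finType) (F : I -> J -> K -> R) :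
  \sum_i \sum_j \sum_k F i j k = \sum_k \sum_i \sum_j F i j k.
Proof.
transitivity (\sum_i \sum_k \sum_j F i j k); last exact: exchange_big.
by apply: eq_bigr => i _; exact: exchange_big.
Qed.

Section LocalCount.
Variables (R : comNzRingType) (E V : finType) (vt : E * bool -> V) (D : {set E}) (v : V).
Variable s : {ffun E -> bool}.
Local Notation H := (E * bool)%type.
Local Notation half_at := (half_at vt D).
Implicit Types (M : {ffun H -> H}) (h g : H) (c : bool).

Definition opp_matching M := local_matching vt D v M && opposite s M.
Definition half_spin c := [set h | half_at v h && (s h.1 == c)].
Definition moved_spin M c := [set h in moved M | s h.1 == c].
Definition free_half M c := [set h | half_at v h && (M h == h) && (s h.1 == c)].

Lemma opp_matchingP M : opp_matching M ->
  [/\ involutive M, forall h, M h != h -> half_at v h &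
      forall h, M h != h -> s h.1 != s (M h).1].
Proof.
move=> /andP[/forallP lm /forallP om]; split=> h.
- by have /andP[/eqP] := lm h.
- by have /andP[_ /implyP] := lm h.
- by have /implyP := om h.
Qed.

Lemma card_moved M : opp_matching M -> #|moved M| = #|moved_spin M true|.*2.
Proof.
move=> oM; have [MK Mat Mo] := opp_matchingP oM.
have e : #|moved_spin M true| = #|moved_spin M false|.
  rewrite -(card_imset _ (inv_inj MK)); apply: eq_card => h; rewrite !inE.
  apply/imsetP/andP => [[g]|[nh sh]].
    rewrite !inE => /andP[ng /eqP sg] ->; rewrite MK eq_sym ng; split=> //.
    by have := Mo g ng; rewrite sg; case: (s _).
  exists (M h); last by rewrite MK.
  rewrite !inE MK eq_sym nh /=.
  by have := Mo h nh; rewrite (eqP sh); case: (s _).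
rewrite -addnn {2}e -cardsUI (_ : _ :&: _ = set0) ?cards0 ?addn0.
  by apply: eq_card => h; rewrite !inE; case: (s h.1); rewrite ?andbT ?andbF ?orbF.
by apply/setP => h; rewrite !inE; case: (s h.1); rewrite ?andbT ?andbF.
Qed.

Lemma card_moved_spin M c : opp_matching M -> #|moved_spin M c| = (#|moved M|)./2.
Proof.
move=> oM; have cE := card_moved oM; have [MK Mat Mo] := opp_matchingP oM.
case: c; first by rewrite cE doubleK.
have : #|moved M| = (#|moved_spin M true| + #|moved_spin M false|)%N.
  rewrite -cardsUI (_ : _ :&: _ = set0) ?cards0 ?addn0.
    by apply: eq_card => h; rewrite !inE; case: (s h.1); rewrite ?andbT ?andbF ?orbF.
  by apply/setP => h; rewrite !inE; case: (s h.1); rewrite ?andbT ?andbF.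
by rewrite cE -addnn => /addnI <-; rewrite addnn doubleK.
Qed.

Lemma card_free_half M c : opp_matching M ->
  #|half_spin c| = (#|free_half M c| + (#|moved M|)./2)%N.
Proof.
move=> oM; have [MK Mat Mo] := opp_matchingP oM.
rewrite -(card_moved_spin c oM) -cardsUI (_ : _ :&: _ = set0) ?cards0 ?addn0.
  apply: eq_card => h; rewrite !inE.
  have [e|nh] := eqVneq (M h) h; first by rewrite andbT orbF.
  by rewrite andbF /= Mat.
by apply/setP => h; rewrite !inE; case: (M h == h); rewrite ?andbF.
Qed.

(** Extends one local matching by trivial ones, so that the lemmas on families apply to it. *)
Let fam M : {ffun V -> {ffun H -> H}} := [ffun u => if u == v then M else [ffun h => h]].

Lemma fam_matching M : local_matching vt D v M -> matching vt D (fam M).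
Proof.
move=> lM; apply/forallP => u; rewrite ffunE; case: eqVneq => [->//|_].
by apply/forallP => h; rewrite !ffunE !eqxx.
Qed.

Lemma fam_partner M h : vt h = v -> partner vt (fam M) h = M h.
Proof. by move=> vh; rewrite /partner ffunE vh eqxx. Qed.

Lemma opp_toggle_rem M h g : opp_matching M -> M h = g -> g != h -> s h.1 ->
  let M' := local_toggle h g M in
  [/\ opp_matching M', h \in free_half M' true & g \in free_half M' false].
Proof.
move=> oM Mh gh sh M'; have [MK Mat Mo] := opp_matchingP oM.
have nh : M h != h by rewrite Mh.
have hat := Mat h nh; have vh : vt h = v by case/andP: hat => /eqP.
have ng : M g != g by rewrite -Mh MK eq_sym.
have gat := Mat g ng.
have sg : s g.1 = false by have := Mo h nh; rewrite Mh sh; case: (s _).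
have Mg : M g = h by rewrite -Mh MK.
have M'E : M' = [ffun k => if (k == h) || (k == g) then k else M k].
  by rewrite /M' /local_toggle eq_sym gh Mh Mg !eqxx.
have [lM _] := andP oM.
have mJ := fam_matching lM.
have na : partner vt (fam M) h != h by rewrite fam_partner.
have [mJ' _ _] := toggle_remP mJ na.
rewrite fam_partner // Mh in mJ'.
have M'v : toggle vt h g (fam M) v = M' by rewrite !ffunE vh eqxx.
split; last 2 first.
- by rewrite !inE M'E ffunE eqxx /= eqxx hat sh.
- by rewrite !inE M'E ffunE eqxx orbT eqxx gat sg.
apply/andP; split; first by rewrite -M'v; move/forallP: mJ'.
apply/forallP => k; rewrite M'E ffunE; case: ifP => [_|_]; first by rewrite eqxx.
by apply/implyP => /Mo.
Qed.

Lemma opp_toggle_add M h g : opp_matching M -> h \in free_half M true ->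
  g \in free_half M false ->
  let M' := local_toggle h g M in
  [/\ opp_matching M', M' h = g, g != h, s h.1 & (#|moved M'| = #|moved M| + 2)%N].
Proof.
move=> oM; rewrite !inE => /andP[/andP[hat /eqP Mh] /eqP sh].
move=> /andP[/andP[gat /eqP Mg] /eqP sg] M'; have [MK Mat Mo] := opp_matchingP oM.
have vh : vt h = v by case/andP: hat => /eqP.
have vg : vt g = v by case/andP: gat => /eqP.
have hD : h.1 \in D by case/andP: hat.
have gD : g.1 \in D by case/andP: gat.
have hg : h != g by apply/eqP => e; rewrite e sg in sh.
have M'E : M' = [ffun k => if k == h then g else if k == g then h else M k].
  by rewrite /M' /local_toggle hg Mh Mg (negbTE hg) /= !eqxx.
have [lM _] := andP oM.
have mJ := fam_matching lM.
have vhg : vt h = vt g by rewrite vh vg.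
have [] := toggle_addP mJ vhg hg _ _ hD gD; rewrite ?fam_partner // => mJ' _.
have M'v : toggle vt h g (fam M) v = M' by rewrite !ffunE vh eqxx.
have famv : fam M v = M by rewrite ffunE eqxx.
rewrite vh M'v famv => cm; split=> //; last 2 first.
- by rewrite M'E ffunE eqxx.
- by rewrite eq_sym.
- apply/andP; split; first by rewrite -M'v; move/forallP: mJ'.
  apply/forallP => k; rewrite M'E ffunE.
  have [->|kh] := eqVneq k h; first by rewrite sh sg implybT.
  have [->|kg] := eqVneq k g; first by rewrite sh sg implybT.
  by apply/implyP => /Mo.
Qed.

(** Double counting through [local_toggle]: separating a chosen pair is inverse to joining two
    chosen free half-edges of opposite spin, for which a matching with [j] pairs leaves [x - j]
    times [y - j] choices. *)
Lemma pair_count (u : nat -> R) :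
  \sum_(M | opp_matching M) (#|moved M|)./2%:R * u (#|moved M|)./2.-1 =
  \sum_(M | opp_matching M)
    (#|half_spin true|%:R - (#|moved M|)./2%:R) *
    (#|half_spin false|%:R - (#|moved M|)./2%:R) * u (#|moved M|)./2.
Proof.
pose P h g M := [&& opp_matching M, M h == g, g != h & s h.1].
pose Q h g M := [&& opp_matching M, h \in free_half M true & g \in free_half M false].
have PQ h g M : P h g (local_toggle h g M) = Q h g M.
  apply/idP/idP => [/and4P[oM /eqP Mh gh sh]|/and3P[oM hF gF]].
    have [] := opp_toggle_rem oM Mh gh sh.
    by rewrite local_toggleK => ? ? ?; apply/and3P.
  by have [? /eqP ? ? ? _] := opp_toggle_add oM hF gF; apply/and4P.
transitivity (\sum_h \sum_g \sum_M if P h g M then u (#|moved M|)./2.-1 else 0).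
  rewrite exchange_big3 big_mkcond /=; apply: eq_bigr => M _.
  case: ifPn => oM; last first.
    by rewrite big1 // => h _; rewrite big1 // => g _; rewrite /P (negbTE oM).
  rewrite -(card_moved_spin true oM) mulr_natl -sumr_const.
  rewrite big_mkcond /=; apply: eq_bigr => h _; rewrite !inE.
  rewrite (bigD1 (M h)) //= [X in _ + X]big1 ?addr0 => [|g ng].
    by rewrite /P oM eqxx; case: (s h.1).
  by rewrite /P oM eq_sym (negbTE ng).
transitivity (\sum_h \sum_g \sum_M if Q h g M then u (#|moved M|)./2 else 0).
  apply: eq_bigr => h _; apply: eq_bigr => g _.
  rewrite (reindex_inj (inv_inj (local_toggleK h g))) /=; apply: eq_bigr => M _.
  rewrite PQ; case: ifP => // /and3P[oM hF gF].
  by have [_ _ _ _ ->] := opp_toggle_add oM hF gF; rewrite addn2.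
rewrite exchange_big3 [RHS]big_mkcond /=; apply: eq_bigr => M _.
case: ifPn => oM; last first.
  by rewrite big1 // => h _; rewrite big1 // => g _; rewrite /Q (negbTE oM).
have fE c : #|half_spin c|%:R - (#|moved M|)./2%:R = #|free_half M c|%:R :> R.
  by rewrite (card_free_half c oM) natrD addrK.
rewrite !fE -natrM mulr_natl mulnC.
rewrite mulrnA -!sumr_const [RHS]big_mkcond /=; apply: eq_bigr => h _.
case: ifP => hF; last by rewrite big1 // => g _; rewrite /Q hF andbF.
by rewrite [RHS]big_mkcond; apply: eq_bigr => g _; rewrite /Q oM hF.
Qed.

End LocalCount.

(** * Reversible lazy kernels *)

Section Kernels.
Variables (R : realFieldType) (T : finType).
Implicit Types (P : T -> T -> R) (x y z : T) (f : T -> R).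

Definition stochastic P := (forall x y, 0 <= P x y) /\ (forall x, \sum_y P x y = 1).

Fixpoint kpow P n x y : R :=
  if n is n'.+1 then \sum_z P x z * kpow P n' z y else (x == y)%:R.

Lemma kpow_stochastic P n : stochastic P -> stochastic (kpow P n).
Proof.
move=> [P0 P1]; elim: n => [|n [IH0 IH1]]; split=> x //=.
- rewrite (bigD1 x) //= eqxx big1 ?addr0 // => y ny.
  by rewrite eq_sym (negbTE ny).
- by move=> y; apply: sumr_ge0 => z _; rewrite mulr_ge0.
- rewrite exchange_big /= -[RHS](P1 x); apply: eq_bigr => z _.
  by rewrite -mulr_sumr IH1 mulr1.
Qed.

(** Each step adds an error of at most [eta], and stochastic kernels do not expand the l1
    distance. *)
Lemma kpow_perturb P P' eta n x : stochastic P -> stochastic P' ->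
  (forall x, \sum_y `|P' x y - P x y| <= eta) ->
  \sum_y `|kpow P' n x y - kpow P n x y| <= n%:R * eta.
Proof.
move=> sP sP' le; have [P'0 P'1] := sP'.
elim: n x => [|n IH] x /=.
  by rewrite mul0r big1 // => y _; rewrite subrr normr0.
apply: le_trans (_ : \sum_y (\sum_z P' x z * `|kpow P' n z y - kpow P n z y| +
   \sum_z `|P' x z - P x z| * kpow P n z y) <= _).
  apply: ler_sum => y _.
  have -> : \sum_z P' x z * kpow P' n z y - \sum_z P x z * kpow P n z y =
     \sum_z P' x z * (kpow P' n z y - kpow P n z y) +
     \sum_z (P' x z - P x z) * kpow P n z y.
    by rewrite -sumrB -big_split /=; apply: eq_bigr => z _; ring.
  apply: le_trans (ler_normD _ _) _; apply: lerD.
    apply: le_trans (ler_norm_sum _ _ _) _; apply: ler_sum => z _.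
    by rewrite normrM ger0_norm.
  apply: le_trans (ler_norm_sum _ _ _) _; apply: ler_sum => z _.
  by rewrite normrM [`|kpow _ _ _ _|]ger0_norm //; case: (kpow_stochastic n sP).
rewrite big_split /= -natr1 mulrDl mul1r; apply: lerD.
  rewrite exchange_big /=.
  apply: le_trans (_ : \sum_z P' x z * (n%:R * eta) <= _).
    by apply: ler_sum => z _; rewrite -mulr_sumr; apply: ler_wpM2l.
  by rewrite -mulr_suml P'1 mul1r.
rewrite exchange_big /=; apply: le_trans (le x); apply: ler_sum => z _.
by rewrite -mulr_sumr; case: (kpow_stochastic n sP) => _ ->; rewrite mulr1.
Qed.

Section Gap.
Variables (P : T -> T -> R) (pi : T -> R) (K : R).
Hypothesis sP : stochastic P.
Hypothesis pi_gt0 : forall x, 0 < pi x.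
Hypothesis pi_sum : \sum_x pi x = 1.
Hypothesis rev : forall x y, pi x * P x y = pi y * P y x.
Hypothesis lazy : forall x, 2^-1 <= P x x.
Hypothesis K_ge1 : 1 <= K.
Hypothesis gap : forall f, \sum_x pi x * f x = 0 ->
  \sum_x pi x * f x ^+ 2 <= K * \sum_x \sum_y pi x * P x y * (f x - f y) ^+ 2.

Let P0 : forall x y, 0 <= P x y. Proof. by case: sP. Qed.
Let P1 : forall x, \sum_y P x y = 1. Proof. by case: sP. Qed.

Definition apply_kernel f x := \sum_y P x y * f y.

Lemma jensen (I : finType) (q a : I -> R) : (forall i, 0 <= q i) -> \sum_i q i = 1 ->
  (\sum_i q i * a i) ^+ 2 <= \sum_i q i * a i ^+ 2.
Proof.
move=> q0 q1; set m := \sum_i _.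
have : 0 <= \sum_i q i * (a i - m) ^+ 2.
  by apply: sumr_ge0 => i _; rewrite mulr_ge0 ?sqr_ge0.
rewrite (eq_bigr (fun i => q i * a i ^+ 2 - m *+ 2 * (q i * a i) + m ^+ 2 * q i)); last first.
  by move=> i _; ring.
rewrite big_split sumrB /= -!mulr_sumr -/m q1 => ge.
by rewrite -subr_ge0; apply: le_trans ge _; rewrite le_eqVlt; apply/orP; left; apply/eqP; ring.
Qed.

Lemma apply_mean f : \sum_x pi x * apply_kernel f x = \sum_x pi x * f x.
Proof.
under eq_bigr => x _ do rewrite /apply_kernel mulr_sumr.
rewrite exchange_big /=; apply: eq_bigr => y _.
under eq_bigr => x _ do rewrite mulrA rev -mulrA.
by rewrite -mulr_sumr -mulr_suml P1 mul1r.
Qed.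

(** Laziness makes [2 P - 1] a stochastic kernel that preserves [pi]. By Jensen the squared norm of
    [2 P f - f] is at most that of [f], which says that the squared norm of [P f] is at most the
    inner product of [f] and [P f]; the gap bounds the latter. This takes the place of a spectral
    decomposition. *)
Lemma contraction f : \sum_x pi x * f x = 0 ->
  \sum_x pi x * apply_kernel f x ^+ 2 <= (1 - (2 * K)^-1) * \sum_x pi x * f x ^+ 2.
Proof.
move=> f0; set n2 := \sum_x pi x * f x ^+ 2.
have K0 : 0 < K by apply: lt_le_trans K_ge1.
set cr := \sum_x pi x * (f x * apply_kernel f x).
have diag : \sum_x \sum_y pi x * P x y * (f x - f y) ^+ 2 = n2 *+ 2 - cr *+ 2.
  transitivity (\sum_x (pi x * f x ^+ 2 * (\sum_y P x y) - (pi x * (f x * apply_kernel f x)) *+ 2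
     + \sum_y pi y * P y x * f y ^+ 2)).
    apply: eq_bigr => x _; rewrite /apply_kernel mulr_sumr !mulr_sumr -sumrMnl -sumrB -big_split /=.
    by apply: eq_bigr => y _; rewrite -(rev x y); ring.
  rewrite big_split sumrB /= sumrMnl -/cr [X in _ + X]exchange_big /=.
  have -> : \sum_x pi x * f x ^+ 2 * \sum_y P x y = n2.
    by apply: eq_bigr => x _; rewrite P1 mulr1.
  have -> : \sum_x \sum_y pi x * P x y * f x ^+ 2 = n2.
    apply: eq_bigr => x _; rewrite -mulr_suml -mulr_sumr P1 mulr1 //.
  by rewrite mulr2n addrAC.
have crn : \sum_x pi x * apply_kernel f x ^+ 2 <= cr.
  have q x : (apply_kernel f x *+ 2 - f x) ^+ 2 <= \sum_y (P x y *+ 2 - (x == y)%:R) * f y ^+ 2.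
    have -> : apply_kernel f x *+ 2 - f x = \sum_y (P x y *+ 2 - (x == y)%:R) * f y.
      transitivity (\sum_y ((P x y * f y) *+ 2 - (x == y)%:R * f y)).
        rewrite sumrB sumrMnl; congr (_ - _).
        rewrite (bigD1 x) //= eqxx mul1r big1 ?addr0 // => y ny.
        by rewrite eq_sym (negbTE ny) mul0r.
      by apply: eq_bigr => y _; ring.
    apply: jensen => [y|].
      have [<-|_] := eqVneq x y; last by rewrite subr0 mulrn_wge0.
      by have := lazy x; rewrite subr_ge0 (_ : true%:R = 1 :> R) // -mulr_natr; lra.
    rewrite sumrB sumrMnl P1 (bigD1 x) //= eqxx big1 ?addr0; first by rewrite mulr2n addrK.
    by move=> y ny; rewrite eq_sym (negbTE ny).
  have := @ler_sum _ _ (index_enum _) xpredT _ _ (fun x _ => ler_wpM2l (ltW (pi_gt0 x)) (q x)).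
  have -> : \sum_x pi x * (\sum_y (P x y *+ 2 - (x == y)%:R) * f y ^+ 2) = n2.
    transitivity (\sum_x (pi x * apply_kernel (fun y => f y ^+ 2) x *+ 2 - pi x * f x ^+ 2)).
      apply: eq_bigr => x _; rewrite -mulrnAr -mulrBr; congr (_ * _).
      transitivity (\sum_y ((P x y * f y ^+ 2) *+ 2 - (x == y)%:R * f y ^+ 2)).
        by apply: eq_bigr => y _; ring.
      rewrite sumrB sumrMnl; congr (_ - _).
      rewrite (bigD1 x) //= eqxx mul1r big1 ?addr0 // => y ny.
      by rewrite eq_sym (negbTE ny) mul0r.
    by rewrite sumrB sumrMnl apply_mean -/n2 mulr2n addrK.
  have -> : \sum_x pi x * (apply_kernel f x *+ 2 - f x) ^+ 2 =
     (\sum_x pi x * apply_kernel f x ^+ 2) *+ 4 - cr *+ 4 + n2.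
    rewrite -!sumrMnl -sumrB -big_split /=; apply: eq_bigr => x _; ring.
  by rewrite gerDr subr_le0 ler_pMn2r.
have g := gap f0; rewrite -/n2 diag in g.
apply: le_trans crn _; rewrite mulrBl mul1r -subr_ge0.
have -> : n2 - (2 * K)^-1 * n2 - cr = (2 * K)^-1 * (K * (n2 *+ 2 - cr *+ 2) - n2).
  by field; rewrite gt_eqF.
by rewrite mulr_ge0 ?subr_ge0 // invr_ge0 mulr_ge0 // ltW.
Qed.

Lemma kpow_rev n x y : pi x * kpow P n x y = pi y * kpow P n y x.
Proof.
have shift m a b : kpow P m.+1 a b = \sum_z kpow P m a z * P z b.
  elim: m a b => [|m IH] a b /=.
    rewrite (bigD1 b) //= eqxx mulr1 big1 ?addr0; last first.
      by move=> z nz; rewrite (negbTE nz) mulr0.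
    rewrite (bigD1 a) //= eqxx mul1r big1 ?addr0 // => z nz.
    by rewrite eq_sym (negbTE nz) mul0r.
  under eq_bigr => z _ do rewrite -/(kpow P m.+1 z b) IH mulr_sumr.
  rewrite exchange_big /=; apply: eq_bigr => z _.
  by rewrite mulr_suml; apply: eq_bigr => u _; rewrite mulrA.
elim: n x y => [|n IH] x y /=.
  by rewrite [y == x]eq_sym; have [->|ne] := eqVneq x y; rewrite // !mulr0.
rewrite -/(kpow P n.+1 y x) shift !mulr_sumr; apply: eq_bigr => z _.
by rewrite mulrA rev mulrAC IH [RHS]mulrA.
Qed.

(** The chi-square argument: by reversibility [h m] is the density, minus one, of the law at time
    [m] relative to [pi]. It evolves by [apply_kernel], its squared norm starts at [(pi x0)^-1 - 1],
    and Jensen passes to the l1 distance. *)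
Lemma mixing n x0 :
  (\sum_y `|kpow P n x0 y - pi y|) ^+ 2 <= (1 - (2 * K)^-1) ^+ n / pi x0.
Proof.
have K0 : 0 < K by apply: lt_le_trans K_ge1.
have r0 : 0 <= 1 - (2 * K)^-1.
  by rewrite subr_ge0 invf_le1 ?mulr_gt0 // -[leLHS]mul1r ler_pM // ler1n.
pose h m y := kpow P m y x0 / pi x0 - 1.
have h_mean m : \sum_y pi y * h m y = 0.
  rewrite /h; under eq_bigr => y _ do rewrite mulrBr mulr1 mulrA -kpow_rev mulrAC divff ?mul1r ?gt_eqF //.
  by rewrite sumrB pi_sum; case: (kpow_stochastic m sP) => _ ->; rewrite subrr.
have h_step m y : h m.+1 y = apply_kernel (h m) y.
  rewrite /h /apply_kernel; under eq_bigr => z _ do rewrite mulrBr mulr1 mulrA.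
  by rewrite sumrB P1 -mulr_suml.
have h_norm m : \sum_y pi y * h m y ^+ 2 <= (1 - (2 * K)^-1) ^+ m / pi x0.
  elim: m => [|m IH].
    rewrite expr0 mul1r.
    have -> : \sum_y pi y * h 0 y ^+ 2 = (pi x0)^-1 - 1.
      transitivity (\sum_y ((y == x0)%:R * (pi y / pi x0 ^+ 2 - pi y / pi x0 *+ 2) + pi y)).
        apply: eq_bigr => y _; rewrite /h /=.
        case: (y == x0) => /=; first by rewrite !mul1r; field; rewrite gt_eqF.
        by rewrite !mul0r !add0r sqrrN expr1n mulr1.
      rewrite big_split /= pi_sum (bigD1 x0) //= eqxx mul1r big1 ?addr0; last first.
        by move=> y ny; rewrite (negbTE ny) mul0r.
      by field; rewrite gt_eqF.
    by rewrite gerBl ler01.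
  rewrite exprS -mulrA; apply: le_trans (ler_wpM2l r0 IH).
  under eq_bigr => y _ do rewrite h_step.
  exact: contraction.
apply: le_trans (h_norm n).
have -> : \sum_y `|kpow P n x0 y - pi y| = \sum_y pi y * `|h n y|.
  apply: eq_bigr => y _; rewrite -[pi y in RHS](gtr0_norm (pi_gt0 y)) -normrM; congr `|_|.
  by rewrite /h mulrBr mulr1 mulrA -kpow_rev mulrAC divff ?mul1r ?gt_eqF.
apply: le_trans (jensen _ (fun y => ltW (pi_gt0 y)) pi_sum) _.
by apply: ler_sum => y _; rewrite real_normK // num_real.
Qed.

End Gap.
End Kernels.

(** * Expected outcome of a program *)

Section Semantics.
Variables (R : realFieldType) (input : seq nat) (oracles : seq (nat -> nat)).
Local Notation step := (step input oracles).
Local Notation regs := (nat -> nat).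

(** Average over the next [n] random bits; every step consumes one, used or not, and a halted
    machine ignores the rest. *)
Fixpoint ev n (cf : config) (F : config -> R) : R :=
  if n is n'.+1 then (ev n' (step cf true) F + ev n' (step cf false) F) / 2
  else F cf.

Lemma ev_sum n cf F :
  ev n cf F = (\sum_(bits : n.-tuple bool) F (foldl step cf bits)) / 2 ^+ n.
Proof.
elim: n cf => [|n IH] cf.
  rewrite /= expr0 divr1 (bigD1 [tuple]) //= big1 ?addr0 // => t.
  by rewrite (tuple0 t) => /eqP.
rewrite /= !IH -mulrDl -mulrA -invfM -exprSr; congr (_ / _).
rewrite (reindex (fun p : bool * n.-tuple bool => cons_tuple p.1 p.2)) /=; last first.
  exists (fun t : n.+1.-tuple bool => (thead t, behead_tuple t)) => [[b t] _|t _] /=.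
    by congr (_, _); apply/val_inj.
  by apply/val_inj; rewrite [in RHS](tuple_eta t).
rewrite -(pair_bigA _ (fun b (t : n.-tuple bool) => F (foldl step (step cf b) t))) /=.
by rewrite big_bool.
Qed.

Variables (F : config -> R) (cap : nat).

(* Starting the commands [s] from the registers [m] costs at most [K], and the
   final expectation of [F] is [v], provided the budget [cap] is respected. *)
Definition outcome (s : seq cmd) (m : regs) (K : nat) (v : R) :=
  forall t n, (K <= n)%N -> (t + K <= cap)%N -> ev n (Config s m t) F = v.

Lemma outcome_mono s m K K' v : outcome s m K v -> (K <= K')%N -> outcome s m K' v.
Proof.
move=> h le t n nK tK; apply: h; first exact: leq_trans nK.
by apply: leq_trans tK; rewrite leq_add2l.
Qed.

Lemma outcome_nil m v : (forall t, (t <= cap)%N -> F (Config [::] m t) = v) ->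
  outcome [::] m 0 v.
Proof.
move=> h t n _; rewrite addn0 => tc.
by elim: n => [|n IH] /=; [exact: h|rewrite IH; field].
Qed.

Lemma outcome_det c s m s' m' K k v :
  (forall t b, step (Config (c :: s) m t) b = Config s' m' (t + k)) -> (0 < k)%N ->
  outcome s' m' K v -> outcome (c :: s) m (k + K) v.
Proof.
move=> st k0 h t [|n] nK tK; first by move: nK; lia.
rewrite [LHS](_ : _ = (ev n (step (Config (c :: s) m t) true) F +
  ev n (step (Config (c :: s) m t) false) F) / 2) // !st (h (t + k)%N); first by field.
- by move: nK; lia.
- by rewrite -addnA.
Qed.

Lemma outcome_step c s m s' m' K v :
  (forall t b, step (Config (c :: s) m t) b = Config s' m' t.+1) ->
  outcome s' m' K v -> outcome (c :: s) m K.+1 v.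
Proof.
by move=> st; apply: (@outcome_det c s m s' m' K 1) => // t b; rewrite st addn1.
Qed.

Lemma outcome_seq c1 c2 s m K v : outcome [:: c1, c2 & s] m K v -> outcome (CSeq c1 c2 :: s) m K.+1 v.
Proof. exact: outcome_step. Qed.

Lemma outcome_if a c1 c2 s m K v :
  outcome ((if m a == 0%N then c2 else c1) :: s) m K v -> outcome (CIf a c1 c2 :: s) m K.+1 v.
Proof. exact: outcome_step. Qed.

Lemma outcome_flip d s m K v1 v0 : outcome s (upd m d 1) K v1 -> outcome s (upd m d 0) K v0 ->
  outcome (CFlip d :: s) m K.+1 ((v1 + v0) / 2).
Proof.
move=> h1 h0 t [|n] nK tK; first by move: nK; rewrite ltn0.
by rewrite /= h1 ?h0 // addSnnS.
Qed.

Lemma outcome_query d o a s m K v (ans := nth (fun=> 0%N) oracles o (m a)) :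
  outcome s (upd m d ans) K v ->
  outcome (CQuery d o a :: s) m ((m a + trunc_log 2 ans).+1 + K) v.
Proof. exact: outcome_det. Qed.

Fixpoint simple c := match c with
  | CFlip _ | CIf _ _ _ | CWhile _ _ | CQuery _ _ _ | CSeq _ _ => false
  | _ => true end.

Definition simple_step (m : regs) c : regs := match c with
  | CConst d k => upd m d k
  | CAdd d a b => upd m d (m a + m b)
  | CSub d a b => upd m d (m a - m b)
  | CHalf d a => upd m d (m a)./2
  | CFetch d a => upd m d (m (m a))
  | CStore a b => upd m (m a) (m b)
  | CRead d a => upd m d (nth 0%N input (m a))
  | _ => m end.

Definition run_simple (m : regs) cs := foldl simple_step m cs.

Lemma outcome_simple c s m K v : simple c ->
  outcome s (simple_step m c) K v -> outcome (c :: s) m K.+1 v.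
Proof. by case: c => // *; apply: outcome_step; eauto. Qed.

Lemma outcome_block cs c s m K v : all simple cs ->
  outcome (c :: s) (run_simple m cs) K v ->
  outcome (foldr CSeq c cs :: s) m ((size cs).*2 + K) v.
Proof.
elim: cs m => [|c' cs IH] m //= /andP[sc scs] h.
by apply: outcome_seq; apply: outcome_simple => //; apply: IH.
Qed.

Lemma outcome_skip s m K v : outcome s m K v -> outcome (CSkip :: s) m K.+1 v.
Proof. exact: outcome_step. Qed.

Section While.
Variables (a : nat) (body : cmd) (X : Type) (I : nat -> X -> regs -> Prop).
Variables (V : nat -> X -> R) (kb : nat).
Hypothesis test : forall i x m, I i x m -> (m a == 0%N) = (i == 0%N).
Hypothesis bodyP : forall i x m, I i.+1 x m -> forall s K,
  (forall y m', I i y m' -> outcome s m' K (V i y)) -> outcome (body :: s) m (kb + K) (V i.+1 x).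

(** [i] counts the iterations left, [x] is a ghost state and [V i x] the expected result from there.
    The body is specified against an arbitrary continuation, so random branching inside it requires
    no description of intermediate laws. *)
Lemma outcome_while i x m s K : I i x m ->
  (forall y m', I 0 y m' -> outcome s m' K (V 0 y)) ->
  outcome (CWhile a body :: s) m (kb.+1 * i + K.+1) (V i x).
Proof.
move=> Im h; elim: i x m Im => [|i IH] x m Im.
  rewrite muln0; apply: outcome_step (h _ _ Im) => t b /=.
  by rewrite (test Im).
rewrite mulnS addSn addSn -addnA; apply: (@outcome_step _ _ _ [:: body, CWhile a body & s] m).
  by move=> t b /=; rewrite (test Im).
apply: bodyP Im _ _ _ => y m' Im'; exact: IH.
Qed.
End While.

Local Open Scope nat_scope.

Definition same_off (l : seq nat) (m m' : regs) := forall i, i \notin l -> m' i = m i.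

Lemma same_off_upd l m m' d k : same_off l m m' -> d \in l -> same_off l m (upd m' d k).
Proof.
move=> sm dl i il; rewrite /upd; case: eqP => [e|_]; last exact: sm.
by rewrite e dl in il.
Qed.

Lemma same_off_trans l1 l2 l m m' m'' : same_off l1 m m' -> same_off l2 m' m'' ->
  {subset l1 <= l} -> {subset l2 <= l} -> same_off l m m''.
Proof.
move=> s1 s2 h1 h2 i il; rewrite s2 ?s1 //; first by apply: contra il => /h1.
by apply: contra il => /h2.
Qed.

Lemma same_off_sub l l' m m' : same_off l m m' -> {subset l <= l'} -> same_off l' m m'.
Proof. by move=> so sub i il; apply: so; apply: contra il => /sub. Qed.

Lemma sum_pow2S (v : nat -> R) x i :
  (\sum_(u < 2 ^ i.+1) v (x * 2 ^ i.+1 + u)%N =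
  \sum_(u < 2 ^ i) v ((x + x + 1) * 2 ^ i + u)%N +
  \sum_(u < 2 ^ i) v ((x + x) * 2 ^ i + u)%N)%R.
Proof.
rewrite -!(big_mkord xpredT (fun u => v (_ + u)%N)) expnS mul2n -addnn.
rewrite (big_cat_nat (n := (2 ^ i)%N)) ?leq_addr //= addrC; congr (_ + _)%R.
  have := @big_addn R 0%R +%R 0 (2 ^ i + 2 ^ i) (2 ^ i) xpredT
    (fun u => v (x * (2 ^ i + 2 ^ i) + u)).
  rewrite add0n addnK => ->.
  by apply: eq_bigr => u _; congr (v _); lia.
by apply: eq_bigr => u _; congr (v _); lia.
Qed.

(* Register 0 holds the address of the first spin, 1 the number of spins, 2 the
   constant 1, 3 the number of random bits of a coin, 4 the threshold of the coin
   of bias [exp (- beta)], 5 and 6 those of the coins for the field, 7 the number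
   of steps left, 8 the constant 0; registers 10 to 31 are scratch. *)
Definition draw := foldr CSeq (CWhile 10 (CSeq (CFlip 12)
   (foldr CSeq CSkip [:: CAdd 11 11 11; CAdd 11 11 12; CSub 10 10 2])))
  [:: CAdd 10 3 8; CConst 11 0].

Lemma outcome_draw L m s K (v : nat -> R) : m 3 = L -> m 2 = 1%N -> m 8 = 0%N ->
  (forall U m', m' 11 = U -> same_off [:: 10; 11; 12] m m' -> outcome s m' K (v U)) ->
  outcome (draw :: s) m (10 * L + 5 + K) ((\sum_(U < 2 ^ L) v U) / 2 ^+ L)%R.
Proof.
move=> m3 m2 m8 h.
pose I i x m' := [/\ m' 10 = i, m' 11 = x & same_off [:: 10; 11; 12] m m'].
pose V i x := ((\sum_(u < 2 ^ i) v (x * 2 ^ i + u)%N) / 2 ^+ i)%R.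
have -> : ((\sum_(U < 2 ^ L) v U) / 2 ^+ L)%R = V L 0%N.
  by rewrite /V; congr (_ / _)%R; apply: eq_bigr => u _; rewrite mul0n.
eapply outcome_mono; [eapply outcome_block; [by []|eapply (@outcome_while 10 _ _ I V 9)] | ].
- by move=> i x m' [->].
- move=> i x m' [mi mx so] s' K' h'.
  have m'2 : m' 2 = 1%N by rewrite so.
  have -> : V i.+1 x = ((V i (x + x + 1)%N + V i (x + x)%N) / 2)%R.
    by rewrite /V sum_pow2S exprS -mulrDl -mulrA -invfM [(2 * _)%R]mulrC.
  eapply outcome_mono; [eapply outcome_seq; eapply outcome_flip; (eapply outcome_block; [by []|eapply outcome_skip; apply: h']) | by rewrite /=; lia].
    split; rewrite /run_simple /= /upd /= ?mi ?mx ?m'2 ?subn1 //.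
    by do 4 (apply: same_off_upd => //).
  split; rewrite /run_simple /= /upd /= ?mi ?mx ?m'2 ?subn1 ?addn0 //.
  by do 4 (apply: same_off_upd => //).
- split; rewrite /run_simple /= /upd /= ?m3 ?m8 ?addn0 //.
  by do 2 (apply: same_off_upd => //).
- move=> y m' [_ my so]; rewrite (_ : V 0%N y = v y); first exact: h.
  by rewrite /V expr0 divr1 big_ord1 muln1 addn0.
by rewrite /=; lia.
Qed.

(** Truncated subtraction compares the draw in register 11 with the threshold in register 13.
    Failure clears the flag in register 14 and success leaves it alone, so successive coins form a
    conjunction. *)
Definition coin := CSeq draw (CSeq (CSub 12 13 11) (CIf 12 CSkip (CConst 14 0))).

Definition coin_prob L thr : R := ((minn thr (2 ^ L))%:R / 2 ^+ L)%R.

Lemma outcome_coin L m s K va vr : m 3 = L -> m 2 = 1%N -> m 8 = 0%N ->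
  (forall m', same_off [:: 10; 11; 12] m m' -> outcome s m' K va) ->
  (forall m', m' 14 = 0%N -> same_off [:: 10; 11; 12; 14] m m' -> outcome s m' K vr) ->
  outcome (coin :: s) m (10 * L + 10 + K)
    (coin_prob L (m 13) * va + (1 - coin_prob L (m 13)) * vr)%R.
Proof.
move=> m3 m2 m8 ha hr.
pose v U := if (U < m 13)%N then va else vr.
have -> : (coin_prob L (m 13) * va + (1 - coin_prob L (m 13)) * vr =
   (\sum_(U < 2 ^ L) v U) / 2 ^+ L)%R.
  have [k kE] : exists k, k = minn (m 13) (2 ^ L) by eexists.
  have kle : (k <= 2 ^ L)%N by rewrite kE geq_minr.
  have -> : (\sum_(U < 2 ^ L) v U = k%:R * va + (2 ^ L - k)%N%:R * vr)%R.
    rewrite -(big_mkord xpredT v) (big_cat_nat (n := k)) //=; congr (_ + _)%R.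
      rewrite (eq_big_nat _ _ (F2 := fun=> va)).
        by rewrite sumr_const_nat subn0 mulr_natl.
      by move=> i /andP[_]; rewrite /v kE ltn_min => /andP[-> _].
    rewrite (eq_big_nat _ _ (F2 := fun=> vr)); first by rewrite sumr_const_nat mulr_natl.
    move=> i /andP[ki iL]; rewrite /v; case: ltnP => // im.
    by move: ki; rewrite kE leqNgt ltn_min im iL.
  rewrite /coin_prob -kE natrB // natrX; field.
  by rewrite expf_neq0 // pnatr_eq0.
eapply outcome_mono; [eapply outcome_seq; eapply (@outcome_draw L _ _ (4 + K)) => // | by lia].
move=> U m' mU so; have m'13 : m' 13 = m 13 by rewrite so.
apply: outcome_seq; apply: outcome_simple; first by [].
apply: outcome_if; rewrite /= /upd /= mU m'13 subn_eq0 /v ltnNge.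
case: leqP => le /=.
  apply: outcome_simple => //; apply: hr; first by [].
  apply: same_off_upd => //; apply: same_off_upd => //.
  by apply: same_off_sub so _ => i; rewrite !inE => /or3P[] /eqP->.
by apply: outcome_skip; apply: ha; apply: same_off_upd.
Qed.

(** The flag survives all tosses with probability a power of the bias; no power is ever computed. *)
Definition coins := CWhile 15 (foldr CSeq (CSeq coin (CSub 15 15 2)) [:: CAdd 13 4 8]).

Definition acc_regs := [:: 10; 11; 12; 13; 14; 15].

Lemma outcome_coins L c m s K va vr : m 3 = L -> m 2 = 1%N -> m 8 = 0%N -> m 15 = c ->
  m 14 != 0%N ->
  (forall b m', (m' 14 != 0%N) = b -> same_off acc_regs m m' ->
     outcome s m' K (if b then va else vr)) ->
  outcome (coins :: s) m ((10 * L + 15) * c + K.+1)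
    (coin_prob L (m 4) ^+ c * va + (1 - coin_prob L (m 4) ^+ c) * vr)%R.
Proof.
move=> m3 m2 m8 m15 m14 h; set p := coin_prob L (m 4).
pose I i b m' := [/\ m' 15 = i, (m' 14 != 0%N) = b & same_off acc_regs m m'].
pose V i (b : bool) := if b then (p ^+ i * va + (1 - p ^+ i) * vr)%R else vr.
rewrite -/(V c true).
eapply outcome_mono; [eapply (@outcome_while 15 _ _ I V (10 * L + 14)) | ].
- by move=> i x m' [->].
- move=> i b m' [mi mb so] s' K' h'.
  have m'3 : m' 3 = L by rewrite so.
  have m'2 : m' 2 = 1%N by rewrite so.
  have m'8 : m' 8 = 0%N by rewrite so.
  have m'4 : m' 4 = m 4 by rewrite so.
  have -> : V i.+1 b = (p * V i b + (1 - p) * V i false)%R.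
    by rewrite /V; case: b {mb}; [rewrite exprS; ring|ring].
  set m1 := upd m' 13 (m 4).
  have so1 : same_off acc_regs m m1 by apply: same_off_upd.
  eapply outcome_mono; [eapply outcome_block; [by []|rewrite /run_simple /= m'4 m'8 addn0 -/m1; eapply outcome_seq] | ].
    have pE : p = coin_prob L (m1 13) by [].
    rewrite pE; eapply (@outcome_coin L) => //.
      move=> m2' so2; apply: outcome_simple; first by [].
      have e i' : i' \notin [:: 10; 11; 12] -> m2' i' = m1 i' by move=> /so2.
      apply: h'; split.
      + by rewrite /= /upd /= !e // /m1 /upd /= mi m'2 subn1.
      + by rewrite /= /upd /= !e // /m1 /upd /= mb.
      + apply: same_off_upd => //; apply: (same_off_trans so1 so2) => // j.
        by rewrite !inE => /or3P[] ->; rewrite ?orbT.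
    move=> m2' z2 so2; apply: outcome_simple; first by [].
    have e i' : i' \notin [:: 10; 11; 12; 14] -> m2' i' = m1 i' by move=> /so2.
    refine (h' false _ _); split.
    + by rewrite /= /upd /= !e // /m1 /upd /= mi m'2 subn1.
    + by rewrite /= /upd /= z2.
    + apply: same_off_upd => //; apply: (same_off_trans so1 so2) => // j.
      by rewrite !inE => /or4P[] ->; rewrite ?orbT.
  by rewrite /=; lia.
- by split.
- move=> b m' [_ mb so]; rewrite (_ : V 0%N b = if b then va else vr); first exact: h.
  by rewrite /V expr0 subrr mul0r addr0 mul1r.
by lia.
Qed.

(** Bits are drawn until the range, doubled in register 17, reaches the number of spins: so
    [up_log 2 n] is found on the fly. A draw beyond the last spin will make the step idle, which
    avoids a rejection loop of unbounded length. *)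
Definition site := foldr CSeq (CWhile 18 (CSeq (CFlip 12)
   (foldr CSeq CSkip [:: CAdd 16 16 16; CAdd 16 16 12; CAdd 17 17 17; CSub 18 1 17])))
  [:: CConst 16 0; CConst 17 1; CSub 18 1 17].

Definition site_regs := [:: 12; 16; 17; 18].

Lemma outcome_site n m s K (v : nat -> R) (r := up_log 2 n) : m 1 = n ->
  (forall U m', m' 16 = U -> same_off site_regs m m' -> outcome s m' K (v U)) ->
  outcome (site :: s) m (12 * r + 7 + K) ((\sum_(U < 2 ^ r) v U) / 2 ^+ r)%R.
Proof.
move=> m1 h.
pose I i x m' := [/\ m' 16 = x, m' 17 = (2 ^ (r - i))%N, m' 18 = (n - 2 ^ (r - i))%N,
  (i <= r)%N & same_off site_regs m m'].
pose V i x := ((\sum_(u < 2 ^ i) v (x * 2 ^ i + u)%N) / 2 ^+ i)%R.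
have -> : ((\sum_(U < 2 ^ r) v U) / 2 ^+ r)%R = V r 0%N.
  by rewrite /V; congr (_ / _)%R; apply: eq_bigr => u _; rewrite mul0n.
eapply outcome_mono; [eapply outcome_block; [by []|eapply (@outcome_while 18 _ _ I V 11)] | ].
- move=> i x m' [_ _ -> ir _]; rewrite subn_eq0; apply/idP/idP => [le|/eqP->].
    have := up_log_min (isT : (1 < 2)%N) le; rewrite -/r; lia.
  by rewrite subn0 up_logP.
- move=> i x m' [mx mp mi ir so] s' K' h'.
  have m'1 : m' 1 = n by rewrite so.
  have pE : (2 ^ (r - i.+1) + 2 ^ (r - i.+1))%N = (2 ^ (r - i))%N.
    by rewrite addnn -mul2n -expnS; congr (2 ^ _)%N; lia.
  have -> : V i.+1 x = ((V i (x + x + 1)%N + V i (x + x)%N) / 2)%R.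
    by rewrite /V sum_pow2S exprS -mulrDl -mulrA -invfM [(2 * _)%R]mulrC.
  eapply outcome_mono; [eapply outcome_seq; eapply outcome_flip; (eapply outcome_block; [by []|eapply outcome_skip; apply: h']) | by rewrite /=; lia].
    split; rewrite /run_simple /= /upd /= ?mx ?mp ?m'1 ?pE //; first exact: ltnW.
    by do 5 (apply: same_off_upd => //).
  split; rewrite /run_simple /= /upd /= ?mx ?mp ?m'1 ?pE ?addn0 //; first exact: ltnW.
  by do 5 (apply: same_off_upd => //).
- split; rewrite /run_simple /= /upd /= ?m1 ?subnn ?expn0 //.
  by do 3 (apply: same_off_upd => //).
- move=> y m' [my _ _ _ so]; rewrite (_ : V 0%N y = v y); first exact: h.
  by rewrite /V expr0 divr1 big_ord1 muln1 addn0.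
by rewrite /=; lia.
Qed.

(** The offset of a row of the adjacency matrix by repeated addition, as the machine cannot
    multiply. It starts at 1 because the input begins with the number of vertices. *)
Definition rowptr := foldr CSeq (CWhile 20 (foldr CSeq CSkip [:: CAdd 19 19 1; CSub 20 20 2]))
  [:: CAdd 20 16 8; CConst 19 1].

Lemma outcome_rowptr n u m s K v : m 1 = n -> m 2 = 1%N -> m 8 = 0%N -> m 16 = u ->
  (forall m', m' 19 = (u * n).+1 -> same_off [:: 19; 20] m m' -> outcome s m' K v) ->
  outcome (rowptr :: s) m (6 * u + 5 + K) v.
Proof.
move=> m1 m2 m8 m16 h.
pose I i (x : unit) m' := [/\ m' 20 = i, m' 19 = ((u - i) * n).+1, (i <= u)%N &
  same_off [:: 19; 20] m m'].
eapply outcome_mono; [eapply outcome_block; [by []|eapply (@outcome_while 20 _ _ I (fun _ _ => v) 5) with (x := tt)] | ].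
- by move=> i x m' [->].
- move=> i x m' [mi mx iu so] s' K' h'.
  have m'1 : m' 1 = n by rewrite so.
  have m'2 : m' 2 = 1%N by rewrite so.
  eapply outcome_mono; [eapply outcome_block; [by []|eapply outcome_skip; apply: (h' tt)] | by rewrite /=; lia].
  split; rewrite /run_simple /= /upd /= ?mx ?mi ?m'1 ?m'2 ?subn1 //; last 2 first.
  + exact: ltnW.
  + by do 2 (apply: same_off_upd => //).
  + by rewrite (_ : (u - i = (u - i.+1).+1)%N); [rewrite mulSn; lia|lia].
- split; rewrite /run_simple /= /upd /= ?m16 ?m8 ?addn0 ?subnn //.
  by do 2 (apply: same_off_upd => //).
- by move=> _ m' [_ mx _ so]; apply: h => //; rewrite mx subn0.
by rewrite /=; lia.
Qed.

Lemma nth_allpairs (S T : Type) (f : S -> T -> nat) (l1 : seq S) (l2 : seq T) x y i j :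
  i < size l1 -> j < size l2 ->
  nth 0 [seq f a b | a <- l1, b <- l2] (i * size l2 + j) = f (nth x l1 i) (nth y l2 j).
Proof.
elim: l1 i => [|a l1 IH] [|i] //= il jl; rewrite nth_cat size_map.
  by rewrite mul0n add0n jl (nth_map y).
rewrite mulSn -addnA ltnNge leq_addr /= addKn; exact: IH.
Qed.

(** * One Metropolis update on the machine *)

Section Update.
Variables (G : sgraph) (sq : seq G).
Hypothesis sq_uniq : uniq sq.
Hypothesis sq_all : forall e : G, e \in sq.
Hypothesis inputE : input = graph_code sq.
Implicit Types (sg : {ffun G -> bool}) (e f : G).
Let n := size sq.
Variables (base L q lam pw : nat).
Hypothesis base_ge : 32 <= base.

Definition holds sg (m : regs) :=
  [/\ [/\ m 0 = base, m 1 = n, m 2 = 1 & m 3 = L],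
      [/\ m 4 = q, m 5 = lam, m 6 = pw & m 8 = 0] &
      forall e, m (base + index e sq) = sg e].

Lemma holds_same_off l sg m m' : holds sg m -> same_off l m m' ->
  all (fun i => (8 < i) && (i < 32)) l -> holds sg m'.
Proof.
move=> [[h0 h1 h2 h3] [h4 h5 h6 h8] hs] so /allP al.
have nin i : (i <= 8) || (32 <= i) -> i \notin l.
  by move=> hi; apply: contraL hi => /al; lia.
by split; [split|split|move=> e]; rewrite so // nin //; lia.
Qed.

Lemma index_ltn e : index e sq < n.
Proof. by rewrite index_mem. Qed.

Lemma input_adj e f : nth 0 input ((index e sq * n).+1 + index f sq) = adj e f.
Proof.
rewrite inputE /= (@nth_allpairs _ _ _ sq sq e f) ?index_ltn //.
by rewrite !nth_index.
Qed.

(** Registers 24 and 25 count the neighbours that agree and disagree with the spin in register 22.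
    The sum of the two truncated differences vanishes exactly when the spins agree. *)
Definition nbr_compare := foldr CSeq (CIf 28 (CAdd 25 25 2) (CAdd 24 24 2))
  [:: CFetch 27 23; CSub 28 27 22; CSub 29 22 27; CAdd 28 28 29].
Definition nbr_advance := foldr CSeq CSkip [:: CAdd 19 19 2; CAdd 23 23 2; CSub 20 20 2].
Definition nbr_body :=
  CSeq (CRead 26 19) (CSeq (CIf 26 nbr_compare CSkip) nbr_advance).

Definition nbr := foldr CSeq (CWhile 20 nbr_body)
  [:: CAdd 21 0 16; CFetch 22 21; CAdd 20 1 8; CAdd 23 0 8; CConst 24 0; CConst 25 0].

Definition nbr_regs := [:: 19; 20; 21; 22; 23; 24; 25; 26; 27; 28; 29].

Definition agree sg e (l : seq G) := count (fun f => adj e f && (sg f == sg e)) l.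
Definition disagree sg e (l : seq G) := count (fun f => adj e f && (sg f != sg e)) l.

Lemma outcome_nbr sg e m s K v : holds sg m -> m 16 = index e sq ->
  m 19 = (index e sq * n).+1 ->
  (forall m', m' 21 = base + index e sq -> m' 22 = sg e ->
     m' 24 = agree sg e sq -> m' 25 = disagree sg e sq ->
     same_off nbr_regs m m' -> outcome s m' K v) ->
  outcome (nbr :: s) m (25 * n + 13 + K) v.
Proof.
move=> hm m16 m19 h.
have [[h0 h1 h2 h3] [h4 h5 h6 h8] hs] := hm.
pose I i (x : unit) m' := [/\ m' 20 = i /\ i <= n,
  m' 19 = (index e sq * n).+1 + (n - i) /\ m' 23 = base + (n - i),
  m' 21 = base + index e sq /\ m' 22 = sg e,
  m' 24 = agree sg e (take (n - i) sq) /\ m' 25 = disagree sg e (take (n - i) sq) &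
  same_off nbr_regs m m'].
eapply outcome_mono; [eapply outcome_block; [by []|eapply (@outcome_while 20 _ _ I (fun _ _ => v) 24) with (x := tt) (i := n)] | ].
- by move=> i x m' [[->]].
- move=> i x m' [[m20 iin] [m'19 m23] [m21 m22] [m24 m25] so] s' K' h'.
  have hm' : holds sg m' by apply: holds_same_off hm so _.
  have [[_ _ h2' _] _ hs'] := hm'.
  have jn : n - i.+1 < n by lia.
  set f := nth e sq (n - i.+1).
  have fi : index f sq = n - i.+1 by rewrite index_uniq.
  have tE : take (n - i) sq = rcons (take (n - i.+1) sq) f.
    by rewrite -(take_nth e) //; congr take; lia.
  have rd : nth 0 input (m' 19) = adj e f by rewrite m'19 -fi input_adj.
  have fin m1 : (forall j, j \notin [:: 24; 25; 26; 27; 28; 29] -> m1 j = m' j) ->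
      m1 24 = agree sg e (take (n - i) sq) -> m1 25 = disagree sg e (take (n - i) sq) ->
      outcome (nbr_advance :: s') m1 (7 + K') v.
    move=> so1 a1 d1.
    eapply outcome_mono; [eapply outcome_block; [by []|eapply outcome_skip; apply: (h' tt)] | by rewrite /=; lia].
    split; last first.
      do 3 (apply: same_off_upd => //); apply: (same_off_trans so (l2 := [:: 24; 25; 26; 27; 28; 29])) => //.
      by move=> j; rewrite !inE => /or4P[->|->|->|/or3P[]->]; rewrite ?orbT.
    + by split; rewrite /run_simple /= /upd /=.
    + by split; rewrite /run_simple /= /upd /= !so1.
    + by split; rewrite /run_simple /= /upd /= !so1 // ?h2' ?m'19 ?m23; lia.
    + by split; rewrite /run_simple /= /upd /= ?so1 // ?h2' ?m20 ?subn1 //; lia.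
  apply: outcome_seq; apply: outcome_simple => //; apply: outcome_seq.
  eapply outcome_mono; [apply: outcome_if | exact: leqnn].
  set m1 := simple_step m' _.
  have m1so j : j != 26 -> m1 j = m' j by rewrite /m1 /= /upd => /negbTE->.
  have m126 : m1 26 = adj e f by rewrite /m1 /= /upd /= rd.
  rewrite m126; case adjE: (adj e f) => /=; last first.
    eapply outcome_mono; [apply: outcome_skip; apply: fin | ].
    + by move=> j; rewrite !inE !negb_or => /and4P[_ _ j26 _]; apply: m1so.
    + by rewrite m1so // m24 tE /agree -cats1 count_cat /= adjE /= !addn0.
    + by rewrite m1so // m25 tE /disagree -cats1 count_cat /= adjE /= !addn0.
    + by lia.
  eapply outcome_mono; [eapply outcome_block; [by []|] | ].
    set m2 := run_simple m1 _.
    have e23 : m1 (m1 23) = sg f by rewrite !m1so // ?m23 -?fi ?hs' //; lia.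
    have m2E : [/\ m2 24 = m' 24, m2 25 = m' 25, m2 2 = 1 & m2 28 = (sg f != sg e) :> nat].
      rewrite /m2 /run_simple /= /upd /= e23 !m1so // m22 h2'; split=> //.
      by case: (sg f); case: (sg e).
    have m2so j : j \notin [:: 24; 25; 26; 27; 28; 29] -> m2 j = m' j.
      rewrite !inE !negb_or => /and4P[_ _ j26 /and3P[j27 j28 j29]].
      rewrite /m2 /run_simple /= /upd /= (negbTE j27) (negbTE j28) (negbTE j29).
      exact: m1so.
    have [e24 e25 e2 e28] := m2E.
    apply: outcome_if; rewrite e28; case sfe: (sg f == sg e) => /=.
      apply: outcome_simple => //; apply: fin.
      * move=> j jn'; rewrite /= /upd; case: eqP => [je|_]; last exact: m2so.
        by rewrite je in jn'.
      * by rewrite /= /upd /= e24 e2 m24 tE /agree -cats1 count_cat /= adjE sfe.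
      * by rewrite /= /upd /= e25 m25 tE /disagree -cats1 count_cat /= adjE sfe /= !addn0.
    apply: outcome_simple => //; apply: fin.
    + move=> j jn'; rewrite /= /upd; case: eqP => [je|_]; last exact: m2so.
      by rewrite je in jn'.
    + by rewrite /= /upd /= e24 m24 tE /agree -cats1 count_cat /= adjE sfe /= !addn0.
    + by rewrite /= /upd /= e25 e2 m25 tE /disagree -cats1 count_cat /= adjE sfe.
  by rewrite /=; lia.
- split; last by rewrite /run_simple /=; do 6 (apply: same_off_upd => //).
  + by rewrite /run_simple /= /upd /= h1 h8 addn0.
  + by rewrite /run_simple /= /upd /= subnn addn0 h0 h8 m19 !addn0.
  + rewrite /run_simple /= /upd /= h0 m16; split=> //.
    by rewrite ifN ?hs //; apply/eqP; move: base_ge; lia.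
  + by rewrite subnn take0.
- move=> _ m' [_ _ [m21 m22] [m24 m25] so]; apply: h => //.
    by rewrite m24 subn0 take_size.
  by rewrite m25 subn0 take_size.
by rewrite /=; lia.
Qed.

(** The field enters through the ratio of two thresholds: register 6 for flips from 1 to 0, register
    5 for flips from 0 to 1. *)
Definition nu_coin := CSeq (CIf 22 (CAdd 13 6 8) (CAdd 13 5 8)) coin.
Definition do_flip := foldr CSeq CSkip [:: CSub 22 2 22; CStore 21 22].
(** A flip changes the cut by [agree - disagree] and only a decrease is penalised, so the truncated
    difference of registers 25 and 24 is the number of coins in the Metropolis rule. *)
Definition accept := foldr CSeq (CSeq coins (CSeq nu_coin (CIf 14 do_flip CSkip)))
  [:: CSub 15 25 24; CConst 14 1].
Definition update := CSeq rowptr (CSeq nbr accept).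

Definition accept_prob sg e : R :=
  (coin_prob L q ^+ (disagree sg e sq - agree sg e sq) *
   coin_prob L (if sg e then pw else lam))%R.

Lemma outcome_accept sg e m s K v0 v1 : holds sg m ->
  m 21 = base + index e sq -> m 22 = sg e ->
  m 24 = agree sg e sq -> m 25 = disagree sg e sq ->
  (forall m', holds sg m' -> m' 7 = m 7 -> outcome s m' K v0) ->
  (forall m', holds (flip sg [set e]) m' -> m' 7 = m 7 -> outcome s m' K v1) ->
  outcome (accept :: s) m ((10 * L + 15) * n + 10 * L + 40 + K)
    (accept_prob sg e * v1 + (1 - accept_prob sg e) * v0)%R.
Proof.
move=> hm m21 m22 m24 m25 h_0 h_1.
have [[h0 h1 h2 h3] [h4 h5 h6 h8] hs] := hm.
set c := disagree sg e sq - agree sg e sq.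
have cn : c <= n by rewrite /c; apply: leq_trans (leq_subr _ _) (count_size _ _).
set p := coin_prob L q; set p' := coin_prob L (if sg e then pw else lam).
have pE : accept_prob sg e = (p ^+ c * p')%R by [].
have pnE : (accept_prob sg e * v1 + (1 - accept_prob sg e) * v0 =
  p ^+ c * (p' * v1 + (1 - p') * v0) + (1 - p ^+ c) * v0)%R by rewrite pE; ring.
rewrite pnE.
eapply (@outcome_mono _ _ (4 + ((10 * L + 15) * c + (10 * L + 26 + K)).+1)); last first.
  have : (10 * L + 15) * c <= (10 * L + 15) * n by rewrite leq_mul2l cn orbT.
  by lia.
eapply outcome_block; [by []|eapply outcome_seq].
set m1 := run_simple m _.
have m1so : same_off acc_regs m m1 by do 2 (apply: same_off_upd => //).
have e4 : m1 4 = q by rewrite m1so.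
rewrite /p -e4; eapply (@outcome_mono _ _ ((10 * L + 15) * c + (25 + (10 * L + K)).+1)); last by lia.
apply: (@outcome_coins L c) => //; try by rewrite m1so.
  by rewrite /m1 /run_simple /= /upd /= m24 m25.
move=> b m2 m14 so2.
have so : same_off acc_regs m m2.
  by apply: (same_off_trans m1so so2).
have hm2 : holds sg m2 by apply: holds_same_off hm so _.
have [[g0 g1 g2 g3] [g4 g5 g6 g8] gs] := hm2.
have m2_22 : m2 22 = sg e by rewrite so.
have m2_21 : m2 21 = base + index e sq by rewrite so.
have m2_7 : m2 7 = m 7 by rewrite so.
apply: outcome_seq; apply: outcome_seq; apply: outcome_if.
rewrite (_ : (if m2 22 == 0 then _ else _) = CAdd 13 (if sg e then 6 else 5) 8); last first.
  by rewrite m2_22; case: (sg e).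
apply: outcome_simple; first by [].
set m3 := simple_step m2 _.
have m3so : same_off [:: 13] m2 m3 by apply: same_off_upd.
have m3_13 : m3 13 = if sg e then pw else lam.
  by rewrite /m3 /= /upd /= g8 addn0; case: (sg e); rewrite ?g5 ?g6.
rewrite (_ : (if b then _ else _) = coin_prob L (m3 13) * (if b then v1 else v0) +
   (1 - coin_prob L (m3 13)) * v0)%R; last by rewrite m3_13; case: b {m14}; rewrite // -/p'; ring.
eapply (@outcome_mono _ _ (10 * L + 10 + (10 + K))); last by lia.
apply: (@outcome_coin L); rewrite ?m3so //.
  move=> m4 so4.
  have so24 : same_off [:: 10; 11; 12; 13] m2 m4.
    apply: (same_off_trans m3so so4) => j; rewrite !inE.
      by move=> /eqP->.
    by case/or3P => /eqP->.
  have m4_7 : m4 7 = m 7 by rewrite so24 // m2_7.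
  have hm4 : holds sg m4 by apply: holds_same_off hm2 so24 _.
  apply: outcome_if; rewrite so24 // -[m2 14 == 0]negbK m14; case: b {m14} => /=; last first.
    by eapply outcome_mono; [apply: outcome_skip; exact: h_0 | lia].
  eapply outcome_mono; [eapply outcome_block; [by []|eapply outcome_skip; apply: h_1] | by rewrite /=; lia].
    have [[k0 k1 k2 k3] [k4 k5 k6 k8] ks] := hm4.
    have k22 : m4 22 = sg e by rewrite so24.
    have k21 : m4 21 = base + index e sq by rewrite so24.
    have addr : (upd m4 22 (m4 2 - m4 22)) 21 = base + index e sq by rewrite /upd /=.
    rewrite /run_simple /= addr.
    have lo i : i < 32 -> i != 22 -> upd (upd m4 22 (m4 2 - m4 22)) (base + index e sq)
       (upd m4 22 (m4 2 - m4 22) 22) i = m4 i.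
      move=> i32 i22; rewrite /upd (negbTE i22); case: eqP => // ie.
      by move: i32 base_ge; rewrite ie; lia.
    split; [split; rewrite lo //|split; rewrite lo //|].
    move=> f; rewrite {1}/upd eqn_add2l !ffunE inE.
    have [fe|fe] := eqVneq f e.
      by rewrite fe eqxx /upd /= k2 k22; case: (sg e).
    rewrite addbF -ks ifN; last first.
      apply: contra fe => /eqP fe; apply/eqP.
      by rewrite -(nth_index e (sq_all f)) fe nth_index.
    by rewrite /upd ifN //; apply/eqP; move: base_ge; lia.
  rewrite /run_simple /= /upd /=.
  by rewrite ifN ?m4_7 //; apply/eqP; move: base_ge; rewrite so24 // m2_21; lia.
move=> m4 z14 so4.
have so24 : same_off [:: 10; 11; 12; 13; 14] m2 m4.
  apply: (same_off_trans m3so so4) => j; rewrite !inE.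
    by move=> /eqP->.
  by case/or4P => /eqP->.
apply: outcome_if; rewrite z14 /=.
eapply outcome_mono; [apply: outcome_skip; apply: h_0 | by lia].
  by apply: holds_same_off hm2 so24 _.
by rewrite so24 // m2_7.
Qed.

Definition one_step := CSeq site (foldr CSeq (CIf 18 update CSkip) [:: CSub 18 1 16]).

Definition glauber_step (v : {ffun G -> bool} -> R) sg : R :=
  ((\sum_e (accept_prob sg e * v (flip sg [set e]) + (1 - accept_prob sg e) * v sg)
    + (2 ^ up_log 2 n - n)%:R * v sg) / 2 ^+ up_log 2 n)%R.

Definition step_cost := (10 * L + 50) * n + 12 * up_log 2 n + 10 * L + 90.

Lemma outcome_one_step sg m s K v : holds sg m ->
  (forall sg' m', holds sg' m' -> m' 7 = m 7 -> outcome s m' K (v sg')) ->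
  outcome (one_step :: s) m (step_cost + K) (glauber_step v sg).
Proof.
move=> hm h; have [[h0 h1 h2 h3] [h4 h5 h6 h8] hs] := hm.
set r := up_log 2 n.
pose V U : R := if insub U is Some i then
   let e := tnth (in_tuple sq) i in
   (accept_prob sg e * v (flip sg [set e]) + (1 - accept_prob sg e) * v sg)%R
   else v sg.
have n_le : n <= 2 ^ r by apply: up_logP.
have -> : glauber_step v sg = ((\sum_(U < 2 ^ r) V U) / 2 ^+ r)%R.
  rewrite /glauber_step -/r; congr (_ / _)%R.
  rewrite -(big_mkord xpredT V) (big_cat_nat (n := n)) //=; congr (_ + _)%R.
    rewrite big_mkord; transitivity (\sum_(i < n) V (index (tnth (in_tuple sq) i) sq))%R.
      rewrite -(big_tuple _ _ (in_tuple sq) xpredT (fun e => V (index e sq))) /=.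
      rewrite [RHS](perm_big (index_enum G)) /=; last first.
        by apply: uniq_perm => [||e]; rewrite ?index_enum_uniq ?sq_uniq ?mem_index_enum ?sq_all.
      apply: eq_bigr => e _; rewrite /V insubT ?index_ltn // => ie.
      by rewrite /= (tnth_nth e) /= nth_index.
    apply: eq_bigr => i _; rewrite (tnth_nth (tnth (in_tuple sq) i)) /= index_uniq //.
  rewrite (eq_big_nat _ _ (F2 := fun=> v sg)); first by rewrite sumr_const_nat mulr_natl.
  by move=> i /andP[ni _]; rewrite /V insubF // ltnNge ni.
eapply (@outcome_mono _ _ (12 * r + 7 + (10 + ((10 * L + 50) * n + 10 * L + 65 + K))).+1); last by rewrite /step_cost -/r; lia.
apply: outcome_seq; apply: outcome_site => // U m' m16 so.
have hm' : holds sg m' by apply: holds_same_off hm so _.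
have m'7 : m' 7 = m 7 by rewrite so.
have [[g0 g1 g2 g3] [g4 g5 g6 g8] gs] := hm'.
apply: outcome_seq; apply: outcome_simple => //; apply: outcome_if.
set m1 := simple_step m' _.
have so1 : same_off [:: 18] m' m1 by apply: same_off_upd.
have hm1 : holds sg m1 by apply: holds_same_off hm' so1 _.
have [[k0 k1 k2 k3] [k4 k5 k6 k8] ks] := hm1.
have m1_18 : m1 18 = n - U by rewrite /m1 /= /upd /= g1 m16.
rewrite m1_18 subn_eq0; case: leqP => [nU|Un].
  rewrite /V insubF; last by rewrite ltnNge nU.
  eapply outcome_mono; [apply: outcome_skip; apply: h hm1 _; by rewrite so1 | by lia].
rewrite /V insubT /=; set e := tnth _ _.
have ie : index e sq = U by rewrite /e (tnth_nth e) /= index_uniq.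
have m1_16 : m1 16 = index e sq by rewrite ie so1.
eapply (@outcome_mono _ _ (6 * index e sq + 5 + (25 * n + 13 + ((10 * L + 15) * n + 10 * L + 40 + K)).+1).+1); last first.
  by rewrite ie; lia.
apply: outcome_seq; apply: (@outcome_rowptr n) => // m2 m2_19 so2.
have hm2 : holds sg m2 by apply: holds_same_off hm1 so2 _.
apply: outcome_seq; apply: (outcome_nbr (e := e) hm2) => //; first by rewrite so2.
move=> m3 m21 m22 m24 m25 so3.
have hm3 : holds sg m3 by apply: holds_same_off hm2 so3 _.
have m3_7 : m3 7 = m 7 by rewrite so3 // so2 // so1.
apply: outcome_accept => // m4 hm4 m4_7; apply: h => //; by rewrite m4_7.
Qed.

Lemma holds_upd7 sg m k : holds sg m -> holds sg (upd m 7 k).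
Proof.
move=> [[h0 h1 h2 h3] [h4 h5 h6 h8] hs]; split; [by split|by split|move=> e].
by rewrite /upd ifN ?hs //; apply/eqP; move: base_ge; lia.
Qed.

Definition chain := CWhile 7 (CSeq one_step (CSub 7 7 2)).

Lemma outcome_chain sg m N s K v : holds sg m -> m 7 = N ->
  (forall sg' m', holds sg' m' -> outcome s m' K (v sg')) ->
  outcome (chain :: s) m ((step_cost + 3) * N + K.+1) (iter N glauber_step v sg).
Proof.
move=> hm m7 h.
pose I i sg' m' := holds sg' m' /\ m' 7 = i.
eapply outcome_mono; [eapply (@outcome_while 7 _ _ I (fun i => iter i glauber_step v) (step_cost + 2)) | ].
- by move=> i x m' [_ ->].
- move=> i x m' [hm' m'7] s' K' h'.
  eapply (@outcome_mono _ _ (step_cost + K'.+1).+1); last by lia.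
  apply: outcome_seq; apply: outcome_one_step => // sg' m2 hm2 m2_7.
  apply: outcome_simple => //; apply: h'; split; first exact: holds_upd7.
  have [[_ _ g2 _] _ _] := hm2.
  by rewrite /= /upd /= m2_7 m'7 g2 subn1.
- by split.
- by move=> sg' m' [hm' _]; apply: h.
by lia.
Qed.

End Update.

End Semantics.

(** * The sampling program *)

Section Program.
Variables (R : realFieldType) (input : seq nat) (oracles : seq (nat -> nat)).
Variables (F : config -> R) (cap : nat).
Local Notation outcome := (@outcome R input oracles F cap).
Local Notation regs := (nat -> nat).
Local Notation run_simple := (run_simple input).
Local Open Scope nat_scope.

Lemma upd_other (m : regs) d k i : i != d -> upd m d k i = m i.
Proof. by rewrite /upd => /negbTE->. Qed.

Lemma outcome_for a cs (I : nat -> regs -> Prop) i m s K v : all simple cs ->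
  (forall i m, I i m -> (m a == 0) = (i == 0)) ->
  (forall i m, I i.+1 m -> I i (run_simple m cs)) -> I i m ->
  (forall m', I 0 m' -> outcome s m' K v) ->
  outcome (CWhile a (foldr CSeq CSkip cs) :: s) m ((size cs).*2.+2 * i + K.+1) v.
Proof.
move=> scs test body Im h.
eapply (@outcome_while _ _ _ _ _ a _ unit (fun i _ => I i) (fun _ _ => v)) => //.
- by move=> i' _ m'; apply: test.
- move=> i' _ m' Im' s' K' h'.
  eapply (outcome_mono (K := ((size cs).*2 + K'.+1))); last by lia.
  apply: outcome_block => //; apply: outcome_skip; apply: (h' tt); exact: body.
Qed.

(* The registers below 32 come last, as they hold the addresses: each receives
   the address of its spin and is then dereferenced. *)
Definition out_copy := CWhile 10 (foldr CSeq CSkip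
  [:: CFetch 13 12; CStore 11 13; CAdd 11 11 2; CAdd 12 12 2; CSub 10 10 2]).
Definition out_finish := flatten [seq [:: CConst d d; CAdd d d 0] | d <- iota 1 31] ++
  [seq CFetch d d | d <- iota 0 32].
Definition output := foldr CSeq (CSeq out_copy (foldr CSeq CSkip out_finish))
  [:: CConst 14 32; CSub 10 1 14; CAdd 11 14 8; CAdd 12 0 14].

Lemma run_simple_cat m cs cs' :
  run_simple m (cs ++ cs') = run_simple (run_simple m cs) cs'.
Proof. exact: foldl_cat. Qed.

Lemma run_address k a m i : 0 < a ->
  run_simple m (flatten [seq [:: CConst d d; CAdd d d 0] | d <- iota a k]) i =
  if a <= i < a + k then i + m 0 else m i.
Proof.
elim: k a m => [|k IH] a m a0 /=; first by rewrite addn0; case: ifP => //; lia.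
rewrite /run_simple /= -/(run_simple _ _) IH //.
have a0n : (0 == a) = false by lia.
have -> : upd m a a a = a by rewrite /upd eqxx.
have -> : upd m a a 0 = m 0 by rewrite /upd a0n.
have -> : upd (upd m a a) a (a + m 0) 0 = m 0 by rewrite /upd a0n.
have [->|ia] := eqVneq i a.
  by rewrite ltnn leqnn /= ifT /upd ?eqxx //; lia.
have -> : upd (upd m a a) a (a + m 0) i = m i by rewrite /upd (negbTE ia).
rewrite (_ : (a.+1 <= i < a.+1 + k) = (a <= i < a + k.+1)) //.
by move: ia; lia.
Qed.

(** Each register is replaced by the contents of the address that it holds. The hypothesis puts all
    these addresses beyond the block, so no overwriting disturbs a later fetch. *)
Lemma run_fetch k a m i : (forall d, a <= d < a + k -> a + k <= m d) ->
  run_simple m [seq CFetch d d | d <- iota a k] i =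
  if a <= i < a + k then m (m i) else m i.
Proof.
elim: k a m => [|k IH] a m ge /=; first by case: ifP => //; lia.
have upda d : d != a -> upd m a (m (m a)) d = m d by rewrite /upd => /negbTE->.
rewrite /run_simple /= -/(run_simple _ _) IH; last first.
  move=> d hd; rewrite upda; last by lia.
  by have := ge d; lia.
have [->|ia] := eqVneq i a.
  by rewrite ltnn /= /upd eqxx ifT //; lia.
have -> : (a.+1 <= i < a.+1 + k) = (a <= i < a + k.+1) by move: ia; lia.
rewrite (upda i) //; case: ifP => // hi.
have mia : m i != a by have := ge i hi; lia.
by rewrite upda.
Qed.

Lemma outcome_output (G : sgraph) (sq : seq G) base L q lam pw sg m s K v :
  base = size sq + 32 -> holds sq base L q lam pw sg m -> (forall e : G, e \in sq) ->
  (forall m' : regs, (forall e, m' (index e sq) = sg e) -> outcome s m' K v) ->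
  outcome (output :: s) m (12 * size sq + 300 + K) v.
Proof.
move=> bE [[h0 h1 h2 h3] [h4 h5 h6 h8] hs] sall h; set n := size sq in bE h1 *.
pose I i m' := [/\ m' 10 = i /\ i <= n - 32, m' 0 = base /\ m' 2 = 1,
  m' 11 = 32 + (n - 32 - i) /\ m' 12 = base + 32 + (n - 32 - i),
  forall a, base <= a -> m' a = m a &
  forall k, k < n - 32 - i -> m' (32 + k) = m (base + 32 + k)].
eapply (outcome_mono (K := (8 + (12 * (n - 32) + (200 + K).+1).+1))); last by lia.
eapply outcome_block; [by []|eapply outcome_seq].
eapply outcome_mono; [eapply (@outcome_for 10 _ I (n - 32) _ _ (200 + K)) => // | by rewrite /=; lia].
- by move=> i m' [[->]].
- move=> i m' [[m10 ile] [m0 m2] [m11 m12] hi lo].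
  have a32 : m' 11 < base by rewrite m11; lia.
  have hi12 : m' (m' 12) = m (m' 12) by apply: hi; rewrite m12; lia.
  rewrite /run_simple /=.
  set m1 := upd m' 13 _; have m1E j : j != 13 -> m1 j = m' j by rewrite /m1 /upd => /negbTE->.
  have e11 : m1 11 = 32 + (n - 32 - i.+1) by rewrite m1E.
  have e13 : m1 13 = m (base + 32 + (n - 32 - i.+1)) by rewrite /m1 /upd /= hi12 m12.
  set m2' := upd m1 (m1 11) _.
  have m2E j : j != m1 11 -> m2' j = m1 j by rewrite /m2' /upd => /negbTE->.
  have low j : j < 32 -> m2' j = m1 j by move=> j32; apply: m2E; rewrite e11; lia.
  split.
  + by split; rewrite /upd /= ?low ?m1E // ?m10 ?m2 ?subn1 //; lia.
  + by split; rewrite /upd /= low ?m1E.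
  + by split; rewrite /upd /= ?low ?m1E // ?m11 ?m12 ?m2; lia.
  + move=> a ab; do 3 (rewrite upd_other; last by lia).
    rewrite m2E; last by rewrite e11; lia.
    by rewrite m1E ?hi //; lia.
  + move=> k kle; do 3 (rewrite upd_other; last by lia).
    have [kE|kne] := eqVneq k (n - 32 - i.+1).
      by rewrite kE -e11 /m2' /upd eqxx e13.
    rewrite m2E; last by rewrite e11; lia.
    by rewrite m1E ?lo //; lia.
- have low j : j \notin [:: 10; 11; 12; 14] -> run_simple m
    [:: CConst 14 32; CSub 10 1 14; CAdd 11 14 8; CAdd 12 0 14] j = m j.
    rewrite !inE !negb_or => /and4P[a b c d].
    by rewrite /run_simple /= /upd (negbTE a) (negbTE b) (negbTE c) (negbTE d).
  split.
  + by rewrite /run_simple /= /upd /= h1.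
  + by rewrite !low.
  + by rewrite /run_simple /= /upd /= h0 h8 subnn !addn0.
  + by move=> a ab; apply: low; rewrite !inE; lia.
  + by move=> k; rewrite subnn.
move=> m' [_ [m0 m2] _ hi lo].
eapply (outcome_mono (K := ((size out_finish).*2 + K.+1))); last first.
  by rewrite /=; lia.
apply: outcome_block => //; apply: outcome_skip; apply: h => e.
rewrite run_simple_cat.
set m1 := run_simple m' _.
have m1E i : m1 i = if 1 <= i < 1 + 31 then i + m' 0 else m' i by apply: run_address.
have en : index e sq < n by rewrite index_mem.
have m10 : m1 0 = base by rewrite m1E /= m0.
have m1lo d : d < 32 -> m1 d = base + d.
  by case: d => [|d] d32; rewrite ?addn0 // m1E ifT ?m0; lia.
have m1hi d : 32 <= d -> m1 d = m' d by move=> d32; rewrite m1E ifF //; lia.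
rewrite run_fetch; last by move=> d hd; rewrite m1lo; lia.
case: ifP => [/andP[_ e32]|e32].
  rewrite (m1lo (index e sq)) // m1hi; last by lia.
  by rewrite hi ?hs //; lia.
have e32' : 32 <= index e sq by lia.
rewrite m1hi // -{1}(subnKC e32') lo; last by lia.
by rewrite -addnA subnKC // hs.
Qed.

Section Init.
Variable n : nat.
Hypothesis input0 : nth 0 input 0 = n.

Definition ready (m : regs) := [/\ m 0 = n + 32, m 1 = n, m 2 = 1, m 8 = 0 &
  forall i, 32 <= i -> m i = 0].

Lemma ready_same_off l m m' : ready m -> same_off l m m' ->
  all (fun i => (i < 32) && (i \notin [:: 0; 1; 2; 8])) l -> ready m'.
Proof.
move=> [h0 h1 h2 h8 hi] so /allP al.
have nin i : (i \in [:: 0; 1; 2; 8]) || (32 <= i) -> i \notin l.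
  by move=> hi'; apply: contraL hi' => /al; rewrite negb_or -ltnNge andbC.
split; try by rewrite so ?nin.
by move=> i i32; rewrite so ?hi // nin // i32 orbT.
Qed.

Definition prelude := [:: CConst 2 1; CRead 1 8; CConst 0 32; CAdd 0 0 1].

Lemma ready_prelude : ready (run_simple (fun=> 0) prelude).
Proof.
rewrite /run_simple /=; split=> [||||i i32]; rewrite /upd /= ?input0 //; first by rewrite addnC.
by rewrite !ifN //; apply/eqP; lia.
Qed.

Definition search_body := CSeq (CAdd 10 10 2) (CSeq (CQuery 11 2 10) (CSub 12 13 11)).
(** Looks for the least precision [k] at which the name of the tolerance reaches 2: then [delta] is
    at least [2 ^- k], and if [k > 0] the previous answer shows that it is at most [4 * 2 ^- k]. *)
Definition search := foldr CSeq
  (CSeq (CQuery 11 2 10) (CSeq (CSub 12 13 11) (CWhile 12 search_body)))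
  [:: CConst 13 2; CConst 10 0].

Let phi k := nth (fun=> 0) oracles 2 k.

Lemma outcome_search ell m s K v (Q := trunc_log 2 (phi ell)) : ready m ->
  (forall k, k < ell -> phi k < 2) -> 2 <= phi ell ->
  (forall m', ready m' -> m' 10 = ell -> outcome s m' K v) ->
  outcome (search :: s) m ((ell + Q + 10) * ell.+1 + 10 + K) v.
Proof.
move=> rm below above h.
pose I i (x : unit) m' := [/\ ready m', m' 13 = 2, m' 10 = ell - i, m' 12 = 2 - phi (ell - i) &
  i <= ell].
have Qge k : k <= ell -> trunc_log 2 (phi k) <= Q.
  rewrite leq_eqVlt => /predU1P[-> //|kl]; apply: leq_trunc_log.
  by have := below k kl; lia.
pose m1 := run_simple m [:: CConst 13 2; CConst 10 0].
have rm1 : ready m1.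
  by apply: (ready_same_off (l := [:: 10; 13]) rm) => //; do 2 (apply: same_off_upd => //).
have goal1 : outcome [:: CSub 12 13 11, CWhile 12 search_body & s]
    (upd m1 11 (phi 0)) ((ell + Q + 6).+1 * ell + K.+1).+1 v.
  apply: outcome_simple => //.
  eapply (@outcome_while _ _ _ _ _ 12 _ unit I (fun _ _ => v) (ell + Q + 6)) with (x := tt).
  - move=> i x m' [_ _ _ -> il]; case: i il => [|i] il.
      by rewrite subn0 subn_eq0 above.
    by rewrite subn_eq0 leqNgt below //; lia.
  - move=> i x m' [rm' m13 m10 m12 il] s' K' h'.
    have [_ _ m2 _ _] := rm'.
    have kE : m' 10 + m' 2 = ell - i by rewrite m10 m2; lia.
    have step_cost0 : trunc_log 2 (phi (ell - i)) <= Q by apply: Qge; lia.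
    apply: (outcome_mono (K := (2 + ((ell - i + trunc_log 2 (phi (ell - i))).+1 + K'.+2)))); last by lia.
    apply: outcome_seq; apply: outcome_simple => //; rewrite /= kE.
    set m'' := upd _ _ _; have e10 : m'' 10 = ell - i by [].
    apply: (outcome_mono (K := ((m'' 10 + trunc_log 2 (phi (m'' 10))).+1 + K'.+1).+1)); last by rewrite e10; lia.
    apply: outcome_seq; apply: outcome_query; apply: outcome_simple => //; apply: (h' tt); split.
    + apply: (ready_same_off (l := [:: 10; 11; 12]) rm') => //.
      by do 3 (apply: same_off_upd => //).
    + by rewrite /= /upd.
    + by rewrite /= /upd.
    + by rewrite /= /m'' /upd /= m13.
    + by lia.
  - split; rewrite ?subnn //.
    apply: (ready_same_off (l := [:: 11; 12]) rm1) => //.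
    by do 2 (apply: same_off_upd => //).
  - by move=> _ m' [rm' _ m10 _ _]; apply: h => //; rewrite m10 subn0.
have q0 : trunc_log 2 (phi 0) <= Q by apply: Qge.
apply: (outcome_mono (K := (4 + ((m1 10 + trunc_log 2 (phi (m1 10))).+1 + ((ell + Q + 6).+1 * ell + K.+1).+2).+1))).
  apply: outcome_block => //; apply: outcome_seq; apply: outcome_query; apply: outcome_seq; exact: goal1.
have -> : m1 10 = 0 by [].
by lia.
Qed.

Definition mul := foldr CSeq
  (CSeq (CWhile 11 (foldr CSeq CSkip [:: CAdd 10 10 13; CSub 11 11 2])) (CAdd 12 10 8))
  [:: CAdd 11 12 8; CConst 10 0].

Lemma outcome_mul x y m s K v : ready m -> m 12 = x -> m 13 = y ->
  (forall m', ready m' -> m' 12 = x * y -> m' 13 = y -> m' 7 = m 7 -> outcome s m' K v) ->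
  outcome (mul :: s) m (6 * x + 8 + K) v.
Proof.
move=> rm m12 m13 h.
pose I i m' := [/\ ready m', m' 13 = y, m' 11 = i, m' 10 = (x - i) * y & m' 7 = m 7 /\ i <= x].
apply: (outcome_mono (K := 4 + (6 * x + K.+2).+1)); last by lia.
have rm1 : ready (run_simple m [:: CAdd 11 12 8; CConst 10 0]).
  by apply: (ready_same_off (l := [:: 10; 11]) rm) => //; do 2 (apply: same_off_upd => //).
have [_ _ _ m8 _] := rm.
apply: outcome_block => //; apply: outcome_seq; apply: (@outcome_for 11 _ I x) => //.
- by move=> i m' [_ _ ->].
- move=> i m' [rm' m'13 m'11 m'10 [m'7 ix]].
  have [_ _ m'2 _ _] := rm'.
  split; rewrite /run_simple /= /upd /= ?m'13 ?m'11 ?m'10 ?m'2 ?subn1 //.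
  + apply: (ready_same_off (l := [:: 10; 11]) rm') => //.
    by do 2 (apply: same_off_upd => //).
  + by rewrite (_ : x - i = (x - i.+1).+1); [rewrite mulSn addnC|lia].
  + by split; [|lia].
- by split; rewrite ?subnn //= /upd /= m12 m8 addn0.
- move=> m' [rm' m'13 _ m'10 [m'7 _]]; have [_ _ _ m'8 _] := rm'.
  apply: outcome_simple => //; apply: h; rewrite /= /upd /= ?m'10 ?m'8 ?addn0 ?subn0 //.
  by apply: (ready_same_off (l := [:: 12]) rm') => //; apply: same_off_upd.
Qed.

Definition muls k := iter k (CSeq mul) CSkip.

Lemma outcome_muls k x y m s K v : 0 < y -> ready m -> m 12 = x -> m 13 = y ->
  (forall m', ready m' -> m' 12 = x * y ^ k -> m' 7 = m 7 -> outcome s m' K v) ->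
  outcome (muls k :: s) m ((6 * (x * y ^ k) + 10) * k + 1 + K) v.
Proof.
move=> y0; elim: k x m => [|k IH] x m rm m12 m13 h.
  by rewrite muln0; apply: outcome_skip; apply: h; rewrite ?expn0 ?muln1.
have xE : x * y * y ^ k = x * y ^ k.+1 by rewrite expnS mulnA.
have le : x <= x * y ^ k.+1 by rewrite leq_pmulr // expn_gt0 y0.
apply: (outcome_mono (K := (6 * x + 8 + ((6 * (x * y * y ^ k) + 10) * k + 1 + K)).+1)); last first.
  by rewrite xE; lia.
apply: outcome_seq; apply: (outcome_mul (y := y)) => // m' rm' m'12 m'13 m'7.
apply: IH => // m2 rm2 m212 m27; apply: h => //; first by rewrite m212 xE.
by rewrite m27.
Qed.

Variables (a c0 c : nat).

Definition horizon := foldr CSeq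
  (CSeq (muls a) (CSeq (CConst 13 c0) (CSeq mul (CAdd 7 12 8))))
  [:: CAdd 12 10 2; CAdd 13 1 2].

Lemma outcome_horizon ell m s K v (N := ell.+1 * n.+1 ^ a) : ready m -> m 10 = ell ->
  (forall m', ready m' -> m' 7 = N * c0 -> outcome s m' K v) ->
  outcome (horizon :: s) m ((6 * N + 10) * a.+1 + 10 + K) v.
Proof.
move=> rm m10 h.
apply: (outcome_mono (K := 4 + ((6 * N + 10) * a + 1 + (6 * N + 8 + K.+1).+3).+1)); last by lia.
have [_ m1 m2 _ _] := rm.
apply: outcome_block => //; apply: outcome_seq; apply: (@outcome_muls a ell.+1 n.+1) => //.
- by apply: (ready_same_off (l := [:: 12; 13]) rm) => //; do 2 (apply: same_off_upd => //).
- by rewrite /= /upd /= m10 m2 addn1.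
- by rewrite /= /upd /= m1 m2 addn1.
move=> m' rm' m'12 _; apply: outcome_seq; apply: outcome_simple => //; apply: outcome_seq.
apply: (@outcome_mul N c0) => //.
  by apply: (ready_same_off (l := [:: 13]) rm') => //; apply: same_off_upd.
move=> m3 rm3 m312 _ _; have [_ _ _ m38 _] := rm3.
apply: outcome_simple => //; apply: h; last by rewrite /= /upd /= m312 m38 addn0.
by apply: (ready_same_off (l := [:: 7]) rm3) => //; apply: same_off_upd.
Qed.

(** The number [M] of steps also fixes the precision: a coin has [c + M] bits, and the threshold
    [2 ^ M] in register 6 has bias [2 ^- c]. *)
Definition power := foldr CSeq
  (CWhile 11 (foldr CSeq CSkip [:: CAdd 6 6 6; CSub 11 11 2]))
  [:: CConst 3 c; CAdd 3 3 7; CConst 6 1; CAdd 11 7 8].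

Lemma outcome_power M m s K v : ready m -> m 7 = M ->
  (forall m', ready m' -> m' 3 = c + M -> m' 6 = 2 ^ M -> m' 7 = M -> outcome s m' K v) ->
  outcome (power :: s) m (6 * M + 9 + K) v.
Proof.
move=> rm m7 h.
pose I i m' := [/\ ready m', m' 3 = c + M, m' 11 = i, m' 6 = 2 ^ (M - i) & m' 7 = M /\ i <= M].
apply: (outcome_mono (K := 8 + (6 * M + K.+1))); last by lia.
have [_ _ _ m8 _] := rm.
apply: outcome_block => //; apply: (@outcome_for 11 _ I M) => //.
- by move=> i m' [_ _ ->].
- move=> i m' [rm' m'3 m'11 m'6 [m'7 ix]].
  have [_ _ m'2 _ _] := rm'.
  split; rewrite /run_simple /= /upd /= ?m'3 ?m'11 ?m'6 ?m'2 ?subn1 //.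
  + apply: (ready_same_off (l := [:: 6; 11]) rm') => //.
    by do 2 (apply: same_off_upd => //).
  + by rewrite addnn -mul2n -expnS; congr (2 ^ _); lia.
  + by split; [|lia].
- split; rewrite ?subnn //= /upd /= ?m7 ?m8 ?addn0 //.
  apply: (ready_same_off (l := [:: 3; 6; 11]) rm) => //.
  by rewrite /run_simple /=; do 4 (apply: same_off_upd => //).
- by move=> m' [rm' m'3 _ m'6 [m'7 _]]; apply: h => //; rewrite m'6 subn0.
Qed.

(* Registers 16 and 17 hold the doubled remainder before and after subtracting
   the divisor; fetching from [16 + bit] selects one without branching. *)
Definition division := foldr CSeq
  (CWhile 11 (foldr CSeq CSkip [:: CAdd 4 4 4; CAdd 16 14 14; CSub 17 16 13; CSub 15 13 16;
     CSub 15 2 15; CAdd 4 4 15; CConst 18 16; CAdd 18 18 15; CFetch 14 18; CSub 11 11 2]))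
  [:: CAdd 11 7 3; CConst 4 0; CConst 14 1].

Definition table_regs := [:: 4; 11; 14; 15; 16; 17; 18].

Lemma divn_double x b : 0 < b ->
  ((x + x) %/ b = x %/ b + x %/ b + (b <= x %% b + x %% b) /\
  (x + x) %% b = if b <= x %% b + x %% b then x %% b + x %% b - b else x %% b + x %% b).
Proof.
move=> b0; have lt := ltn_pmod x b0.
set q := x %/ b; set r := x %% b; rewrite -/r in lt.
have xE : x = q * b + r by rewrite -divn_eq.
case: leqP => h.
  have -> : x + x = (q + q + 1) * b + (r + r - b) by rewrite xE; lia.
  by rewrite divnMDl // modnMDl divn_small ?modn_small ?addn0 //; lia.
have -> : x + x = (q + q) * b + (r + r) by rewrite xE; lia.
by rewrite divnMDl // modnMDl divn_small ?modn_small //.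
Qed.

(** Long division of a power of two: there are no digits to bring down, so a round doubles quotient
    and remainder and subtracts [b] if possible. With [T = M + (c + M)] and [b] close to
    [2 ^ M * expR beta], the quotient is the threshold of the coin of bias [expR (- beta)]. *)
Lemma outcome_division b m s K v (T := m 7 + m 3) : ready m -> m 13 = b -> 1 < b ->
  (forall m', m' 4 = 2 ^ T %/ b -> same_off table_regs m m' -> outcome s m' K v) ->
  outcome (division :: s) m (22 * T + 7 + K) v.
Proof.
move=> rm m13 b1 h.
pose I i m' := [/\ m' 11 = i, m' 4 = 2 ^ (T - i) %/ b, m' 14 = 2 ^ (T - i) %% b,
  i <= T & same_off table_regs m m'].
apply: (outcome_mono (K := 6 + (22 * T + K.+1))); last by lia.
apply: outcome_block => //; apply: (@outcome_for 11 _ I T) => //.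
- by move=> i m' [->].
- move=> i m' [m11 m4 m14 iT so].
  have rm' : ready m' by apply: (ready_same_off rm so).
  have [_ _ m'2 _ _] := rm'.
  have m'13 : m' 13 = b by rewrite so.
  have pE : 2 ^ (T - i) = 2 ^ (T - i.+1) + 2 ^ (T - i.+1).
    by rewrite addnn -mul2n -expnS; congr (2 ^ _); lia.
  have [dE rE] := divn_double (2 ^ (T - i.+1)) (ltnW b1).
  rewrite -pE in dE rE.
  have tE : 1 - (b - (m' 14 + m' 14)) = (b <= m' 14 + m' 14) :> nat.
    by case: leqP; lia.
  split; last by rewrite /run_simple /=; do 10 (apply: same_off_upd => //).
  + by rewrite /run_simple /= /upd /= m11 m'2 subn1.
  + by rewrite dE -m14 -m4 -tE /run_simple /= /upd /= m'2 m'13.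
  + rewrite rE -m14 /run_simple /= /upd /= m'2 m'13 tE.
    by case: leqP.
  + by lia.
- have ltb : 1 %/ b = 0 /\ 1 %% b = 1 by rewrite divn_small ?modn_small.
  case: ltb => d1 r1.
  split; rewrite ?subnn ?expn0 ?d1 ?r1 //.
  by rewrite /run_simple /=; do 3 (apply: same_off_upd => //).
- by move=> m' [_ m4 _ _ so]; apply: h => //; rewrite m4 subn0.
Qed.

Definition init := foldr CSeq
  (CSeq search (CSeq horizon (CSeq power (CSeq (CQuery 5 1 7) (CSeq (CQuery 13 0 7) division)))))
  prelude.

Definition init_cost ell qlam qb (N := ell.+1 * n.+1 ^ a) :=
  (ell + trunc_log 2 (phi ell) + 10) * ell.+1 + (6 * N + 10) * a.+1 + 60 * (N * c0) + 22 * c +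
  trunc_log 2 qlam + trunc_log 2 qb + 100.

Lemma outcome_init ell s K v (M := ell.+1 * n.+1 ^ a * c0)
  (lam := nth (fun=> 0) oracles 1 M) (b := nth (fun=> 0) oracles 0 M) :
  (forall k, k < ell -> phi k < 2) -> 2 <= phi ell -> 1 < b ->
  (forall m', ready m' -> m' 3 = c + M -> m' 4 = 2 ^ (M + (c + M)) %/ b -> m' 5 = lam ->
     m' 6 = 2 ^ M -> m' 7 = M -> outcome s m' K v) ->
  outcome (init :: s) (fun=> 0) (init_cost ell lam b + K) v.
Proof.
move=> below above b1 h.
set A1 := (ell + trunc_log 2 (phi ell) + 10) * ell.+1.
set N := ell.+1 * n.+1 ^ a; set A2 := (6 * N + 10) * a.+1.
set qa := trunc_log 2 lam; set qb := trunc_log 2 b.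
apply: (outcome_mono (K := 8 + (A1 + 10 + (A2 + 10 + (6 * M + 9 + ((M + qa).+1 +
   ((M + qb).+1 + (22 * (M + (c + M)) + 7 + K)).+1).+1).+1).+1).+1)); last first.
  by rewrite /init_cost -/A1 -/N -/A2 -/qa -/qb -/M; lia.
apply: outcome_block => //; apply: outcome_seq; apply: outcome_search => //; first exact: ready_prelude.
move=> m1 rm1 m110; apply: outcome_seq; apply: (outcome_horizon rm1 m110) => m2 rm2 m27.
apply: outcome_seq; apply: (outcome_power rm2 m27) => m3 rm3 m33 m36 m37.
have rm4 : ready (upd m3 5 lam).
  by apply: (ready_same_off (l := [:: 5]) rm3) => //; apply: same_off_upd.
have rm5 : ready (upd (upd m3 5 lam) 13 b).
  by apply: (ready_same_off (l := [:: 13]) rm4) => //; apply: same_off_upd.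
have e7 : upd m3 5 lam 7 = M by [].
apply: outcome_seq; rewrite -[X in outcome _ _ ((X + _).+1 + _)]m37.
rewrite /qa /lam -[X in nth _ _ _ X]m37.
apply: outcome_query; rewrite m37 -/lam; apply: outcome_seq.
rewrite -[X in outcome _ _ ((X + _).+1 + _)]e7.
rewrite /qb /b -[X in nth _ _ _ X]e7.
apply: outcome_query; rewrite e7 -/b.
rewrite (_ : M + (c + M) = upd (upd m3 5 lam) 13 b 7 + upd (upd m3 5 lam) 13 b 3); last first.
  by rewrite /upd /= m37 m33.
apply: (outcome_division rm5) => // m6 m64 so.
have rm6 : ready m6 by apply: (ready_same_off rm5 so).
apply: h => //; try by rewrite so.
by rewrite m64 /upd /= m37 m33.
Qed.

End Init.

Definition sampler a c0 c := CSeq (init a c0 c) (CSeq chain output).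

Lemma outcome_sampler (G : sgraph) (sq : seq G) a c0 c ell M lam b v (n := size sq) :
  M = ell.+1 * n.+1 ^ a * c0 ->
  lam = nth (fun=> 0) oracles 1 M -> b = nth (fun=> 0) oracles 0 M -> uniq sq -> (forall e : G, e \in sq) -> input = graph_code sq ->
  (forall k, k < ell -> nth (fun=> 0) oracles 2 k < 2) ->
  2 <= nth (fun=> 0) oracles 2 ell -> 1 < b ->
  (forall (sg : {ffun G -> bool}) (m' : regs) t, (forall e, m' (index e sq) = sg e) -> t <= cap ->
     F (Config [::] m' t) = v sg) ->
  outcome [:: sampler a c0 c] (fun=> 0)
    (init_cost n a c0 c ell lam b + (step_cost sq (c + M) + 3) * M + 12 * n + 310)
    (iter M (glauber_step sq (c + M) (2 ^ (M + (c + M)) %/ b) lam (2 ^ M)) v [ffun=> false]).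
Proof.
move=> ME lamE bE us alls inE below above b1 hF.
set q := _ %/ _; set L := c + M.
apply: (outcome_mono (K := (init_cost n a c0 c ell lam b + ((step_cost sq L + 3) * M +
   (12 * n + 300 + 0).+1).+1).+1)); last by lia.
rewrite lamE bE ME; apply: outcome_seq; apply: outcome_init => //; rewrite -?ME -?bE -?lamE //.
  by rewrite inE.
move=> m rm m3 m4 m5 m6 m7; have [m0 m1 m2 m8 hi] := rm.
apply: outcome_seq; apply: (@outcome_chain _ _ _ _ _ _ sq us alls inE (n + 32) L q lam (2 ^ M)) => //.
- by lia.
(* The registers from 32 on are still 0, so the chain starts from the all-zero configuration. *)
- split=> // e; rewrite ffunE hi //; lia.
- move=> sg m' hm; apply: (outcome_output _ hm) => // m'' hs.
  by apply: outcome_nil => t tc; apply: hF.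
Qed.

End Program.

(** * Line graphs and Metropolis dynamics *)

Section Energy.
Variables (E V : finType) (vt : E * bool -> V).
Implicit Types (s : {ffun E -> bool}) (D U : {set E}).
Local Open Scope nat_scope.

Definition energy D s :=
  \sum_v #|half_spin vt D v s true| * #|half_spin vt D v s false|.

Lemma card_half_spin D v s : #|half_spin vt D v s true| + #|half_spin vt D v s false| = deg vt D v.
Proof.
rewrite /deg -(cardID [pred h | s h.1] [set h | half_at vt D v h]); congr (_ + _).
  by apply: eq_card => h; rewrite !inE; case: (s h.1); rewrite ?andbT ?andbF.
by apply: eq_card => h; rewrite !inE; case: (s h.1); rewrite ?andbT ?andbF.
Qed.

Lemma card_half_spinC D v s c :
  #|half_spin vt setT v s c| = #|half_spin vt D v s c| + #|half_spin vt (~: D) v s c|.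
Proof.
rewrite -(cardID [pred h | h.1 \in D] (half_spin vt setT v s c)); congr (_ + _).
  apply: eq_card => h; rewrite !inE /half_at !inE andbT.
  by case: (vt h == v); case: (s h.1 == c); case: (h.1 \in D).
apply: eq_card => h; rewrite !inE /half_at !inE andbT.
by case: (vt h == v); case: (s h.1 == c); case: (h.1 \in D).
Qed.

Lemma half_spin_flip D v s c : half_spin vt D v (flip s D) c = half_spin vt D v s (~~ c).
Proof.
apply/setP => h; rewrite !inE /half_at ffunE.
by case: (h.1 \in D); rewrite ?andbF //; case: (s h.1); case: c.
Qed.

Lemma half_spin_flip_out D U v s c : [disjoint U & D] ->
  half_spin vt D v (flip s U) c = half_spin vt D v s c.
Proof.
move=> /pred0P dUD; apply/setP => h; rewrite !inE /half_at ffunE.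
by have := dUD h.1; rewrite /=; case: (h.1 \in D); rewrite ?andbF // andbT => ->; rewrite addbF.
Qed.

(** With counts [x], [y] inside [D] and [x'], [y'] outside, [(x + x') * (y + y') + (y + x') * (x +
    y') = 2 * x * y + 2 * x' * y' + (x + y) * (x' + y')]: the mixed terms involve degrees only. *)
Lemma energy_flip_sum D s : energy setT s + energy setT (flip s D) =
  2 * energy D s + 2 * energy (~: D) s + \sum_v deg vt D v * deg vt (~: D) v.
Proof.
have dD : [disjoint D & ~: D] by rewrite disjoints_subset setCK.
rewrite /energy !big_distrr /= -!big_split /=; apply: eq_bigr => v _.
rewrite !(card_half_spinC D) !half_spin_flip !(half_spin_flip_out _ _ _ dD) /=.
rewrite -!(card_half_spin _ _ s); ring.
Qed.

Lemma energy_flip_in D s U : U \subset D ->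
  energy setT (flip s U) + energy setT (flip (flip s U) D) + 2 * energy D s =
  energy setT s + energy setT (flip s D) + 2 * energy D (flip s U).
Proof.
move=> UD; have dU : [disjoint U & ~: D] by rewrite disjoints_subset setCK.
rewrite !energy_flip_sum (_ : energy (~: D) (flip s U) = energy (~: D) s); first by ring.
by apply: eq_bigr => v _; rewrite !(half_spin_flip_out _ _ _ dU).
Qed.

Definition ones s := \sum_e (s e : nat).

Lemma ones_flip_in D s U : U \subset D ->
  ones (flip s U) + ones (flip (flip s U) D) = ones s + ones (flip s D).
Proof.
move=> /subsetP UD; rewrite -!big_split /=; apply: eq_bigr => e _; rewrite !ffunE.
case eU: (e \in U); last by rewrite addbF.
by rewrite (UD _ eU); case: (s e).
Qed.

End Energy.

Section Cut.
Variable G : sgraph.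
Implicit Types (s : {ffun G -> bool}) (e f : G).
Local Open Scope nat_scope.

Definition cut_pair s e f : nat := [&& adj e f, s e & ~~ s f].
Definition cut_size s := \sum_e \sum_f cut_pair s e f.

Lemma cut_split s e : cut_size s =
  \sum_(i | i != e) \sum_(j | j != e) cut_pair s i j + \sum_f (adj e f && (s f != s e)).
Proof.
rewrite /cut_size (bigD1 e) //=.
have -> : \sum_(i | i != e) \sum_f cut_pair s i f =
    \sum_(i | i != e) \sum_(j | j != e) cut_pair s i j + \sum_(i | i != e) cut_pair s i e.
  by rewrite -big_split /=; apply: eq_bigr => i _; rewrite (bigD1 e) //= addnC.
rewrite addnC -addnA; congr (_ + _).
rewrite [X in _ + X](bigD1 e) //= [RHS](bigD1 e) //= /cut_pair adj_irrefl /= !add0n -big_split /=.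
apply: eq_bigr => f _; rewrite [adj f e]adj_sym.
by case: (adj e f); case: (s e); case: (s f).
Qed.

Lemma cut_flip s e (sq : seq G) : uniq sq -> (forall f, f \in sq) ->
  cut_size (flip s [set e]) + disagree s e sq = cut_size s + agree s e sq.
Proof.
move=> us alls.
have cE (P : pred G) : count P sq = \sum_f P f.
  rewrite -sum1_count big_mkcond /= [RHS](perm_big sq) /=.
    by apply: eq_bigr => f _; case: (P f).
  by apply: uniq_perm => [||f]; rewrite ?index_enum_uniq ?mem_index_enum ?alls.
rewrite /disagree /agree !cE !(cut_split _ e) -!addnA.
congr (_ + _).
  apply: eq_bigr => i ie; apply: eq_bigr => j je.
  by rewrite /cut_pair !ffunE !inE (negbTE ie) (negbTE je) !addbF.
rewrite addnC; congr (_ + _); apply: eq_bigr => f _.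
rewrite !ffunE !inE eqxx; have [->|fe] := eqVneq f e; first by rewrite adj_irrefl.
by rewrite addbF addbT; case: (s f); case: (s e).
Qed.

(** Of the two ordered pairs of an edge, exactly one is counted by [cut_size] if the spins differ
    and none if they agree. *)
Lemma cut_oriented (R : realFieldType) s :
  (\sum_(ij : G * G | adj ij.1 ij.2 && (enum_rank ij.1 < enum_rank ij.2)%N)
    `|(s ij.1)%:R - (s ij.2)%:R| = (cut_size s)%:R :> R)%R.
Proof.
have -> : cut_size s = \sum_(ij : G * G) cut_pair s ij.1 ij.2 by rewrite /cut_size pair_bigA.
have swapK : involutive (fun ij : G * G => (ij.2, ij.1)) by case.
have -> : \sum_(ij : G * G) cut_pair s ij.1 ij.2 =
    \sum_(ij : G * G | enum_rank ij.1 < enum_rank ij.2)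
       (cut_pair s ij.1 ij.2 + cut_pair s ij.2 ij.1).
  rewrite (bigID (fun ij : G * G => enum_rank ij.1 < enum_rank ij.2)) /= big_split /=.
  congr (_ + _); rewrite (reindex_inj (inv_inj swapK)) /=.
  rewrite big_mkcond [RHS]big_mkcond /=; apply: eq_bigr => -[i j] _ /=.
  have [->|ij] := eqVneq i j; first by rewrite ltnn /= /cut_pair adj_irrefl.
  rewrite -leqNgt leq_eqVlt; case: eqP => // /val_inj/enum_rank_inj e.
  by rewrite e eqxx in ij.
rewrite natr_sum big_mkcondl /=.
apply: eq_bigr => -[i j] _ /=; rewrite /cut_pair [adj j i]adj_sym.
case: (adj i j) => //=; case: (s i); case: (s j) => /=;
  rewrite ?subrr ?subr0 ?sub0r ?normrN ?normr0 ?normr1 //.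
Qed.

Lemma cut_le s : cut_size s <= #|G| * #|G|.
Proof.
apply: (@leq_trans (\sum_(e : G) \sum_(f : G) 1)); last first.
  by rewrite !big_const !iter_addn_0 mul1n.
by apply: leq_sum => e _; apply: leq_sum => f _; apply: leq_b1.
Qed.

End Cut.

Section LineGraphCut.
Variable G : sgraph.
Local Open Scope nat_scope.
Local Notation E := (line_graph G).

Lemma line_ends : exists vt : E * bool -> G,
  forall e : E, vt (e, false) != vt (e, true) /\ sval e = [set vt (e, false); vt (e, true)].
Proof.
have ex (e : E) : exists p : G * G, p.1 != p.2 /\ sval e = [set p.1; p.2].
  case: e => e /=; rewrite inE => /existsP[x /existsP[y /andP[xy /eqP ->]]].
  by exists (x, y); split=> //=; apply: contraTneq xy => ->; rewrite adj_irrefl.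
have [p pP] := fin_all_exists ex.
by exists (fun h => if h.2 then (p h.1).2 else (p h.1).1) => e; apply: pP.
Qed.

Variable vt : E * bool -> G.
Hypothesis vtP : forall e : E,
  vt (e, false) != vt (e, true) /\ sval e = [set vt (e, false); vt (e, true)].

(** In a simple graph distinct edges have at most one common end, for two would determine the
    edge. *)
Lemma common_ends (e f : E) : e != f ->
  \sum_b \sum_c (vt (e, b) == vt (f, c) : nat) = adj e f.
Proof.
move=> ef; rewrite [adj e f](_ : _ = (sval e :&: sval f != set0)); last first.
  by rewrite /adj /= /line_adj ef.
have [en eE] := vtP e; have [fn fE] := vtP f.
rewrite !big_bool /=.
have ne : ~~ ((vt (e, false) == vt (f, false)) && (vt (e, true) == vt (f, true))) /\
   ~~ ((vt (e, false) == vt (f, true)) && (vt (e, true) == vt (f, false))).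
  split; apply: contraNN ef => /andP[/eqP e1 /eqP e2]; apply/eqP/val_inj.
    by rewrite /= eE fE e1 e2.
  by rewrite /= eE fE e1 e2 setUC.
rewrite eE fE.
move: en fn ne; set a := vt (e, false); set a' := vt (e, true);
  set b := vt (f, false); set b' := vt (f, true) => en fn [n1 n2].
have memE : ([set a; a'] :&: [set b; b'] != set0) =
   [|| a == b, a == b', a' == b | a' == b'].
  apply/set0Pn/idP => [[x]|].
    by rewrite !inE => /andP[/orP[] /eqP-> /orP[] /eqP->]; rewrite eqxx ?orbT.
  by case/or4P => /eqP h; [exists a|exists a|exists a'|exists a'];
    rewrite !inE h eqxx ?orbT.
rewrite memE.
have x1 : ~~ ((a == b) && (a == b')).
  by apply: contraNN fn => /andP[/eqP <- /eqP <-].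
have x2 : ~~ ((a' == b) && (a' == b')).
  by apply: contraNN fn => /andP[/eqP <- /eqP <-].
have x3 : ~~ ((a == b) && (a' == b)).
  by apply: contraNN en => /andP[/eqP -> /eqP ->].
have x4 : ~~ ((a == b') && (a' == b')).
  by apply: contraNN en => /andP[/eqP -> /eqP ->].
move: n1 n2 x1 x2 x3 x4; move: (a == b) (a == b') (a' == b) (a' == b').
by case; case; case; case.
Qed.

(** Here the line graph structure enters: its cut edges are grouped by the vertex of [Gamma] that
    the two edges share, so the cut splits into products of counts at the vertices. *)
Lemma energy_cut (s : {ffun E -> bool}) : energy vt setT s = cut_size s.
Proof.
transitivity (\sum_(h : E * bool) \sum_(h' : E * bool)
   ((vt h == vt h') * (s h.1 && ~~ s h'.1))).
  rewrite /energy.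
  have cE v c : #|half_spin vt setT v s c| = \sum_h ((vt h == v) && (s h.1 == c)).
    rewrite -sum1_card big_mkcond /=; apply: eq_bigr => h _.
    by rewrite !inE /half_at inE andbT; case: (_ && _).
  under eq_bigr => v _ do rewrite !cE big_distrl /=.
  rewrite exchange_big /=; apply: eq_bigr => h _.
  rewrite (bigD1 (vt h)) //= [X in _ + X]big1 ?addn0; last first.
    by move=> v vh; rewrite eq_sym (negbTE vh).
  rewrite eqxx /= big_distrr /=; apply: eq_bigr => h' _.
  by rewrite [vt h' == _]eq_sym; case: (vt h == vt h'); case: (s h.1); case: (s h'.1).
transitivity (\sum_(e : E) \sum_b \sum_(f : E) \sum_c
   ((vt (e, b) == vt (f, c)) * (s e && ~~ s f))).
  rewrite [RHS]pair_bigA /=; apply: eq_bigr => -[e b] _.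
  by rewrite [RHS]pair_bigA /=; apply: eq_bigr => -[f c] _.
apply: eq_bigr => e _.
rewrite exchange_big /=; apply: eq_bigr => f _.
under eq_bigr => b _ do rewrite -big_distrl /=.
rewrite -big_distrl /=.
have [ef|ef] := eqVneq e f; first by rewrite ef /cut_pair andbN muln0 andbF.
by rewrite common_ends // /cut_pair mulnb.
Qed.

End LineGraphCut.

Section Metropolis.
Variables (R : realFieldType) (E : finType) (r : nat).
Hypothesis r_large : (#|E| <= 2 ^ r)%N.
Local Notation S := {ffun E -> bool}.
Implicit Types (acc : S -> E -> R) (v : S -> R) (x y : S).

(** Only [#|E|] of the [2 ^ r] draws stand for sites; the others end up in the idle term. *)
Definition metropolis acc x y : R :=
  \sum_e acc x e / 2 ^+ r * (y == flip x [set e])%:R +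
  (1 - \sum_e acc x e / 2 ^+ r) * (y == x)%:R.

Lemma flip_neq x e : (flip x [set e] == x) = false.
Proof. by apply/negbTE/eqP => /ffunP/(_ e); rewrite ffunE inE eqxx; case: (x e). Qed.

Lemma sum_eqr v x : \sum_y (y == x)%:R * v y = v x.
Proof.
rewrite (bigD1 x) //= eqxx mul1r big1 ?addr0 // => y /negbTE->.
by rewrite mul0r.
Qed.

Lemma metropolis_apply acc v x : \sum_y metropolis acc x y * v y =
  \sum_e acc x e / 2 ^+ r * v (flip x [set e]) + (1 - \sum_e acc x e / 2 ^+ r) * v x.
Proof.
rewrite /metropolis; under eq_bigr do rewrite mulrDl.
rewrite big_split /=; congr (_ + _).
  under eq_bigr do rewrite mulr_suml.
  rewrite exchange_big /=; apply: eq_bigr => e _.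
  by under eq_bigr do rewrite -mulrA; rewrite -mulr_sumr sum_eqr.
by under eq_bigr do rewrite -mulrA; rewrite -mulr_sumr sum_eqr.
Qed.

Lemma pow2_gt0 : 0 < 2 ^+ r :> R. Proof. exact: exprn_gt0. Qed.

Lemma site_average (g : E -> R) (a : R) : (forall e, g e <= a) -> 0 <= a ->
  \sum_e g e / 2 ^+ r <= a.
Proof.
move=> ga a0; rewrite -mulr_suml ler_pdivrMr ?pow2_gt0 //.
apply: le_trans (ler_sum _ (fun e _ => ga e)) _.
rewrite sumr_const -(mulr_natr a) ler_wpM2l // -natrX ler_nat; exact: r_large.
Qed.

Lemma metropolis_stochastic acc : (forall x e, 0 <= acc x e <= 1) ->
  stochastic (metropolis acc).
Proof.
move=> acc01; split=> [x y|x].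
  rewrite addr_ge0 ?mulr_ge0 //; last first.
    by rewrite subr_ge0 site_average // => e; case/andP: (acc01 x e).
  apply: sumr_ge0 => e _; rewrite mulr_ge0 // divr_ge0 ?(ltW pow2_gt0) //.
  by case/andP: (acc01 x e).
have := metropolis_apply acc (fun=> 1) x.
under eq_bigr do rewrite mulr1; move=> ->; rewrite mulr1.
by under eq_bigr do rewrite mulr1; rewrite addrC subrK.
Qed.

Lemma metropolis_lazy acc x : (forall e, acc x e <= 2^-1) -> 2^-1 <= metropolis acc x x.
Proof.
move=> ah; rewrite /metropolis eqxx mulr1 big1 ?add0r; last first.
  by move=> e _; rewrite eq_sym flip_neq mulr0.
have : \sum_e acc x e / 2 ^+ r <= 2^-1 by apply: site_average; rewrite ?invr_ge0.
by lra.
Qed.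

Lemma metropolis_rev acc (mu : S -> R) :
  (forall x e, mu x * acc x e = mu (flip x [set e]) * acc (flip x [set e]) e) ->
  forall x y, mu x * metropolis acc x y = mu y * metropolis acc y x.
Proof.
move=> rev x y; rewrite /metropolis !mulrDr; congr (_ + _); last first.
  by rewrite [x == y]eq_sym; case: eqVneq => [->|_]; rewrite // !mulr0.
rewrite !mulr_sumr; apply: eq_bigr => e _.
have -> : (x == flip y [set e]) = (y == flip x [set e]).
  by apply/eqP/eqP => ->; rewrite flipK.
case: eqVneq => [->|_]; last by rewrite !mulr0.
by rewrite !mulr1 !mulrA rev.
Qed.

Lemma metropolis_form acc (mu f : S -> R) :
  \sum_x \sum_y mu x * metropolis acc x y * (f x - f y) ^+ 2 =
  \sum_x \sum_e mu x * acc x e / 2 ^+ r * (f x - f (flip x [set e])) ^+ 2.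
Proof.
apply: eq_bigr => x _.
under eq_bigr do rewrite -mulrA; rewrite -mulr_sumr.
rewrite (metropolis_apply acc (fun y => (f x - f y) ^+ 2)) subrr expr0n mulr0 addr0.
by rewrite mulr_sumr; apply: eq_bigr => e _; rewrite !mulrA.
Qed.

Lemma metropolis_perturb acc acc' (eps : R) x : 0 <= eps ->
  (forall e, `|acc x e - acc' x e| <= eps) ->
  \sum_y `|metropolis acc x y - metropolis acc' x y| <= 2 * eps.
Proof.
move=> eps0 close.
pose g e := `|acc x e - acc' x e| / 2 ^+ r.
have gs : \sum_e g e <= eps by apply: site_average.
apply: le_trans (_ : \sum_y (\sum_e g e * (y == flip x [set e])%:R +
    \sum_e g e * (y == x)%:R) <= _).
  apply: ler_sum => y _.
  rewrite (_ : _ - _ = \sum_e (acc x e - acc' x e) / 2 ^+ r * (y == flip x [set e])%:R -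
      \sum_e (acc x e - acc' x e) / 2 ^+ r * (y == x)%:R); last first.
    rewrite /metropolis -[X in _ = _ - X]mulr_suml.
    under [X in _ = X - _]eq_bigr do rewrite mulrBl mulrBl.
    under [X in _ = _ - X * _]eq_bigr do rewrite mulrBl.
    by rewrite !sumrB; ring.
  apply: le_trans (ler_normB _ _) _.
  have nE (b : bool) (z : R) : `|z / 2 ^+ r * b%:R| = `|z| / 2 ^+ r * b%:R.
    by rewrite !normrM normfV (ger0_norm (ltW pow2_gt0)) normr_nat.
  apply: lerD; apply: le_trans (ler_norm_sum _ _ _) _; apply: ler_sum => e _;
    by rewrite nE.
rewrite big_split /= exchange_big /= [X in _ + X]exchange_big /=.
have sE e (z : {ffun E -> bool}) : \sum_y g e * (y == z)%:R = g e.
  by rewrite -[RHS](sum_eqr (fun=> g e) z); apply: eq_bigr => y _; exact: mulrC.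
under eq_bigr do rewrite sE; under [X in _ + X]eq_bigr do rewrite sE.
by rewrite mulr_natl mulr2n lerD.
Qed.

End Metropolis.

Section GlauberKernel.
Variables (R : realFieldType) (G : sgraph) (sq : seq G).
Hypothesis sq_uniq : uniq sq.
Hypothesis sq_all : forall e : G, e \in sq.
Variables (L q lam pw : nat).
Let n := size sq.
Let r := up_log 2 n.
Let acc := accept_prob R sq L q lam pw.

Lemma size_sq : n = #|G|.
Proof.
rewrite /n cardE; apply: perm_size; apply: uniq_perm => // [|e].
  exact: enum_uniq.
by rewrite sq_all mem_enum.
Qed.

Lemma up_log_large : (#|G| <= 2 ^ r)%N.
Proof. by rewrite -size_sq /r up_logP. Qed.

Lemma glauber_stepE v x :
  glauber_step sq L q lam pw v x = \sum_y metropolis r acc x y * v y.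
Proof.
rewrite metropolis_apply /glauber_step -/n -/r -/acc.
rewrite big_split /= mulrDl mulrDl -addrA; congr (_ + _).
  by rewrite mulr_suml; apply: eq_bigr => e _; rewrite mulrAC.
have p0 : 2 ^+ r != 0 :> R by rewrite expf_neq0 // pnatr_eq0.
rewrite -!mulr_suml sumrB sumr_const -/(1 *+ #|G|) natrB; last by rewrite size_sq up_log_large.
rewrite natrX size_sq; field.
by [].
Qed.

Lemma iter_glauber N v x : iter N (glauber_step sq L q lam pw) v x =
  \sum_y kpow (metropolis r acc) N x y * v y.
Proof.
elim: N x => [|N IH] x /=.
  by under eq_bigr do rewrite eq_sym; rewrite sum_eqr.
rewrite glauber_stepE (eq_bigr _ (fun y _ => congr1 ( *%R _) (IH y))).
under eq_bigr do rewrite mulr_sumr.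
rewrite exchange_big /=; apply: eq_bigr => y _.
by rewrite mulr_suml; apply: eq_bigr => z _; rewrite mulrA.
Qed.

End GlauberKernel.

From mathcomp Require Import all_classical all_reals all_analysis.
Import Order.TTheory GRing.Theory Num.Theory.
Local Open Scope ring_scope.

(** * Weights of partial matchings *)

Section DividedDifferences.
Variable R : realType.
Implicit Types (d j k : nat) (t x a : R).

(** The mean value theorem with an integrating factor. It yields both comparison for [y' >= a y] and
    uniqueness for [y' = a y]. *)
Lemma mvt_exp (y dy : R -> R) a t : (forall x, is_derive x 1 y (dy x)) -> 0 < t ->
  exists2 c, 0 < c < t & expR (- (a * t)) * y t - y 0 = expR (- (a * c)) * (dy c - a * y c) * t.
Proof.
move=> dyP t0.
pose z x := expR (- (a * x)) * y x.
have zP x : is_derive x 1 z (expR (- (a * x)) * (dy x - a * y x)).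
  have d1 : is_derive x 1 (fun u => - (a * u)) (- a).
    have := @is_deriveZ R R R id (- a) x 1 1 _.
    rewrite (_ : - a \*: id = (fun u => - (a * u))); last first.
      by apply/funext => u; rewrite /= scaleNr.
    by rewrite scaler1; apply.
  have d2 := @is_derive1_comp R expR (fun u => - (a * u)) x _ _ (is_derive_expR _) d1.
  have := @is_deriveM R R _ _ x 1 _ _ d2 (dyP x).
  rewrite (_ : _ * _ = z) //; congr (is_derive _ _ _ _).
  by rewrite /GRing.scale /=; ring.
have [|c cI zE] := @MVT R z _ 0 t t0 (fun x _ => zP x).
  by apply: derivable_within_continuous => x _; case: (zP x).
exists c; first by move: cI; rewrite in_itv.
by move: zE; rewrite /z mulr0 oppr0 expR0 mul1r addr0.
Qed.

Lemma gronwall_ge0 (y dy : R -> R) a t : (forall x, is_derive x 1 y (dy x)) ->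
  0 <= y 0 -> (forall x, 0 < x -> a * y x <= dy x) -> 0 < t -> 0 <= y t.
Proof.
move=> dyP y0 ge t0; have [c /andP[c0 _] e] := mvt_exp a dyP t0.
rewrite -(pmulr_rge0 _ (expR_gt0 (- (a * t)))).
rewrite -[leRHS](subrK (y 0)) e addr_ge0 // !mulr_ge0 ?expR_ge0 ?(ltW t0) //.
by rewrite subr_ge0 ge.
Qed.

Lemma gronwall_gt0 (y dy : R -> R) a t : (forall x, is_derive x 1 y (dy x)) ->
  0 <= y 0 -> (forall x, 0 < x -> a * y x < dy x) -> 0 < t -> 0 < y t.
Proof.
move=> dyP y0 gt t0; have [c /andP[c0 _] e] := mvt_exp a dyP t0.
rewrite -(pmulr_rgt0 _ (expR_gt0 (- (a * t)))).
rewrite -[ltRHS](subrK (y 0)) e ltr_pwDl // !mulr_gt0 ?expR_gt0 //.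
by rewrite subr_gt0 gt.
Qed.

Definition node d j : R := j%:R * (d%:R - j%:R).

(** The last coefficient is the one that makes the combination of exponentials vanish at [t = 0]. *)
Fixpoint dd_coef d j k : R :=
  if j is j'.+1 then
    if (k <= j')%N then dd_coef d j' k / (node d k - node d j'.+1)
    else if k == j'.+1 then
      - \sum_(i < j'.+1) dd_coef d j' i / (node d i - node d j'.+1)
    else 0
  else (k == 0)%:R.

(* The divided difference of [x |-> expR (x * t)] at [node d 0, ..., node d j]. *)
Definition dd d j t : R := \sum_(k < j.+1) dd_coef d j k * expR (node d k * t).

Definition dd_pred d j t : R := if j is j'.+1 then dd d j' t else 0.

Lemma nodeB d j k : node d j - node d k = (j%:R - k%:R) * (d%:R - j%:R - k%:R).
Proof. by rewrite /node; ring. Qed.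

Lemma node_neq d j k : (k <= j)%N -> (j.+1.*2 <= d)%N -> node d k - node d j.+1 != 0.
Proof.
move=> kj jd; rewrite nodeB; apply: mulf_neq0.
  by rewrite lt_eqF // subr_lt0 ltr_nat.
by rewrite gt_eqF // -addrA -opprD -natrD subr_gt0 ltr_nat; lia.
Qed.

Lemma dd0 d t : dd d 0 t = 1.
Proof. by rewrite /dd big_ord1 /= /node mul0r mul0r expR0 mulr1. Qed.

Lemma dd_at0 d j : dd d j.+1 0 = 0.
Proof.
rewrite /dd; under eq_bigr => k _ do rewrite mulr0 expR0 mulr1.
rewrite big_ord_recr /= ltnn eqxx; apply/eqP; rewrite subr_eq0; apply/eqP.
by apply: eq_bigr => k _; rewrite -ltnS ltn_ord.
Qed.

Lemma is_derive_expM (c l x : R) : is_derive x 1 (fun t => c * expR (l * t)) (c * (l * expR (l * x))).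
Proof.
have d1 : is_derive x 1 (fun u => l * u) l.
  have := @is_deriveZ R R R id l x 1 1 _.
  rewrite (_ : l \*: id = (fun u => l * u)); last by apply/funext.
  by rewrite scaler1; apply.
have d2 := @is_derive1_comp R expR (fun u => l * u) x _ _ (is_derive_expR _) d1.
have := @is_deriveZ R R R _ c x 1 _ d2.
rewrite (_ : c \*: _ = (fun t => c * expR (l * t))); last by apply/funext.
by rewrite /GRing.scale /= [expR _ * l]mulrC.
Qed.

(** Together with the values at 0 this triangular system of linear equations determines the
    functions; positivity, curvature and growth are all read off from it by comparison. *)
Lemma is_derive_dd d j x : (j.*2 <= d)%N ->
  is_derive x 1 (dd d j) (node d j * dd d j x + dd_pred d j x).
Proof.
move=> jd.
have -> : node d j * dd d j x + dd_pred d j x =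
    \sum_(k < j.+1) dd_coef d j k * (node d k * expR (node d k * x)).
  case: j jd => [|j] jd; first by rewrite dd0 /= big_ord1 /node !mul0r mulr0 addr0.
  rewrite /dd_pred {1}/dd mulr_sumr; apply/eqP.
  rewrite eq_sym addrC -subr_eq -sumrB big_ord_recr /= [X in _ + X == _](_ : _ = 0); last by ring.
  rewrite addr0; apply/eqP/eq_bigr => k _.
  rewrite (_ : (k <= j)%N) /=; last by rewrite -ltnS ltn_ord.
  by field; apply: node_neq => //; rewrite -ltnS ltn_ord.
have -> : dd d j = \sum_(k < j.+1) (fun t => dd_coef d j k * expR (node d k * t)).
  by apply/funext => t; rewrite fct_sumE.
apply: is_derive_sum => k; exact: is_derive_expM.
Qed.

Lemma dd_gt0 d j t : (j.*2 <= d)%N -> 0 < t -> 0 < dd d j t.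
Proof.
elim: j t => [|j IH] t jd t0; first by rewrite dd0.
apply: (gronwall_gt0 (a := node d j.+1) (fun x => @is_derive_dd d j.+1 x jd)) => //.
  by rewrite dd_at0.
by move=> x x0; rewrite ltrDl /=; apply: IH => //; lia.
Qed.

Lemma dd_pred_ge0 d j t : (j.*2 <= d)%N -> 0 < t -> 0 <= dd_pred d j t.
Proof. by case: j => //= j jd t0; rewrite ltW // dd_gt0 //; lia. Qed.

Lemma nodeD d j : node d j.+2 + node d j = node d j.+1 *+ 2 - 2.
Proof. by rewrite /node -!natr1; ring. Qed.

(** The right side minus the left solves [y' = 2 * node d j.+1 * y] plus nonnegative terms. The
    nodes have second difference -2, which the factor [expR (2 * t)] makes up for; the leading 2
    dominates the cross term in the derivative of the square. *)
Lemma dd_curvature d j t : (j.+2.*2 <= d)%N -> 0 < t ->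
  dd d j.+1 t ^+ 2 <= 2 * expR (2 * t) * dd d j t * dd d j.+2 t.
Proof.
move=> jd t0; rewrite -subr_ge0.
have D2 x := @is_derive_dd d j.+2 x jd.
have D1 x : is_derive x 1 (dd d j.+1) _ := @is_derive_dd d j.+1 x ltac:(lia).
have D0 x : is_derive x 1 (dd d j) _ := @is_derive_dd d j x ltac:(lia).
pose y x := 2 * expR (2 * x) * dd d j x * dd d j.+2 x - dd d j.+1 x ^+ 2.
pose dy x := node d j.+1 *+ 2 * y x + (2 * (expR (2 * x) - 1) * dd d j.+1 x * dd d j x
   + 2 * expR (2 * x) * dd d j.+2 x * dd_pred d j x).
have dyP x : is_derive x 1 y (dy x).
  have e1 := @is_deriveM R R _ _ x 1 _ _ (is_derive_expM 2 2 x) (D0 x).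
  have e2 := @is_deriveM R R _ _ x 1 _ _ e1 (D2 x).
  have e3 := @is_deriveM R R _ _ x 1 _ _ (D1 x) (D1 x).
  have := @is_deriveB R R R _ _ x 1 _ _ e2 e3.
  rewrite (_ : _ - _ = y); last by apply/funext.
  congr (is_derive _ _ _ _); rewrite /GRing.scale /= ?mulrfctE /dy /y.
  have -> : node d j.+2 = node d j.+1 *+ 2 - 2 - node d j by rewrite -nodeD; ring.
  by ring.
rewrite -/(y t); apply: (gronwall_ge0 (a := node d j.+1 *+ 2) dyP) => //.
  by rewrite /y dd_at0 dd_at0 mulr0 expr0n subr0.
move=> x x0; rewrite /dy lerDl addr_ge0 // ?mulr_ge0 ?expR_ge0 ?ler0n //.
- by rewrite subr_ge0 -expR0 ler_expR mulr_ge0 // ltW.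
- by rewrite ltW // dd_gt0 //; lia.
- by rewrite ltW // dd_gt0 //; lia.
- by rewrite ltW // dd_gt0.
- by rewrite dd_pred_ge0 //; lia.
Qed.

(** Comparison at rate [node d j.+1]; the exponent is the difference of the nodes [j.+1] and [j],
    and the factor [t] integrates the source term [dd d j]. *)
Lemma dd_next_le d j t : (j.+1.*2 <= d)%N -> 0 < t ->
  dd d j.+1 t <= t * expR ((d - j.*2.+1)%:R * t) * dd d j t.
Proof.
move=> jd t0; set m := (d - _)%:R; rewrite -subr_ge0.
have mE : m = node d j.+1 - node d j.
  rewrite /m natrB; last by lia.
  have -> : (j.*2.+1)%:R = j%:R * 2 + 1 :> R by rewrite -addn1 natrD -muln2 natrM.
  by rewrite /node -natr1; ring.
have D1 x := @is_derive_dd d j.+1 x jd.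
have D0 x : is_derive x 1 (dd d j) _ := @is_derive_dd d j x ltac:(lia).
pose y x := x * expR (m * x) * dd d j x - dd d j.+1 x.
pose dy x := node d j.+1 * y x + ((expR (m * x) - 1) * dd d j x + x * expR (m * x) * dd_pred d j x).
have dyP x : is_derive x 1 y (dy x).
  have e0 := @is_deriveM R R _ _ x 1 _ _ (is_derive_id x 1) (is_derive_expM 1 m x).
  have e1 := @is_deriveM R R _ _ x 1 _ _ e0 (D0 x).
  have := @is_deriveB R R R _ _ x 1 _ _ e1 (D1 x).
  rewrite (_ : _ - _ = y); last by apply/funext => u; rewrite /y /= -[in RHS](mul1r (expR _)).
  congr (is_derive _ _ _ _); rewrite /GRing.scale /= ?mulrfctE /dy /y.
  have -> : node d j.+1 = m + node d j by rewrite mE; ring.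
  by ring.
rewrite -/(y t); apply: (gronwall_ge0 (a := node d j.+1) dyP) => //.
  by rewrite /y dd_at0 mul0r mul0r subr0.
move=> x x0; rewrite /dy lerDl addr_ge0 // ?mulr_ge0 ?expR_ge0 ?(ltW x0) //.
- by rewrite subr_ge0 -expR0 ler_expR mulr_ge0 // ltW.
- by rewrite ltW // dd_gt0 //; lia.
- by rewrite dd_pred_ge0 //; lia.
Qed.

End DividedDifferences.

Section MatchingSum.
Variable R : realType.

Lemma is_derive_big (I : Type) (r : seq I) (P : pred I) (f : I -> R -> R) (df : I -> R) (x : R) :
  (forall i, P i -> is_derive x 1 (f i) (df i)) ->
  is_derive x 1 (fun t => \sum_(i <- r | P i) f i t) (\sum_(i <- r | P i) df i).
Proof.
move=> fP; elim: r => [|i r IH].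
  rewrite big_nil (_ : (fun _ => _) = cst 0); first exact: is_derive_cst.
  by apply/funext => t; rewrite big_nil.
rewrite big_cons (_ : (fun _ => _) =
    (if P i then f i \+ (fun t => \sum_(i <- r | P i) f i t) else (fun t => \sum_(i <- r | P i) f i t))).
  by case: ifP => // Pi; apply: is_deriveD; apply: fP.
by apply/funext => t; rewrite big_cons; case: ifP.
Qed.

Variables (E V : finType) (vt : E * bool -> V) (D : {set E}) (v : V) (s : {ffun E -> bool}).
Local Notation d := (deg vt D v).

Lemma pairs_le (M : {ffun E * bool -> E * bool}) : opp_matching vt D v s M ->
  ((#|moved M|)./2.*2 <= d)%N.
Proof.
move=> oM; apply: (@leq_trans #|moved M|); first by rewrite -[leqRHS]odd_double_half leq_addl.
apply: subset_leq_card; apply/fintype.subsetP => h; rewrite !inE.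
by case/andP: oM => /forallP/(_ h)/andP[_ /implyP lM] _.
Qed.

(* As functions of [t], both sides solve [z' = x y z] with [z 0 = 1], where
   [x] and [y] are the numbers of half-edges of either spin. *)
Lemma matching_sum (t : R) : 0 < t ->
  \sum_(M | local_matching vt D v M && opposite s M)
     (#|moved M|)./2`!%:R * dd d (#|moved M|)./2 t =
  expR ((#|half_spin vt D v s true| * #|half_spin vt D v s false|)%:R * t).
Proof.
move=> t0; set x := #|half_spin _ _ _ _ true|; set y := #|half_spin _ _ _ _ false|.
pose j (M : {ffun E * bool -> E * bool}) := (#|moved M|)./2.
pose Y u : R := \sum_(M | opp_matching vt D v s M) (j M)`!%:R * dd d (j M) u.
pose dY u : R := \sum_(M | opp_matching vt D v s M)
   (j M)`!%:R * (node R d (j M) * dd d (j M) u + dd_pred d (j M) u).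
have dYP (u : R) : is_derive u 1 Y (dY u).
  apply: is_derive_big => M oM.
  exact: is_deriveZ (is_derive_dd _ (pairs_le oM)).
have dE : d%:R = x%:R + y%:R :> R by rewrite -natrD /x /y card_half_spin.
have dYE (u : R) : dY u = (x * y)%:R * Y u.
  rewrite /dY; under eq_bigr do rewrite mulrDr.
  rewrite big_split /=.
  have -> : \sum_(M | opp_matching vt D v s M) (j M)`!%:R * dd_pred d (j M) u =
    \sum_(M | opp_matching vt D v s M) (j M)%:R * ((j M).-1`!%:R * dd d (j M).-1 u).
    apply: eq_bigr => M _; case: (j M) => [|k] /=; first by rewrite mulr0 mul0r.
    by rewrite factS natrM mulrA.
  (* The nodes are made for the identity [node d j + (x - j) * (y - j) = x * y], valid for
     [d = x + y]: after the double counting all terms have the same rate. *)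
  rewrite (pair_count vt D v s (fun k => k`!%:R * dd d k u)) -big_split /= mulr_sumr.
  apply: eq_bigr => M _; rewrite -/x -/y -/(j M) natrM /node dE; ring.
have Y0 : Y 0 = 1.
  rewrite /Y (bigD1 [ffun h => h]) /=; last first.
    apply/andP; split; apply/forallP => h; rewrite !ffunE eqxx //=.
  have -> : j [ffun h => h] = 0%N.
    rewrite /j (_ : moved _ = finset.set0) ?cards0 //.
    by apply/finset.setP => h; rewrite !inE ffunE eqxx.
  rewrite fact0 dd0 mulr1 big1 ?addr0 // => M /andP[oM Mn].
  have : j M != 0%N.
    apply: contra Mn => /eqP j0; apply/eqP/ffunP => h; rewrite ffunE.
    have : moved M = finset.set0.
      apply/eqP; rewrite -cards_eq0 (card_moved oM).
      by rewrite (card_moved_spin true oM) -/(j M) j0.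
    by move/finset.setP/(_ h); rewrite !inE => /negbFE/eqP.
  by case: (j M) => // k _; rewrite dd_at0 mulr0.
have [c _] := mvt_exp (x * y)%:R dYP t0.
rewrite dYE subrr mulr0 mul0r Y0 => /eqP; rewrite subr_eq0 => /eqP e.
transitivity (Y t); first by [].
have := congr1 ( *%R (expR ((x * y)%:R * t))) e.
by rewrite mulrA -expRD subrr expR0 mul1r mulr1.
Qed.

End MatchingSum.

Lemma few_free_bounds d j h : (d <= h)%N -> (j.+1.*2 <= d)%N -> (d <= j.*2 + 22)%N ->
  [/\ (j <= h)%N, (d - j.*2.+1 <= 21)%N & (j.*2 <= d)%N].
Proof. by move=> ? ? ?; split; lia. Qed.

(** * Poincare inequality for the Ising weight *)

Section IsingPoincare.
Variables (R : realType) (beta nu : R).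
Hypothesis beta_gt0 : 0 < beta.
Let t := 2 * beta.
Let t_gt0 : 0 < t. Proof. by rewrite mulr_gt0. Qed.
Let kap := 2 * expR (2 * t).
(** The 8 serves [theta_small]; 21 is the largest value of [d - j.*2.+1] in the range
    [d <= j.*2 + 22] of [w_few]. *)
Let bnd := 8 + t * expR (21 * t).

(** [2 ^+ 24] is 8 times [2 ^+ 21]: the number of half-edges plus one is at most [2 * #|E|.+1] and
    occurs to the power 21, namely 12 + 1 from [poincare_const] and 8 from [theta ^- 2]. *)
Definition ising_const : R := 2 ^+ 24 * kap ^+ 3 * bnd ^+ 2.

Lemma ising_const_ge1 : 1 <= ising_const.
Proof.
have e1 : 1 <= expR (2 * t) by rewrite -expR0 ler_expR mulr_ge0 // ltW.
have k1 : 1 <= kap by rewrite /kap; lra.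
have b1 : 1 <= bnd.
  have : 0 <= t * expR (21 * t) by rewrite mulr_ge0 ?expR_ge0 // ltW.
  by rewrite /bnd; lra.
rewrite /ising_const.
apply: le_trans (_ : 1 * 1 * 1 <= _); first by rewrite !mulr1.
by rewrite !ler_pM ?exprn_ege1 // ler1n.
Qed.

Variables (E V : finType) (vt : E * bool -> V).
Implicit Types s : {ffun E -> bool}.

Definition ham s : R := beta * (energy vt finset.setT s)%:R + nu * (ones s)%:R.

Variable Z : R.
Hypothesis Z_gt0 : 0 < Z.
Let mu s := expR (ham s) / Z.
Hypothesis mu_sum : \sum_s mu s = 1.

Lemma ising_poincare (f : {ffun E -> bool} -> R) (m := \sum_s mu s * f s) :
  \sum_s mu s * (f s - m) ^+ 2 <= ising_const * #|E|.+1%:R ^+ 21 *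
  \sum_x \sum_e Num.min (mu x) (mu (flip x [set e])) * (f x - f (flip x [set e])) ^+ 2.
Proof.
pose H := (E * bool)%type.
pose h : R := #|{: H}|%:R.
have h0 : 0 <= h by rewrite ler0n.
have te0 : 0 <= t * expR (21 * t) by rewrite mulr_ge0 ?expR_ge0 // ltW.
have bnd8 : 8 <= bnd by rewrite /bnd lerDl.
have bnd0 : 0 < bnd by apply: lt_le_trans bnd8; rewrite ltr0n.
have h1 : 1 <= (h + 1) ^+ 4 by rewrite exprn_ege1 // lerDr.
have h14 : 0 < (h + 1) ^+ 4 by apply: lt_le_trans h1.
pose theta := (bnd * (h + 1) ^+ 4)^-1.
have th0 : 0 < theta by rewrite invr_gt0 mulr_gt0.
have thP (x : R) : 0 <= x -> x <= bnd * (h + 1) ^+ 4 -> x * theta <= 1.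
  by move=> x0 le; rewrite ler_pdivrMr ?mul1r // mulr_gt0.
pose w d j := j`!%:R * dd d j t.
have fact_gt0R k : 0 < k`!%:R :> R by rewrite ltr0n fact_gt0.
have w0 d j : (j.*2 <= d)%N -> 0 < w d j by move=> jd; rewrite mulr_gt0 // dd_gt0.
have kap1 : 1 <= kap.
  have : 1 <= expR (2 * t) by rewrite -expR0 ler_expR mulr_ge0 // ltW.
  by rewrite /kap; lra.
have mu0 s : 0 < mu s by rewrite divr_gt0 ?expR_gt0.
have main := @poincare R E V vt w kap theta w0 _ _ th0 _ kap1 _ mu
  (fun D s v => expR ((#|half_spin vt D v s true| * #|half_spin vt D v s false|)%:R * t))
  mu0 mu_sum (fun D s v => expR_gt0 _) (fun D s v => matching_sum vt D v s t_gt0) _ f.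
have S0 : 0 <= \sum_x \sum_e Num.min (mu x) (mu (flip x [set e])) * (f x - f (flip x [set e])) ^+ 2.
  apply: sumr_ge0 => x _; apply: sumr_ge0 => e _; rewrite mulr_ge0 ?sqr_ge0 //.
  by rewrite le_min !ltW.
apply: le_trans (main _ _ _ _ _) _ => {main}.
- move=> d j jd; rewrite /w exprMn.
  have cv := dd_curvature jd t_gt0; rewrite -/kap in cv.
  have d0 : 0 < dd d j t.
    by apply: dd_gt0 => //; apply: leq_trans jd; rewrite leq_double -addn2 leq_addr.
  have d2 : 0 < dd d j.+2 t by apply: dd_gt0.
  have fle : j.+1`!%:R ^+ 2 <= j`!%:R * j.+2`!%:R :> R.
    rewrite -natrX -natrM ler_nat expnS expn1 [j.+2`!]factS {1}factS.
    by rewrite -mulnA mulnCA leq_mul // leq_mul2r leqnSn orbT.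
  apply: le_trans (ler_pM _ _ fle cv) _; rewrite ?sqr_ge0 //.
  by rewrite le_eqVlt; apply/orP; left; apply/eqP; ring.
- move=> d j dh jd d22; rewrite /w.
  have nx := dd_next_le jd t_gt0.
  have [jle dle jd'] := few_free_bounds dh jd d22.
  have d0 : 0 < dd d j t by apply: dd_gt0.
  have ex : expR ((d - j.*2.+1)%:R * t) <= expR (21 * t).
    by rewrite ler_expR ler_wpM2r ?(ltW t_gt0) // ler_nat.
  have nx' : dd d j.+1 t <= t * expR (21 * t) * dd d j t.
    apply: le_trans nx _; apply: ler_wpM2r; first exact: ltW.
    by apply: ler_wpM2l ex; apply: ltW.
  have jh : j.+1%:R <= (h + 1) ^+ 4.
    have j1 : j.+1%:R <= h + 1 by rewrite -natr1 lerD2r ler_nat.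
    apply: le_trans j1 _; rewrite -{1}[h + 1]expr1; apply: ler_weXn2l => //.
    by rewrite lerDr.
  have th1 : j.+1%:R * (t * expR (21 * t)) * theta <= 1.
    apply: thP; first by rewrite mulr_ge0.
    by rewrite mulrC ler_pM // /bnd lerDr.
  rewrite factS natrM.
  apply: le_trans (_ : theta * (j.+1%:R * j`!%:R * (t * expR (21 * t) * dd d j t)) <= _).
    by rewrite ler_pM2l // ler_pM2l // mulr_gt0 // ltr0n.
  rewrite (_ : theta * _ = (j.+1%:R * (t * expR (21 * t)) * theta) * (j`!%:R * dd d j t)); last by ring.
  by rewrite ler_piMl // ltW // mulr_gt0.
- by rewrite -[theta]mul1r; apply: thP => //; rewrite -[1]mulr1 ler_pM //; lra.
- apply: thP; first by rewrite mulr_ge0 // exprn_ge0.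
  by apply: ler_pM => //; rewrite ?exprn_ge0 // lerXn2r ?nnegrE ?addr_ge0 // lerDl.
- move=> D s U UD.
  (* For the replica pair the field contributes a constant under flips inside [D], and
     [t = 2 * beta] absorbs the factor 2 of the energy identity. *)
  have ee := energy_flip_in vt s UD; have oo := ones_flip_in s UD.
  have prodE s' : \prod_v expR ((#|half_spin vt D v s' true| * #|half_spin vt D v s' false|)%:R * t) =
     expR ((energy vt D s')%:R * t).
    by rewrite -expR_sum -mulr_suml -natr_sum.
  rewrite !prodE /mass /mu.
  have hE : ham (flip s U) + ham (flip (flip s U) D) + (energy vt D s)%:R * t =
     ham s + ham (flip s D) + (energy vt D (flip s U))%:R * t.
    move/(congr1 (fun k => k%:R : R)): oo; rewrite !natrD => oo.
    have eeR : (energy vt finset.setT (flip s U))%:R + (energy vt finset.setT (flip (flip s U) D))%:R +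
       2 * (energy vt D s)%:R = (energy vt finset.setT s)%:R + (energy vt finset.setT (flip s D))%:R +
       2 * (energy vt D (flip s U))%:R :> R by rewrite -!natrM -!natrD ee.
    rewrite /ham /t; move: {ee} eeR oo.
    set a1 := (energy _ _ (flip s U))%:R; set a2 := (energy _ _ (flip (flip s U) D))%:R.
    set a3 := (energy _ D s)%:R; set a4 := (energy _ finset.setT s)%:R.
    set a5 := (energy _ _ (flip s D))%:R; set a6 := (energy _ D (flip s U))%:R.
    move=> ee oo.
    rewrite [LHS](_ : _ = beta * (a1 + a2 + 2 * a3) + nu * ((ones (flip s U))%:R + (ones (flip (flip s U) D))%:R)); last by ring.
    by rewrite ee oo; ring.
  move: hE; move: (ham (flip s U)) (ham (flip (flip s U) D)) (ham s) (ham (flip s D)) => x1 x2 x3 x4.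
  move/(congr1 expR); rewrite !expRD => xE.
  rewrite [LHS](_ : _ = expR x1 * expR x2 * expR ((energy vt D s)%:R * t) / Z / Z); last by ring.
  by rewrite xE; ring.
apply: ler_wpM2r; first exact: S0.
rewrite /poincare_const -/H -/h /ising_const.
have hn : h + 1 <= 2 * #|E|.+1%:R.
  by rewrite /h card_prod card_bool natrM -natr1; lra.
have hp : (h + 1) ^+ 21 <= 2 ^+ 21 * #|E|.+1%:R ^+ 21.
  by rewrite -exprMn lerXn2r // ?nnegrE ?addr_ge0 // mulr_ge0.
have k3 : 0 <= kap ^+ 3 by rewrite exprn_ge0 // (le_trans _ kap1).
have thE : theta ^- 2 = bnd ^+ 2 * (h + 1) ^+ 8 by rewrite /theta exprVn invrK exprMn -exprM.
rewrite thE.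
apply: le_trans (_ : (h + 1) ^+ 12 * (8 * (h + 1)) * (kap ^+ 3 * (bnd ^+ 2 * (h + 1) ^+ 8)) <= _).
  apply: ler_wpM2r.
    by rewrite mulr_ge0 // mulr_ge0 ?sqr_ge0 // exprn_ge0 // addr_ge0.
  apply: ler_pM; rewrite ?exprn_ge0 ?addr_ge0 ?mulr_ge0 //; last by lra.
  by rewrite lerXn2r // ?nnegrE ?addr_ge0 // lerDl.
rewrite [leLHS](_ : _ = 8 * kap ^+ 3 * bnd ^+ 2 * (h + 1) ^+ 21); last by ring.
rewrite [leRHS](_ : _ = 8 * kap ^+ 3 * bnd ^+ 2 * (2 ^+ 21 * #|E|.+1%:R ^+ 21)); last by ring.
by apply: ler_wpM2l hp; apply: mulr_ge0; [exact: mulr_ge0|exact: sqr_ge0].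
Qed.

End IsingPoincare.

(** * Mixing of the exact chain *)

Lemma gap_collect (F : realFieldType) (i n k S p : F) :
  0 <= i -> 0 <= n -> 0 <= k -> 0 <= S -> p <= 2 * n ->
  i * n ^+ 21 * (k * p * S) <= 2 * i * k * n ^+ 22 * S.
Proof.
move=> i0 n0 k0 S0 pn.
have -> : i * n ^+ 21 * (k * p * S) = (i * n ^+ 21 * k * S) * p by ring.
have -> : 2 * i * k * n ^+ 22 * S = (i * n ^+ 21 * k * S) * (2 * n) by ring.
by apply: ler_wpM2l pn; rewrite !mulr_ge0 // exprn_ge0.
Qed.

Lemma mulr_div_out (F : fieldType) (k w z a : F) : k * (w / z * a) = k * (w * a) / z.
Proof. by ring. Qed.

Lemma mulr_divK_mid (F : fieldType) (k p a b : F) :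
  p != 0 -> k * p * (a / p * b) = k * a * b.
Proof. by move=> p0; field. Qed.

Section DetailedBalance.
Variables (R : realType) (beta nu : R) (G : sgraph) (sq : seq G) (c : nat).
Hypothesis sq_uniq : uniq sq.
Hypothesis sq_all : forall e : G, e \in sq.
Implicit Types (s : {ffun G -> bool}) (e f : G).

Lemma weightE s : weight beta nu s = expR (beta * (cut_size s)%:R + nu * (ones s)%:R).
Proof.
rewrite /weight -!expR_sum -expRD -!mulr_sumr cut_oriented.
by rewrite /ones natr_sum.
Qed.

Lemma weight_gt0 s : 0 < weight beta nu s.
Proof. by rewrite weightE expR_gt0. Qed.

Lemma partition_gt0 : 0 < partition_function beta nu G.
Proof.
rewrite /partition_function (bigD1 [ffun=> false]) //= ltr_pwDl ?weight_gt0 //.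
by apply: sumr_ge0 => s _; rewrite ltW ?weight_gt0.
Qed.

Lemma gibbs_gt0 s : 0 < gibbs beta nu s.
Proof. by rewrite divr_gt0 ?weight_gt0 ?partition_gt0. Qed.

Lemma gibbs_sum : \sum_(s : {ffun G -> bool}) gibbs beta nu s = 1.
Proof. by rewrite -mulr_suml divff // gt_eqF ?partition_gt0. Qed.

Lemma ones_flip s e : (ones (flip s [set e]) + s e = ones s + ~~ s e)%N.
Proof.
rewrite /ones (bigD1 e) //= [in RHS](bigD1 e) //= ffunE inE eqxx addbT.
rewrite -addnA addnC -addnA addnC [RHS]addnAC; congr (_ + _)%N.
by apply: eq_bigr => f fe; rewrite ffunE inE (negbTE fe) addbF.
Qed.

Lemma agree_flip s e :
  agree (flip s [set e]) e sq = disagree s e sq /\ disagree (flip s [set e]) e sq = agree s e sq.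
Proof.
have fE f : adj e f -> flip s [set e] f = s f.
  move=> ef; rewrite ffunE inE (_ : (f == e) = false) ?addbF //.
  by apply/negP => /eqP fe; rewrite fe adj_irrefl in ef.
have eE : flip s [set e] e = ~~ s e by rewrite ffunE inE eqxx addbT.
split; apply: eq_count => f /=; case ef: (adj e f) => //=;
  by rewrite fE // eE; case: (s f); case: (s e).
Qed.

(** The field is handled by the rates 1 and [expR nu] instead of a second truncation, so both signs
    of [nu] are treated alike; the division by [2 ^+ c] brings the rates below one half, for
    laziness. *)
Definition exact_acc s e : R :=
  expR (- beta) ^+ (disagree s e sq - agree s e sq) * ((if s e then 1 else expR nu) / 2 ^+ c).

Let tr s e : R := (disagree s e sq - agree s e sq)%N%:R.

Lemma exact_accE s e :
  exact_acc s e = expR (- (beta * tr s e) + nu * (~~ s e)%:R) / 2 ^+ c.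
Proof.
rewrite /exact_acc mulrA -expRM_natl expRD mulrN [beta * _]mulrC; congr (_ * _ / _).
by case: (s e); rewrite /= ?mulr0 ?mulr1 ?expR0.
Qed.

Lemma exact_balance s e : weight beta nu s * exact_acc s e =
  weight beta nu (flip s [set e]) * exact_acc (flip s [set e]) e.
Proof.
rewrite !weightE !exact_accE !mulrA -!expRD; congr (expR _ / _).
have h1 := cut_flip s e sq_uniq sq_all.
have [aE dE] := agree_flip s e.
have h2 := ones_flip s e.
have h3 : (cut_size s)%:R + tr (flip s [set e]) e = (cut_size (flip s [set e]))%:R + tr s e :> R.
  by rewrite /tr aE dE -!natrD; congr (_%:R); lia.
have h4 : (ones (flip s [set e]))%:R + (s e)%:R = (ones s)%:R + (~~ s e)%:R :> R.
  by rewrite -!natrD h2.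
have -> : ~~ flip s [set e] e = s e by rewrite ffunE inE eqxx addbT negbK.
have -> : (cut_size s)%:R = (cut_size (flip s [set e]))%:R + tr s e - tr (flip s [set e]) e :> R.
  by rewrite -h3 addrK.
have -> : (ones s)%:R = (ones (flip s [set e]))%:R + (s e)%:R - (~~ s e)%:R :> R.
  by rewrite h4 addrK.
by ring.
Qed.

Lemma exact_acc_ge0 s e : 0 <= exact_acc s e.
Proof. by rewrite exact_accE divr_ge0 ?expR_ge0. Qed.

(** The interaction part is exactly the Metropolis minimum; [1 + expR (- nu)] covers what the
    asymmetric field rates lose, for either sign of [nu]. *)
Lemma min_weight_le s e :
  Num.min (weight beta nu s) (weight beta nu (flip s [set e])) <=
  2 ^+ c * (1 + expR (- nu)) * (weight beta nu s * exact_acc s e).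
Proof.
have p0 : 2 ^+ c != 0 :> R by rewrite expf_neq0.
have -> : 2 ^+ c * (1 + expR (- nu)) * (weight beta nu s * exact_acc s e) =
   (1 + expR (- nu)) * (weight beta nu s * (expR (- (beta * tr s e)) * expR (nu * (~~ s e)%:R))).
  by rewrite exact_accE expRD; field.
have e0 := expR_gt0 (- nu); have en := expR_gt0 nu.
have ee : expR (- nu) * expR nu = 1 by rewrite -expRD addrC subrr expR0.
have w0 := weight_gt0 s.
have h1 := cut_flip s e sq_uniq sq_all.
have h2 := ones_flip s e.
case: (leqP (disagree s e sq) (agree s e sq)) => h.
  have -> : tr s e = 0 by rewrite /tr; move: h; rewrite -subn_eq0 => /eqP->.
  apply: le_trans (_ : weight beta nu s <= _); first by rewrite ge_min lexx.
  rewrite mulr0 oppr0 expR0 mul1r; case: (s e); rewrite /= ?mulr0 ?expR0 ?mulr1; first by nra.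
  rewrite mulrCA ler_peMr ?(ltW w0) // mulrDl mul1r ee; lra.
apply: le_trans (_ : weight beta nu (flip s [set e]) <= _); first by rewrite ge_min lexx orbT.
have wE : weight beta nu (flip s [set e]) =
    weight beta nu s * (expR (- (beta * tr s e)) * expR (nu * ((~~ s e)%:R - (s e)%:R))).
  rewrite !weightE -!expRD; congr expR.
  have -> : (cut_size (flip s [set e]))%:R = (cut_size s)%:R - tr s e :> R.
    apply/eqP; rewrite eq_sym subr_eq -natrD eqr_nat; apply/eqP; lia.
  have -> : (ones (flip s [set e]))%:R = (ones s)%:R + (~~ s e)%:R - (s e)%:R :> R.
    by apply/eqP; rewrite eq_sym subr_eq -!natrD h2.
  by ring.
have wt0 : 0 < weight beta nu s * expR (- (beta * tr s e)) by rewrite mulr_gt0 ?expR_gt0.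
have yy : expR (nu * ((~~ s e)%:R - (s e)%:R)) <= (1 + expR (- nu)) * expR (nu * (~~ s e)%:R).
  case: (s e); rewrite /= ?sub0r ?subr0 ?mulr0 ?expR0 ?mulr1 ?mulrN1.
    by rewrite lerDr.
  by rewrite mulrDl mul1r ee lerDl.
rewrite wE mulrA [leRHS](_ : _ = weight beta nu s * expR (- (beta * tr s e)) *
   ((1 + expR (- nu)) * expR (nu * (~~ s e)%:R))); last by ring.
by rewrite ler_pM2l.
Qed.

Lemma exact_acc_half s e : 0 < beta -> 2 * (1 + expR nu) <= 2 ^+ c -> exact_acc s e <= 2^-1.
Proof.
move=> b0 c_large; rewrite /exact_acc.
have a1 : expR (- beta) ^+ (disagree s e sq - agree s e sq) <= 1.
  by rewrite exprn_ile1 ?expR_ge0 // -expR0 ler_expR oppr_le0 ltW.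
have en := expR_gt0 nu.
have p0 : 0 < 2 ^+ c :> R by rewrite exprn_gt0.
apply: le_trans (_ : 1 * ((1 + expR nu) / 2 ^+ c) <= _).
  apply: ler_pM => //; rewrite ?exprn_ge0 ?expR_ge0 // ?divr_ge0 ?(ltW p0) //.
    by case: (s e) => //; rewrite expR_ge0.
  by rewrite ler_pM2r ?invr_gt0 //; case: (s e); lra.
by rewrite mul1r ler_pdivrMr //; lra.
Qed.

(** The all-zero configuration has weight 1, so this bounds the inverse of its probability, the
    price of starting there. *)
Lemma partition_le : 0 < beta ->
  partition_function beta nu G <= expR ((beta + `|nu| + 1) * #|G|.+1%:R ^+ 2).
Proof.
move=> b0; have nn := normr_ge0 nu.
pose n : R := #|G|%:R; have n0 : 0 <= n by rewrite ler0n.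
apply: le_trans (_ : \sum_(s : {ffun G -> bool}) expR (beta * n ^+ 2 + `|nu| * n) <= _).
  apply: ler_sum => s _; rewrite weightE ler_expR; apply: lerD.
    by rewrite ler_pM2l // -natrX ler_nat -mulnn cut_le.
  have o : (ones s)%:R <= n.
    by rewrite ler_nat -sum1_card; apply: leq_sum => e _; apply: leq_b1.
  apply: le_trans (_ : `|nu| * (ones s)%:R <= _); last exact: ler_wpM2l.
  by rewrite ler_wpM2r // ler_norm.
rewrite sumr_const card_ffun card_bool -[_ *+ (2 ^ _)%N]mulr_natl natrX.
have -> : 2 ^+ #|G| = expR (ln 2 * n) :> R by rewrite expRM_natr lnK // posrE.
rewrite -expRD ler_expR -natr1 -/n.
have l2 : ln 2 <= 1 :> R.
  have := @le_ln1Dx R 1; rewrite (_ : 1 + 1 = 2 :> R); last by ring.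
  by apply; lra.
have : ln 2 * n <= n by rewrite ler_piMl.
have h1 : beta * n ^+ 2 <= beta * (n + 1) ^+ 2 by rewrite ler_pM2l //; nra.
have h2 : `|nu| * n <= `|nu| * (n + 1) ^+ 2 by apply: ler_wpM2l => //; nra.
have h3 : n <= (n + 1) ^+ 2 by nra.
by rewrite !mulrDl mul1r; lra.
Qed.

End DetailedBalance.

Section LineGraphMixing.
Variables (R : realType) (beta nu : R) (Gamma : sgraph) (c : nat).
Local Notation G := (line_graph Gamma).
Variable sq : seq G.
Hypothesis beta_gt0 : 0 < beta.
Hypothesis sq_uniq : uniq sq.
Hypothesis sq_all : forall e : G, e \in sq.
Hypothesis c_large : 2 * (1 + expR nu) <= 2 ^+ c.
Let mu := @gibbs R beta nu G.
Let n1 : R := #|G|.+1%:R.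
Let r := up_log 2 (size sq).
Let P := metropolis r (exact_acc beta nu sq c).

Definition gap_const : R := 2 * ising_const beta * (2 ^+ c * (1 + expR (- nu))).

Lemma gap_const_ge1 : 1 <= gap_const.
Proof.
have i1 := ising_const_ge1 beta_gt0; have en := expR_gt0 (- nu).
have p1 : 1 <= 2 ^+ c :> R by rewrite exprn_ege1 // ler1n.
have : 1 <= 2 ^+ c * (1 + expR (- nu)) by nra.
by rewrite /gap_const; nra.
Qed.

Lemma pow_up_log_le : 2 ^+ r <= 2 * n1.
Proof.
have -> : n1 = (size sq).+1%:R by rewrite /n1 (size_sq sq_uniq sq_all).
rewrite -natrX -natrM ler_nat /r; case: (size sq) => [|[|k]] //.
have := up_log_gtn (isT : (1 < 2)%N) (isT : (1 < k.+2)%N).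
set l := up_log _ _; have l0 : (0 < l)%N by rewrite up_log_gt0.
by rewrite -[in (2 ^ l)%N](prednK l0) expnS; lia.
Qed.

Lemma exact_acc01 s e : 0 <= exact_acc beta nu sq c s e <= 1.
Proof.
rewrite exact_acc_ge0 /= (le_trans (exact_acc_half _ _ _ beta_gt0 c_large)) //.
by rewrite invf_le1 // ler1n.
Qed.

Lemma exact_stochastic : stochastic P.
Proof.
apply: metropolis_stochastic; first exact: up_log_large.
exact: exact_acc01.
Qed.

(** The power 22 is the 21 of the Poincare inequality and one more for the choice of the site, as
    [2 ^+ r <= 2 * n1]. *)
Lemma exact_gap (f : {ffun G -> bool} -> R) : \sum_x mu x * f x = 0 ->
  \sum_x mu x * f x ^+ 2 <= gap_const * n1 ^+ 22 *
    \sum_x \sum_y mu x * P x y * (f x - f y) ^+ 2.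
Proof.
move=> f0; have [vt vtP] := line_ends Gamma.
have Z0 := partition_gt0 beta nu G.
have muE s : mu s = expR (ham beta nu vt s) / partition_function beta nu G.
  by rewrite /mu /gibbs weightE /ham (energy_cut vtP).
have mu_sum : \sum_s expR (ham beta nu vt s) / partition_function beta nu G = 1.
  by rewrite -(gibbs_sum beta nu G); apply: eq_bigr => s _; rewrite -muE.
have main : \sum_x mu x * f x ^+ 2 <= ising_const beta * n1 ^+ 21 *
    \sum_x \sum_e Num.min (mu x) (mu (flip x [set e])) * (f x - f (flip x [set e])) ^+ 2.
  have muF : mu = (fun s => expR (ham beta nu vt s) / partition_function beta nu G).
    by apply/funext => s.
  move: f0; rewrite muF => f0; have := ising_poincare beta_gt0 Z0 mu_sum f.
  by rewrite /= f0; under eq_bigr do rewrite subr0.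
apply: le_trans main _.
rewrite metropolis_form.
have i1 := ising_const_ge1 beta_gt0.
have i0 : 0 <= ising_const beta by apply: le_trans i1.
have n11 : 1 <= n1 by rewrite ler1n.
have n21 : 0 <= n1 ^+ 21 by rewrite exprn_ge0 // ler0n.
have rr := pow_up_log_le.
have p0 : 0 < 2 ^+ r :> R by rewrite exprn_gt0.
pose kk := 2 ^+ c * (1 + expR (- nu)).
have kk0 : 0 < kk by rewrite mulr_gt0 ?exprn_gt0 // addr_gt0 ?expR_gt0.
pose S := \sum_x \sum_e mu x * exact_acc beta nu sq c x e / 2 ^+ r * (f x - f (flip x [set e])) ^+ 2.
have S0 : 0 <= S.
  apply: sumr_ge0 => x _; apply: sumr_ge0 => e _.
  rewrite mulr_ge0 ?sqr_ge0 // divr_ge0 ?(ltW p0) // mulr_ge0 ?exact_acc_ge0 //.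
  by rewrite ltW // gibbs_gt0.
rewrite -/S.
apply: le_trans (_ : ising_const beta * n1 ^+ 21 * (kk * 2 ^+ r * S) <= _).
  apply: ler_wpM2l; first by rewrite mulr_ge0.
  rewrite /S mulr_sumr; apply: ler_sum => x _; rewrite mulr_sumr; apply: ler_sum => e _.
  rewrite mulr_divK_mid ?gt_eqF //.
  rewrite ler_wpM2r ?sqr_ge0 //.
  have mw := min_weight_le beta nu c sq_uniq sq_all x e.
  rewrite /mu /gibbs -minr_pMl ?invr_ge0 ?(ltW Z0) // mulr_div_out.
  by apply: ler_wpM2r mw; rewrite invr_ge0 ltW.
by rewrite /gap_const -/kk; apply: gap_collect => //; exact: ltW.
Qed.

Lemma exact_mixing N (K := 2 * (gap_const * n1 ^+ 22)) :
  (\sum_y `|kpow P N [ffun=> false] y - mu y|) ^+ 2 <=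
  expR ((beta + `|nu| + 1) * n1 ^+ 2 - N%:R / K).
Proof.
have n11 : 1 <= n1 by rewrite ler1n.
have K1 : 1 <= gap_const * n1 ^+ 22.
  by rewrite -[1]mulr1 ler_pM // ?gap_const_ge1 // exprn_ege1.
have K0 : 0 < K by rewrite mulr_gt0 // (lt_le_trans ltr01).
have rv : forall x y, mu x * P x y = mu y * P y x.
  apply: metropolis_rev => x e; rewrite /mu /gibbs mulrAC exact_balance //.
  by rewrite mulrAC.
have lz x : 2^-1 <= P x x.
  by apply: metropolis_lazy; [exact: up_log_large|move=> e; apply: exact_acc_half].
apply: le_trans (mixing exact_stochastic (gibbs_gt0 beta nu (G := G)) (gibbs_sum beta nu G)
  rv lz K1 exact_gap N [ffun=> false]) _; rewrite -/K.
have -> : (mu [ffun=> false])^-1 = partition_function beta nu G.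
  have o0 : ones ([ffun=> false] : {ffun G -> bool}) = 0%N.
    by rewrite /ones big1 // => e _; rewrite ffunE.
  have c0 : cut_size ([ffun=> false] : {ffun G -> bool}) = 0%N.
    by rewrite /cut_size big1 // => e _; rewrite big1 // => f _; rewrite /cut_pair !ffunE andbF.
  by rewrite /mu /gibbs weightE c0 o0 !mulr0 addr0 expR0 mul1r invrK.
rewrite [X in expR X]addrC expRD; apply: ler_pM; rewrite ?exprn_ge0 ?(ltW (partition_gt0 _ _ _)) ?partition_le //.
  by rewrite subr_ge0 invf_le1 // /K; lra.
rewrite -mulrN expRM_natl lerXn2r // ?nnegrE ?expR_ge0 //.
  by rewrite subr_ge0 invf_le1 // /K; lra.
exact: expR_ge1Dx.
Qed.

End LineGraphMixing.

(** * Precision and running time *)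

Section Coins.
Variables (R : realType) (beta nu : R) (phi_beta phi_nu : nat -> nat) (M c : nat).
Hypothesis beta_gt0 : 0 < beta.
Hypothesis betaP : dyadic_name phi_beta (expR beta).
Hypothesis nuP : dyadic_name phi_nu (expR nu).
Hypothesis c_nu : 2 * (1 + expR nu) <= 2 ^+ c.
Let L := (c + M)%N.
Let b := phi_beta M.
Let lam := phi_nu M.
Let q := (2 ^ (M + (c + M)) %/ b)%N.
Let pM_gt0 : 0 < 2 ^+ M :> R. Proof. exact: exprn_gt0. Qed.
Let pc_gt0 : 0 < 2 ^+ c :> R. Proof. exact: exprn_gt0. Qed.

Lemma dyadic_nameP phi (x : R) k : dyadic_name phi x ->
  2 ^+ k * x - 1 <= (phi k)%:R <= 2 ^+ k * x + 1.
Proof.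
move=> /(_ k); have p0 : 0 < 2 ^+ k :> R by rewrite exprn_gt0.
rewrite ler_distlC => /andP[h1 h2].
have e : 2 ^+ k * ((phi k)%:R / 2 ^+ k) = (phi k)%:R :> R by rewrite mulrC divfK ?gt_eqF.
have f : 2 ^+ k * 2 ^- k = 1 :> R by rewrite divff ?gt_eqF.
move: h1 h2; rewrite -(ler_pM2l p0) -[in X in _ -> X -> _](ler_pM2l p0) mulrBr mulrDr e f.
by move=> -> ->.
Qed.

(** As [expR beta > 1], the integer [b] exceeds [2 ^ M - 1]. This makes the quotient [q] at most
    [2 ^ L], a genuine threshold. *)
Lemma phi_beta_ge : (2 ^ M <= b)%N.
Proof.
have /andP[h _] := dyadic_nameP M betaP; rewrite -/b in h.
have e1 : 1 < expR beta by rewrite -expR0 ltr_expR.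
have : (2 ^ M)%:R < b.+1%:R :> R.
  have : 2 ^+ M < 2 ^+ M * expR beta by rewrite ltr_pMr.
  by rewrite natrX -natr1; lra.
by rewrite ltr_nat.
Qed.

Lemma phi_nu_le : (lam <= 2 ^ L)%N.
Proof.
have /andP[_ h] := dyadic_nameP M nuP; rewrite -/lam in h.
have p1 : 1 <= 2 ^+ M :> R by rewrite exprn_ege1 // ler1n.
have en := expR_gt0 nu.
have : lam%:R <= (2 ^ L)%:R :> R.
  have h2 : 2 ^+ M * (1 + expR nu) <= 2 ^+ M * 2 ^+ c by rewrite ler_pM2l //; move: c_nu en; lra.
  rewrite natrX /L exprD [2 ^+ c * _]mulrC; apply: le_trans h2.
  by rewrite mulrDr mulr1; lra.
by rewrite ler_nat.
Qed.

Lemma lam_coin : `|coin_prob R L lam - expR nu / 2 ^+ c| <= 2 ^- M.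
Proof.
rewrite /coin_prob (minn_idPl phi_nu_le) /L exprD.
have h := nuP M; rewrite distrC -/lam in h.
have -> : lam%:R / (2 ^+ c * 2 ^+ M) - expR nu / 2 ^+ c =
    (lam%:R / 2 ^+ M - expR nu) / 2 ^+ c :> R.
  by field; rewrite !gt_eqF.
rewrite normrM normfV (gtr0_norm pc_gt0) ler_pdivrMr //.
apply: le_trans h _; rewrite ler_peMr ?invr_ge0 ?(ltW pM_gt0) //.
by rewrite exprn_ege1 // ler1n.
Qed.

Lemma unit_coin : coin_prob R L (2 ^ M) = 1 / 2 ^+ c.
Proof.
rewrite /coin_prob (minn_idPl _); last by rewrite leq_exp2l // leq_addl.
by rewrite natrX /L exprD; field; rewrite !gt_eqF.
Qed.

(** One [2 ^- M] is the rounding of the division, the other the error of the name of [expR beta].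
    Inversion does not amplify it, since [expR beta] and its approximation are at least 1. *)
Lemma beta_coin : `|coin_prob R L q - expR (- beta)| <= 2 * 2 ^- M.
Proof.
have bge := phi_beta_ge.
have b0 : (0 < b)%N by apply: leq_trans bge; rewrite expn_gt0.
have b0R : 0 < b%:R :> R by rewrite ltr0n.
have bgeR : 2 ^+ M <= b%:R :> R by rewrite -natrX ler_nat.
have eb := expR_gt0 beta.
have e1 : 1 < expR beta by rewrite -expR0 ltr_expR.
have qle : (q <= 2 ^ L)%N.
  rewrite /q expnD; apply: leq_trans (leq_div2l _ _ bge) _; first by rewrite expn_gt0.
  by rewrite mulKn ?expn_gt0.
rewrite /coin_prob (minn_idPl qle).
have pL0 : 0 < 2 ^+ L :> R by rewrite exprn_gt0.
have h1 : `|q%:R / 2 ^+ L - 2 ^+ M / b%:R : R| <= 2 ^- M.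
  have qE : (2 ^ (M + (c + M)))%:R = q%:R * b%:R + (2 ^ (M + (c + M)) %% b)%:R :> R.
    by rewrite -natrM -natrD /q -divn_eq.
  set rr : R := (_ %% _)%:R in qE.
  have r0 : 0 <= rr by rewrite ler0n.
  have rb : rr <= b%:R by rewrite ler_nat ltnW // ltn_pmod.
  have qE' : 2 ^+ M = (q%:R * b%:R + rr) / 2 ^+ L :> R.
    rewrite -qE natrX exprD -/L; field.
    by rewrite gt_eqF.
  have dE : q%:R / 2 ^+ L - 2 ^+ M / b%:R = - (rr / b%:R / 2 ^+ L) :> R.
    by rewrite {1}qE'; field; rewrite !gt_eqF.
  rewrite dE.
  rewrite normrN ger0_norm ?divr_ge0 ?(ltW pL0) ?(ltW b0R) //.
  apply: le_trans (_ : 1 / 2 ^+ L <= _).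
    by rewrite ler_pM2r ?invr_gt0 // ler_pdivrMr // mul1r.
  by rewrite mul1r lef_pV2 ?posrE // /L exprD ler_peMl ?(ltW pM_gt0) // exprn_ege1 // ler1n.
have h2 : `|2 ^+ M / b%:R - expR (- beta)| <= 2 ^- M.
  have := betaP M; rewrite -/b => h.
  have -> : 2 ^+ M / b%:R - expR (- beta) =
     (expR beta - b%:R / 2 ^+ M) * ((2 ^+ M / b%:R) / expR beta).
    by rewrite expRN; field; rewrite !gt_eqF.
  rewrite normrM; apply: le_trans (ler_pM _ _ h (_ : _ <= 1)) _; rewrite ?mulr1 //.
  rewrite ger0_norm; last by rewrite divr_ge0 ?(ltW eb) // divr_ge0 ?(ltW pM_gt0) // ltW.
  rewrite ler_pdivrMr // mul1r; apply: le_trans (ltW e1).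
  by rewrite ler_pdivrMr // mul1r.
apply: le_trans (ler_distD (2 ^+ M / b%:R) _ _) _; lra.
Qed.

Lemma coin_prob01 l k : 0 <= coin_prob R l k <= 1.
Proof.
rewrite /coin_prob divr_ge0 //= ler_pdivrMr ?exprn_gt0 // mul1r -natrX ler_nat.
exact: geq_minr.
Qed.

Lemma expr_dist (x y : R) k : 0 <= x <= 1 -> 0 <= y <= 1 -> `|x ^+ k - y ^+ k| <= k%:R * `|x - y|.
Proof.
move=> /andP[x0 x1] /andP[y0 y1]; elim: k => [|k IH]; first by rewrite subrr normr0 mul0r.
have -> : x ^+ k.+1 - y ^+ k.+1 = x * (x ^+ k - y ^+ k) + (x - y) * y ^+ k.
  by rewrite !exprS; ring.
apply: le_trans (ler_normD _ _) _; rewrite -natr1 [leRHS]mulrDl mul1r; apply: lerD.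
  by rewrite normrM (ger0_norm x0); apply: le_trans IH; apply: ler_piMl.
by rewrite normrM; apply: ler_piMr => //; rewrite ger0_norm ?exprn_ge0 // exprn_ile1.
Qed.

Variables (G : sgraph) (sq : seq G).

Lemma accept_prob01 s e : 0 <= accept_prob R sq L q lam (2 ^ M) s e <= 1.
Proof.
rewrite /accept_prob; have /andP[p0 p1] := coin_prob01 L q.
have /andP[r0 r1] := coin_prob01 L (if s e then (2 ^ M)%N else lam).
by rewrite mulr_ge0 ?exprn_ge0 //= mulr_ile1 ?exprn_ge0 // exprn_ile1.
Qed.

(** At most [size sq] tosses with error [2 * 2 ^- M] each, and one field coin with error
    [2 ^- M]. *)
Lemma accept_prob_close s e :
  `|accept_prob R sq L q lam (2 ^ M) s e - exact_acc beta nu sq c s e| <=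
  ((size sq).*2.+1)%:R * 2 ^- M.
Proof.
rewrite /accept_prob /exact_acc; set k := (_ - _)%N.
have kn : (k <= size sq)%N by rewrite /k; apply: leq_trans (leq_subr _ _) (count_size _ _).
set p := coin_prob R L q; set p' := coin_prob R L _.
set a := expR (- beta); set a' := _ / 2 ^+ c.
have a01 : 0 <= a <= 1 by rewrite expR_ge0 /= -expR0 ler_expR oppr_le0 ltW.
have p01 := coin_prob01 L q; have p'01 := coin_prob01 L (if s e then (2 ^ M)%N else lam).
have i0 : 0 <= 2 ^- M :> R by rewrite invr_ge0 ltW.
have pa := beta_coin; rewrite -/p -/a in pa.
have pa' : `|p' - a'| <= 2 ^- M.
  by rewrite /p' /a'; case: (s e); [rewrite unit_coin subrr normr0|exact: lam_coin].
have -> : p ^+ k * p' - a ^+ k * a' = (p ^+ k - a ^+ k) * p' + a ^+ k * (p' - a') by ring.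
apply: le_trans (ler_normD _ _) _.
have -> : ((size sq).*2.+1)%:R * 2 ^- M = (size sq)%:R * (2 * 2 ^- M) + 2 ^- M :> R.
  by rewrite -natr1 -muln2 natrM; ring.
have kR : k%:R <= (size sq)%:R :> R by rewrite ler_nat.
move/andP: a01 => [a0 a1]; move/andP: p'01 => [q0 q1].
apply: lerD; rewrite normrM.
  apply: le_trans (_ : `|p ^+ k - a ^+ k| <= _).
    by apply: ler_piMr => //; rewrite ger0_norm.
  apply: le_trans (expr_dist k p01 _) _; first by rewrite a0.
  by apply: ler_pM.
by rewrite ger0_norm ?exprn_ge0 //; apply: le_trans pa'; apply: ler_piMl => //; rewrite exprn_ile1.
Qed.

End Coins.

(** For [M = 4 * N] steps at precision [M]. The four factors [2 ^ N] of the right side absorb 16,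
    [N], [N] and [2 ^ ell]. *)
Lemma precision_suffices n ell N : (n < N)%N -> (ell < N)%N -> (4 <= N)%N ->
  (4 * N * (2 * n.*2.+1) * 2 ^ ell <= 2 ^ (4 * N))%N.
Proof.
move=> nN lN N4.
have e1 : (2 ^ ell <= 2 ^ N)%N by rewrite leq_exp2l // ltnW.
have e2 : (16 <= 2 ^ N)%N by rewrite -(leq_exp2l 4 N (isT : (1 < 2)%N)) in N4.
have e3 : (N <= 2 ^ N)%N by rewrite ltnW // ltn_expl.
have -> : (2 ^ (4 * N) = 2 ^ N * 2 ^ N * 2 ^ N * 2 ^ N)%N by rewrite -!expnD; congr (2 ^ _)%N; lia.
apply: leq_mul e1.
apply: (@leq_trans (16 * N * N)%N); first by nia.
by rewrite leq_mul // leq_mul.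
Qed.

Lemma horizon_large ell n p c1 : (n < p)%N -> (4 <= c1)%N ->
  [/\ (n < ell.+1 * p * c1)%N, (ell < ell.+1 * p * c1)%N & (4 <= ell.+1 * p * c1)%N].
Proof.
move=> np c4; have p0 : (0 < p)%N by apply: leq_trans np.
have lp : (ell < ell.+1 * p)%N by rewrite leq_pmulr.
have pl : (p <= ell.+1 * p)%N by rewrite leq_pmull.
have c0 : (0 < c1)%N by apply: leq_trans c4.
split.
- by apply: leq_trans (leq_pmulr _ c0); apply: leq_trans np pl.
- by apply: leq_trans (leq_pmulr _ c0).
- by apply: leq_trans c4 _; rewrite leq_pmull // muln_gt0.
Qed.

(** * Distance of the simulated chain from the Gibbs distribution *)

Section SamplerError.
Variables (R : realType) (beta nu : R) (phi_beta phi_nu : nat -> nat) (c c1 ell : nat).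
Variables (Gamma : sgraph).
Local Notation G := (line_graph Gamma).
Variable sq : seq G.
Hypothesis beta_gt0 : 0 < beta.
Hypothesis betaP : dyadic_name phi_beta (expR beta).
Hypothesis nuP : dyadic_name phi_nu (expR nu).
Hypothesis c_nu : 2 * (1 + expR nu) <= 2 ^+ c.
Hypothesis c1_ge4 : (4 <= c1)%N.
Hypothesis c1_large : 2 * gap_const beta nu c * (beta + `|nu| + 3) <= c1%:R.
Hypothesis sq_uniq : uniq sq.
Hypothesis sq_all : forall e : G, e \in sq.
Let n := size sq.
(** 24 is the 22 of the gap plus 2 for the logarithm of the inverse probability of the start;
    [ell.+1] provides the accuracy [2 ^- ell]. *)
Let M := (ell.+1 * n.+1 ^ 24 * (4 * c1))%N.
Let b := phi_beta M.
Let lam := phi_nu M.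
Let q := (2 ^ (M + (c + M)) %/ b)%N.
Let r := up_log 2 n.
Let P' := metropolis r (accept_prob R sq (c + M) q lam (2 ^ M)).
Let P := metropolis r (exact_acc beta nu sq c).
Let x0 : {ffun G -> bool} := [ffun=> false].

Lemma perturb_error : \sum_y `|kpow P' M x0 y - kpow P M x0 y| <= 2 ^- ell.
Proof.
have sP : stochastic P by apply: exact_stochastic.
have sP' : stochastic P'.
  by apply: metropolis_stochastic; [exact: up_log_large|exact: accept_prob01].
apply: le_trans (kpow_perturb (eta := 2 * ((n.*2.+1)%:R * 2 ^- M)) M x0 sP sP' _) _.
  move=> x; apply: metropolis_perturb; first exact: up_log_large.
    by apply: mulr_ge0; [exact: ler0n|rewrite invr_ge0; apply: exprn_ge0; exact: ler0n].
  by move=> e; apply: accept_prob_close.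
have pM : 0 < 2 ^+ M :> R by rewrite exprn_gt0.
have pl : 0 < 2 ^+ ell :> R by rewrite exprn_gt0.
have -> : M%:R * (2 * ((n.*2.+1)%:R * 2 ^- M)) = (M * (2 * n.*2.+1))%N%:R / 2 ^+ M :> R.
  by rewrite !natrM; ring.
rewrite ler_pdivrMr // mulrC ler_pdivlMr // -!natrX -natrM ler_nat.
have pos : (0 < n.+1 ^ 24)%N by rewrite expn_gt0.
have n1 : (n < n.+1 ^ 24)%N by have := @leq_pexp2l n.+1 1 24 isT isT; rewrite expn1.
pose N := (ell.+1 * n.+1 ^ 24 * c1)%N.
have -> : M = (4 * N)%N by rewrite /M /N; lia.
by have [? ? ?] := horizon_large ell n1 c1_ge4; apply: precision_suffices.
Qed.

Lemma mixing_error : \sum_y `|kpow P M x0 y - gibbs beta nu y| <= 2 ^- ell.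
Proof.
have S0 : 0 <= \sum_y `|kpow P M x0 y - gibbs beta nu y| by apply: sumr_ge0.
have p0 : 0 <= 2 ^- ell :> R by rewrite invr_ge0 exprn_ge0.
rewrite -(ler_pXn2r (isT : (0 < 2)%N)) ?nnegrE //.
apply: le_trans (exact_mixing beta_gt0 sq_uniq sq_all c_nu M) _.
set n1 : R := _.+1%:R; set g := gap_const _ _ _; set k := beta + `|nu| + 1.
have g1 : 1 <= g by apply: gap_const_ge1.
have n11 : 1 <= n1 by rewrite ler1n.
have k0 : 0 <= k by rewrite /k !addr_ge0 // ltW.
have -> : 2 ^- ell ^+ 2 = expR (- (ln 4 * ell%:R)) :> R.
  rewrite expRN expRM_natr lnK ?posrE // exprVn -exprM mulnC exprM; congr (_ ^+ _)^-1.
  by ring.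
have aux (x y X : R) : y + x <= X -> x - X <= - y by lra.
rewrite ler_expR; apply: aux.
have l4 : ln 4 <= 2 :> R.
  have -> : 4 = 2 * 2 :> R by ring.
  have := @le_ln1Dx R 1; rewrite (_ : 1 + 1 = 2 :> R); last by ring.
  move=> /(_ ltac:(lra)) l2; rewrite lnM ?posrE //; lra.
have ME : M%:R / (2 * (g * n1 ^+ 22)) = ell.+1%:R * n1 ^+ 2 * (4 * c1%:R / (2 * g)).
  have -> : M%:R = ell.+1%:R * n1 ^+ 24 * (4 * c1%:R) :> R.
    have e24 : (n.+1 ^ 24)%:R = n1 ^+ 24 :> R by rewrite natrX /n1 -(size_sq sq_uniq sq_all).
    by rewrite /M natrM [(ell.+1 * _)%:R]natrM e24 natrM.
  by field; rewrite !gt_eqF // (lt_le_trans ltr01).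
rewrite ME.
have cg : k + 2 <= 4 * c1%:R / (2 * g).
  rewrite ler_pdivlMr; last by lra.
  have := c1_large; rewrite -/g (_ : beta + `|nu| + 3 = k + 2); last by rewrite /k; ring.
  have : 0 <= c1%:R :> R by [].
  by move=> c0 h; lra.
have l0 : 0 <= ell%:R :> R by [].
have n12 : 1 <= n1 ^+ 2 by rewrite exprn_ege1.
apply: le_trans (_ : ell.+1%:R * n1 ^+ 2 * (k + 2) <= _); last first.
  by apply: ler_wpM2l cg; rewrite mulr_ge0 // (le_trans _ n12).
rewrite -[ell.+1%:R]natr1.
have h1 : ln 4 * ell%:R <= 2 * ell%:R :> R by apply: ler_wpM2r.
have h2 : ell%:R * 1 <= ell%:R * n1 ^+ 2 by apply: ler_wpM2l.
have h3 : 0 <= ell%:R * n1 ^+ 2 by rewrite mulr_ge0 // (le_trans _ n12).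
have h4 : 0 <= ell%:R * n1 ^+ 2 * k by rewrite mulr_ge0.
have -> : (ell%:R + 1) * n1 ^+ 2 * (k + 2) =
   ell%:R * n1 ^+ 2 * k + 2 * (ell%:R * n1 ^+ 2) + k * n1 ^+ 2 + 2 * n1 ^+ 2 by ring.
by lra.
Qed.

Lemma sampler_error :
  tv_distance (kpow P' M x0) (gibbs beta nu (G := G)) <= 2 ^- ell.
Proof.
rewrite /tv_distance.
have := lerD perturb_error mixing_error; rewrite -big_split /= => h.
have : \sum_y `|kpow P' M x0 y - gibbs beta nu y| <= 2 ^- ell + 2 ^- ell.
  by apply: le_trans h; apply: ler_sum => y _; apply: ler_distD.
by lra.
Qed.

End SamplerError.

(** * Reading the tolerance *)

Section Tolerance.
Variables (R : realType) (delta : R) (phi : nat -> nat).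
Hypothesis delta_gt0 : 0 < delta.
Hypothesis phiP : dyadic_name phi delta.

Lemma pow2_above (x : R) : exists k, x <= 2 ^+ k.
Proof.
exists (Num.truncn `|x|).+1; apply: le_trans (ler_norm x) _.
apply: le_trans (ltW (truncnS_gt _)) _.
by rewrite -natrX ler_nat ltnW // ltn_expl.
Qed.

Lemma search_ends : exists ell, (forall k, (k < ell)%N -> (phi k < 2)%N) /\ (2 <= phi ell)%N.
Proof.
have ex : exists k, (2 <= phi k)%N.
  have [k hk] := pow2_above (3 / delta); exists k.
  have /andP[h _] := dyadic_nameP k phiP.
  rewrite ler_pdivrMr // in hk.
  by rewrite -(ler_nat R); lra.
have [ell ge2 min] := ex_minnP ex; exists ell; split=> // k kl.
by rewrite ltnNge; apply: contraL kl => /min; rewrite -leqNgt.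
Qed.

Lemma tolerance_ge ell : (2 <= phi ell)%N -> 2 ^- ell <= delta.
Proof.
have /andP[_ h] := dyadic_nameP ell phiP; rewrite -(ler_nat R) => h2.
have p0 : 0 < 2 ^+ ell :> R by rewrite exprn_gt0.
by rewrite -[2 ^- ell]mul1r ler_pdivrMr // mulrC; lra.
Qed.

Lemma pow2_le_log (m : nat) (z : R) : 0 < z -> 2 ^+ m <= 4 * z -> m%:R <= 2 + 2 * `|ln z|.
Proof.
move=> z0 h.
have l2 : 2^-1 <= ln 2 :> R.
  rewrite -[leLHS]expRK ler_ln ?posrE ?expR_gt0 //.
  rewrite -[leRHS]invrK -[leLHS]invrK lef_pV2 ?posrE ?invr_gt0 ?expR_gt0 // -expRN.
  by have := @expR_ge1Dx R (- 2^-1); lra.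
have hl : m%:R * ln 2 <= 2 * ln 2 + ln z.
  rewrite -(ler_expR) expRD !expRM_natl lnK ?posrE // lnK ?posrE //.
  by apply: le_trans h _; rewrite ler_pM2r //; lra.
have nz := ler_norm (ln z); have n0 := normr_ge0 (ln z).
have [m2|m2] := leP (m%:R : R) 2; first by lra.
have : (m%:R - 2) * 2^-1 <= (m%:R - 2) * ln 2 :> R by apply: ler_wpM2l l2; lra.
by move=> ?; lra.
Qed.

(** At precision [ell - 1] the answer was at most 1, so [2 ^+ ell <= 4 / delta]. The absolute value
    covers tolerances above 1. *)
Lemma search_depth_le ell : (forall k, (k < ell)%N -> (phi k < 2)%N) ->
  ell%:R <= 2 + 2 * `|ln delta^-1|.
Proof.
case: ell => [|l] below; first by rewrite addr_ge0 // mulr_ge0.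
apply: pow2_le_log; first by rewrite invr_gt0.
rewrite ler_pdivlMr // exprS.
have /andP[h _] := dyadic_nameP l phiP.
have : (phi l)%:R <= 1 :> R by rewrite (ler_nat R _ 1) -ltnS below.
by lra.
Qed.

(** If the search does not stop at once, its last answer is at most 5, because the previous one was
    at most 1. If it does, the answer is about [delta] and may be large. *)
Lemma search_answer_le ell : (forall k, (k < ell)%N -> (phi k < 2)%N) -> (2 <= phi ell)%N ->
  (trunc_log 2 (phi ell))%:R <= 2 + 2 * `|ln delta^-1|.
Proof.
move=> below above; set m := trunc_log _ _.
have mle : (2 ^ m)%:R <= (phi ell)%:R :> R.
  by rewrite ler_nat trunc_logP // (leq_trans _ above).
rewrite natrX in mle.
have /andP[_ h] := dyadic_nameP ell phiP.
have above' : 2 <= (phi ell)%:R :> R by rewrite ler_nat.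
rewrite lnV ?posrE // normrN.
case: ell below @m mle h above above' => [|l] below m mle h above above'.
  by apply: pow2_le_log => //; rewrite expr0 mul1r in h; lra.
have /andP[hl _] := dyadic_nameP l phiP.
have bl : (phi l)%:R <= 1 :> R by rewrite (ler_nat R _ 1) -ltnS below.
have m2 : (m <= 2)%N.
  rewrite leqNgt; apply/negP => m3.
  have : 2 ^+ 3 <= 2 ^+ m :> R by rewrite ler_weXn2l // ler1n.
  by rewrite exprS in h; rewrite !exprS expr0; lra.
apply: le_trans (_ : 2 <= _); first by rewrite ler_nat.
by rewrite lerDl mulr_ge0.
Qed.

End Tolerance.

Lemma total_cost_le (c M n ell ul N tl ta tb : nat) : (0 < M)%N ->
  (n <= M)%N -> (ell < M)%N -> (ul <= M)%N -> (N <= M)%N ->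
  (ta <= c + M)%N -> (tb <= c + M)%N ->
  ((ell + tl + 10) * ell.+1 + (6 * N + 10) * 25 + 60 * M + 22 * c + ta + tb + 100 +
   ((10 * (c + M) + 50) * n + 12 * ul + 10 * (c + M) + 90 + 3) * M + 12 * n + 310
   <= tl * M + (2000 + 44 * c) * M ^ 3)%N.
Proof.
move=> M0 nM lM uM NM taM tbM.
have h1 : ((ell + tl + 10) * ell.+1 <= (M + tl + 10) * M)%N by apply: leq_mul => //; lia.
have h2 : ((10 * (c + M) + 50) * n + 12 * ul + 10 * (c + M) + 90 + 3 <=
    (10 * (c + M) + 50) * M + 12 * M + 10 * (c + M) + 93)%N.
  have : ((10 * (c + M) + 50) * n <= (10 * (c + M) + 50) * M)%N by rewrite leq_mul2l nM orbT.
  by lia.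
have h3 := leq_mul h2 (leqnn M).
have m3 : (M ^ 3 = M * M * M)%N by rewrite !expnS expn0 muln1 mulnA.
have e2 : (M * M <= M ^ 3)%N by rewrite m3 leq_pmulr.
have e1 : (M <= M ^ 3)%N by apply: leq_trans e2; rewrite leq_pmulr.
have e0 : (1 <= M ^ 3)%N by apply: leq_trans e1.
have f2 : (c * (M * M) <= c * M ^ 3)%N by rewrite leq_mul2l e2 orbT.
have f1 : (c * M <= c * M ^ 3)%N by rewrite leq_mul2l e1 orbT.
have f0 : (c <= c * M ^ 3)%N by rewrite leq_pmulr.
have e3 : ((M * M * M)%N = M ^ 3)%N by rewrite m3.
move: h1 h3 e0 e1 e2 e3 f0 f1 f2; move: (M ^ 3)%N => M3.
have -> : ((M + tl + 10) * M = M * M + tl * M + 10 * M)%N by ring.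
have -> : (((10 * (c + M) + 50) * M + 12 * M + 10 * (c + M) + 93) * M =
  10 * (c * (M * M)) + 10 * (M * M * M) + 62 * (M * M) + 10 * (c * M) + 10 * (M * M) + 93 * M)%N by ring.
have -> : ((2000 + 44 * c) * M3 = 2000 * M3 + 44 * (c * M3))%N by ring.
move: ((ell + tl + 10) * ell.+1)%N => y1.
move: (((10 * (c + M) + 50) * n + 12 * ul + 10 * (c + M) + 90 + 3) * M)%N => y2.
move: (c * (M * M))%N => x3; move: (M * M * M)%N => x4; move: (M * M)%N (c * M)%N (c * M3)%N (tl * M)%N => x5 x2 x1 x6.
move: h2 => _.
by move=> *; lia.
Qed.

Section Correctness.
Variables (R : realType) (beta nu : R) (phi_beta phi_nu phi_delta : nat -> nat).
Variables (c c1 ell : nat) (Gamma : sgraph).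
Local Notation G := (line_graph Gamma).
Variable sq : seq G.
Hypothesis beta_gt0 : 0 < beta.
Hypothesis betaP : dyadic_name phi_beta (expR beta).
Hypothesis nuP : dyadic_name phi_nu (expR nu).
Hypothesis c_nu : 2 * (1 + expR nu) <= 2 ^+ c.
Hypothesis c1_ge4 : (4 <= c1)%N.
Hypothesis c1_large : 2 * gap_const beta nu c * (beta + `|nu| + 3) <= c1%:R.
Hypothesis sq_uniq : uniq sq.
Hypothesis sq_all : forall e : G, e \in sq.
Hypothesis below : forall k, (k < ell)%N -> (phi_delta k < 2)%N.
Hypothesis above : (2 <= phi_delta ell)%N.
Let n := size sq.
Let oracles := [:: phi_beta; phi_nu; phi_delta].
Let input := graph_code sq.
Let A := sampler 24 (4 * c1) c.

Variable M : nat.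
Hypothesis ME : M = (ell.+1 * (size sq).+1 ^ 24 * (4 * c1))%N.
Let lam := phi_nu M.
Let b := phi_beta M.
Let q := (2 ^ (M + (c + M)) %/ b)%N.
Let P' := metropolis (up_log 2 n) (accept_prob R sq (c + M) q lam (2 ^ M)).
Let x0 : {ffun G -> bool} := [ffun=> false].

Definition running_time : nat :=
  (init_cost oracles n 24 (4 * c1) c ell lam b + (step_cost sq (c + M) + 3) * M + 12 * n + 310)%N.
Local Notation T := running_time.

Lemma horizon_gt0 : (0 < M)%N.
Proof.
rewrite ME muln_gt0 muln_gt0 expn_gt0 /= muln_gt0 /=; exact: leq_trans c1_ge4.
Qed.

Lemma b_gt1 : (1 < b)%N.
Proof.
apply: leq_trans (phi_beta_ge M beta_gt0 betaP).
by rewrite -[1%N](expn0 2) ltn_exp2l // horizon_gt0.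
Qed.

(** Running time and output law are both obtained from this, with different observables [F]. *)
Lemma run_average (F : config -> R) (v : {ffun G -> bool} -> R) :
  (forall (sg : {ffun G -> bool}) (m : nat -> nat) t, (forall e, m (index e sq) = sg e) -> (t <= T)%N ->
     F (Config [::] m t) = v sg) ->
  (\sum_(bits : T.-tuple bool) F (run input oracles A bits)) / 2 ^+ T =
  \sum_y kpow P' M x0 y * v y.
Proof.
move=> hF; rewrite -(iter_glauber sq_uniq sq_all) -ev_sum.
have V := @outcome_sampler R input oracles F T G sq 24 (4 * c1) c ell M lam b v ME erefl erefl
  sq_uniq sq_all erefl below above b_gt1 hF.
by apply: V; rewrite /running_time; exact: leqnn.
Qed.

(** The indicator of halting within the budget has average 1 and is at most 1, so it is 1 for every
    sequence of bits: a worst case bound from an expectation. *)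
Lemma sampler_time : runs_in_time input oracles A T.
Proof.
pose F cf : R := (nilp (todo cf) && (cost cf <= T)%N)%:R.
have hF (sg : {ffun G -> bool}) (m : nat -> nat) t : (forall e, m (index e sq) = sg e) ->
    (t <= T)%N -> F (Config [::] m t) = 1.
  by move=> _ tT; rewrite /F /= tT.
have := @run_average F (fun=> 1) hF.
have -> : \sum_y kpow P' M x0 y * 1 = 1.
  under eq_bigr do rewrite mulr1.
  have sP' : stochastic P'.
    by apply: metropolis_stochastic; [exact: up_log_large|exact: accept_prob01].
  by case: (kpow_stochastic M sP').
move=> avg.
have {}avg : (\sum_(bits : T.-tuple bool) F (run input oracles A bits)) = 2 ^+ T.
  have p0 : 2 ^+ T != 0 :> R by rewrite expf_neq0.
  by apply: (mulIf (invr_neq0 p0)); rewrite divff.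
have s0 : \sum_(bits : T.-tuple bool) (1 - F (run input oracles A bits)) = 0.
  by rewrite sumrB avg sumr_const card_tuple card_bool natrX subrr.
have F1 cf : 0 <= 1 - F cf by rewrite /F subr_ge0; case: (_ && _).
move=> bits; have := psumr_eq0P (fun (i : T.-tuple bool) _ => F1 (run input oracles A i)) s0 (i := bits) isT.
rewrite /F; case: (nilp _) => /=; case: (_ <= _)%N => //= /eqP; rewrite subr0 oner_eq0 //.
Qed.

Lemma sampler_law sigma : output_law R sq oracles A T sigma = kpow P' M x0 sigma.
Proof.
pose F cf : R := (output_config sq cf == sigma)%:R.
rewrite /output_law.
have -> : #|[pred bits : T.-tuple bool | output_config sq (run input oracles A bits) == sigma]|%:R =
    \sum_(bits : T.-tuple bool) F (run input oracles A bits).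
  by rewrite -sum1_card natr_sum big_mkcond /=; apply: eq_bigr => bits _; rewrite /F inE; case: (_ == _).
rewrite (@run_average F (fun y => (y == sigma)%:R)).
  by under eq_bigr do rewrite mulrC; rewrite sum_eqr.
move=> sg m t mE _; rewrite /F; congr (_ == _)%:R.
by apply/ffunP => e; rewrite ffunE /= mE; case: (sg e).
Qed.

Lemma sampler_tv : tv_distance (output_law R sq oracles A T) (gibbs beta nu (G := G)) <= 2 ^- ell.
Proof.
have := sampler_error ell beta_gt0 betaP nuP c_nu c1_ge4 c1_large sq_uniq sq_all.
rewrite -ME; congr (_ <= _); rewrite /tv_distance; congr (_ * _).
by apply: eq_bigr => y _; rewrite sampler_law.
Qed.

Hypothesis c_beta : 1 + expR beta <= 2 ^+ c.

(** [c_nu] and [c_beta] bound the lengths of the oracle answers at precision [M] by [c + M]. *)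
Lemma running_time_le :
  (T <= trunc_log 2 (phi_delta ell) * M + (2000 + 44 * c) * M ^ 3)%N.
Proof.
have p0 : (0 < n.+1 ^ 24)%N by rewrite expn_gt0.
have np : (n < n.+1 ^ 24)%N by have := @leq_pexp2l n.+1 1 24 isT isT; rewrite expn1.
have [h1 h2 _] := horizon_large ell np (leq_trans c1_ge4 (leq_pmull c1 (isT : (0 < 4)%N))); rewrite -ME in h1 h2.
have h3 : (ell.+1 * n.+1 ^ 24 <= M)%N.
  by rewrite ME leq_pmulr // muln_gt0 /= (leq_trans _ c1_ge4).
have logle x : (0 < x)%N -> (x <= 2 ^ (c + M))%N -> (trunc_log 2 x <= c + M)%N.
  move=> x0' xle; rewrite -(@leq_exp2l 2) //.
  by apply: leq_trans xle; apply: trunc_logP.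
have ta : (trunc_log 2 lam <= c + M)%N.
  have := phi_nu_le M nuP c_nu; rewrite -/lam.
  by case: (posnP lam) => [-> _|l0]; [rewrite trunc_log0|exact: logle].
have tb : (trunc_log 2 b <= c + M)%N.
  apply: logle; first exact: ltnW b_gt1.
  have /andP[_ h] := dyadic_nameP M betaP; rewrite -/b in h.
  have p1 : 1 <= 2 ^+ M :> R by rewrite exprn_ege1 // ler1n.
  have h4 : 2 ^+ M * (1 + expR beta) <= 2 ^+ M * 2 ^+ c by apply: ler_wpM2l c_beta; apply: exprn_ge0; exact: ler0n.
  rewrite -(ler_nat R) natrX exprD [2 ^+ c * _]mulrC; apply: le_trans h4.
  by rewrite mulrDr mulr1; lra.
have ul : (up_log 2 n <= M)%N.
  apply: leq_trans (ltnW h1); apply: up_log_min => //.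
  by rewrite ltnW // ltn_expl.
have := total_cost_le (trunc_log 2 (phi_delta ell)) horizon_gt0 (ltnW h1) h2 ul h3 ta tb.
apply: leq_trans; rewrite /running_time /init_cost /step_cost -/n -ME.
by rewrite -!addnA.
Qed.

End Correctness.

(** [X] is the input size and [Y] is one plus the square of [ln delta^-1]. The horizon [M] is of
    order [Y * X ^+ 24], and the time is cubic in it. *)
Lemma running_time_poly (R : realType) (T tl M ell n c0 C : nat) (X Y : R) :
  (T <= tl * M + C * M ^ 3)%N -> M = (ell.+1 * n.+1 ^ 24 * c0)%N -> (0 < c0)%N ->
  1 <= X -> 1 <= Y -> ell.+1%:R <= 4 * Y -> tl%:R <= 3 * Y -> n.+1%:R <= 2 * X ->
  T%:R <= (3 + C%:R) * (4 * 2 ^+ 24 * c0%:R) ^+ 3 * (Y ^+ 3 * X ^+ 72).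
Proof.
move=> Tle ME c0_gt0 X1 Y1 hell htl hn.
pose B : R := 4 * Y * (2 * X) ^+ 24 * c0%:R.
have Y0 : 0 <= Y by apply: le_trans Y1.
have X0 : 0 <= X by apply: le_trans X1.
have c01 : 1 <= c0%:R :> R by rewrite ler1n.
have X24 : 1 <= (2 * X) ^+ 24 by rewrite exprn_ege1 //; lra.
have YB : Y <= B.
  have h1 : Y <= 4 * Y * (2 * X) ^+ 24 by rewrite -[leLHS]mulr1 ler_pM //; lra.
  by apply: le_trans h1 _; rewrite ler_peMr // mulr_ge0 ?(le_trans _ X24) // mulr_ge0.
have B1 : 1 <= B by apply: le_trans YB.
have B0 : 0 <= B by apply: le_trans B1.
have MB : M%:R <= B.
  have n24 : (n.+1 ^ 24)%:R <= (2 * X) ^+ 24 :> R.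
    by rewrite natrX lerXn2r // ?nnegrE // mulr_ge0.
  rewrite ME natrM [(ell.+1 * _)%:R]natrM /B ler_wpM2r //.
  exact: ler_pM (ler0n _ _) (ler0n _ _) hell n24.
have M0 : 0 <= M%:R :> R by rewrite ler0n.
have T1 : T%:R <= tl%:R * M%:R + C%:R * M%:R ^+ 3 :> R.
  by rewrite -natrX -!natrM -natrD ler_nat.
have h1 : tl%:R * M%:R <= 3 * B ^+ 3.
  apply: le_trans (_ : 3 * B * B <= _).
    apply: ler_pM => //; apply: le_trans htl _; lra.
  by rewrite -mulrA ler_wpM2l // !exprS expr0 mulr1 ler_wpM2l // ler_peMl.
have h2 : C%:R * M%:R ^+ 3 <= C%:R * B ^+ 3.
  by rewrite ler_wpM2l // lerXn2r // nnegrE.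
have BE : (4 * 2 ^+ 24 * c0%:R) ^+ 3 * (Y ^+ 3 * X ^+ 72) = B ^+ 3.
  have -> : X ^+ 72 = (X ^+ 24) ^+ 3 by rewrite -exprM.
  by rewrite /B [(2 * X) ^+ 24]exprMn; move: (X ^+ 24) (2 ^+ 24) => x t; ring.
by rewrite -mulrA BE mulrDl; lra.
Qed.

Lemma succ_le_double_square n : (n.+1 <= 2 * (n * n).+1)%N.
Proof. by case: n => // n; rewrite mulSn; lia. Qed.

Lemma horner_bound (R : comNzRingType) (C x y : R) k :
  ((C *: (1 + 'X^2) ^+ 3)%:P * 'X^k).[x, y] = C * ((1 + y ^+ 2) ^+ 3 * x ^+ k).
Proof.
by rewrite hornerM hornerC hornerXn hornerM hornerZ !horner_exp hornerD hornerXn !hornerC mulrA.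
Qed.

Theorem theorem2 (R : realType) (beta nu : R) (hbeta : 0 < beta) :
  exists (A : cmd) (p : {poly {poly R}}),
  forall phi_beta phi_nu : nat -> nat,
    dyadic_name phi_beta (expR beta) ->
    dyadic_name phi_nu (expR nu) ->
  forall (Gamma : sgraph) (s : seq (line_graph Gamma)),
    uniq s -> (forall v : line_graph Gamma, v \in s) ->
  forall (delta : R) (phi_delta : nat -> nat),
    0 < delta -> dyadic_name phi_delta delta ->
  let oracles := [:: phi_beta; phi_nu; phi_delta] in
  exists T : nat,
    [/\ T%:R <= p.[(size (graph_code s))%:R, ln delta^-1],
        runs_in_time (graph_code s) oracles A T
      & tv_distance (output_law R s oracles A T)
          (@gibbs R beta nu (line_graph Gamma)) <= delta].
Proof.
have [ca hca] := pow2_above (2 * (1 + expR nu)).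
have [cb hcb] := pow2_above (1 + expR beta).
pose c := (ca + cb)%N.
have c_nu : 2 * (1 + expR nu) <= 2 ^+ c.
  by apply: le_trans hca _; apply: ler_weXn2l; rewrite ?ler1n // leq_addr.
have c_beta : 1 + expR beta <= 2 ^+ c.
  by apply: le_trans hcb _; apply: ler_weXn2l; rewrite ?ler1n // leq_addl.
pose K := 2 * gap_const beta nu c * (beta + `|nu| + 3).
(* [c] and [c1] depend on [beta] and [nu] only, so they can be built into the program as
   constants. *)
pose c1 := ((Num.truncn K).+1 + 4)%N.
have c1_ge4 : (4 <= c1)%N by rewrite leq_addl.
have c1_large : K <= c1%:R.
  by apply: le_trans (ltW (truncnS_gt K)) _; rewrite ler_nat leq_addr.
pose C : R := (3 + (2000 + 44 * c)%N%:R) * (4 * 2 ^+ 24 * (4 * c1)%N%:R) ^+ 3.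
(* The inner variable is [ln delta^-1]; one plus its square dominates its absolute value, which is
   not polynomial, for tolerances on either side of 1. *)
exists (sampler 24 (4 * c1) c), ((C *: (1 + 'X^2) ^+ 3)%:P * 'X^72).
move=> phi_beta phi_nu betaP nuP Gamma s us alls delta phi_delta delta_gt0 deltaP oracles.
have [ell [below above]] := search_ends delta_gt0 deltaP.
pose M := (ell.+1 * (size s).+1 ^ 24 * (4 * c1))%N.
have ME : M = (ell.+1 * (size s).+1 ^ 24 * (4 * c1))%N by rewrite /M.
move: M ME => M ME.
exists (running_time phi_beta phi_nu phi_delta c c1 ell s M); split.
- set y := ln _.
  have -> : ((C *: (1 + 'X^2) ^+ 3)%:P * 'X^72).[(size (graph_code s))%:R, y] =
     C * ((1 + y ^+ 2) ^+ 3 * (size (graph_code s))%:R ^+ 72).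
    exact: horner_bound.
  have y2 : `|y| ^+ 2 = y ^+ 2 by rewrite real_normK // num_real.
  have ay : 2 * `|y| <= 1 + y ^+ 2 by have := sqr_ge0 (`|y| - 1); rewrite sqrrB expr1n mulr1 y2; lra.
  have h1 := search_depth_le delta_gt0 deltaP below.
  have h2 := search_answer_le delta_gt0 deltaP below above.
  have y0 : 0 <= y ^+ 2 by rewrite sqr_ge0.
  have sE : size (graph_code s) = (size s * size s).+1 by rewrite /= size_allpairs.
  apply: (running_time_poly (running_time_le phi_delta hbeta betaP nuP c_nu c1_ge4 ME c_beta) ME).
  + by rewrite muln_gt0.
  + by rewrite sE ler1n.
  + by rewrite lerDl.
  + by rewrite -[ell.+1%:R]natr1; lra.
  + by lra.
  + by rewrite sE -natrM ler_nat succ_le_double_square.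
- exact: (sampler_time hbeta betaP c1_ge4 us alls below above ME).
have tv := sampler_tv hbeta betaP nuP c_nu c1_ge4 c1_large us alls below above ME.
exact: le_trans tv (tolerance_ge deltaP above).
Qed.
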